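(* Let $\Lambda$ be an algebra which is $k$-Gorenstein for all positive integers $k$, and let $n$ be a non-negative integer. Then the following are equivalent: (1) $\Lambda$ is Iwanaga-Gorenstein with $\operatorname{id}_{\Lambda}\Lambda=\operatorname{id}_{\Lambda^{\rm op}}\Lambda\le n$. (2) $\operatorname{id}_{\Lambda}\Lambda\le n$. (3) $\operatorname{id}_{\Lambda^{\rm op}}\Lambda\le n$. (4) $\operatorname{tilt}\Lambda$ has the minimum element $T$ with $\operatorname{pd}_\Lambda T\le n$. (5) $\operatorname{tilt}\Lambda^{\rm op}$ has the minimum element $T$ with $\operatorname{pd}_{\Lambda^{\rm op}} T\le n$. (6) The subcategory $\mathcal{P}_\infty(\Lambda)$ of $\mathsf{mod}\,\Lambda$ is contravariantly finite and $\mathcal{P}_\infty(\Lambda)=\mathcal{P}_n(\Lambda)$ holds. (7) The subcategory $\mathcal{P}_\infty(\Lambda^{\rm op})$ of $\mathsf{mod}\,\Lambda^{\rm op}$ is contravariantly finite and $\mathcal{P}_\infty(\Lambda^{\rm op})=\mathcal{P}_n(\Lambda^{\rm op})$ holds.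
   Context: $K$ is an algebraically closed field; all algebras are basic connected finite dimensional $K$-algebras, and all modules are finitely generated right modules. $\mathsf{mod}\,\Lambda$ is the category of finitely generated right $\Lambda$-modules; $\mathsf{add}\,T$ is the full subcategory of direct summands of finite direct sums of copies of $T$; $\operatorname{pd}$ and $\operatorname{id}$ denote projective and injective dimension. $\Lambda^{\rm op}$ is the opposite algebra, and $\operatorname{id}_{\Lambda^{\rm op}}\Lambda$ is the injective dimension of $\Lambda$ as a right $\Lambda^{\rm op}$-module (i.e. left $\Lambda$-module). Let $0\to \Lambda\to I^0(\Lambda)\to I^1(\Lambda)\to\cdots$ be a minimal injective resolution of the right module $\Lambda$. $\Lambda$ is $k$-Gorenstein if $\operatorname{pd}_\Lambda I^i(\Lambda)\le i$ for all $0\le i\le k-1$. $\Lambda$ is Iwanaga-Gorenstein if both $\operatorname{id}_\Lambda\Lambda$ and $\operatorname{id}_{\Lambda^{\rm op}}\Lambda$ are finite. A module $T\in\mathsf{mod}\,\Lambda$ is a tilting module if its projective dimension is some $d<\infty$, $\operatorname{Ext}^i_\Lambda(T,T)=0$ for all $i\ge1$, and there is an exact sequence $0\to\Lambda\to T_0\to\cdots\to T_d\to0$ with all $T_i\in\mathsf{add}\,T$. Modules $M,N$ are additively equivalent if $\mathsf{add}\,M=\mathsf{add}\,N$. $\operatorname{tilt}\Lambda$ is the set of additive equivalence classes of tilting modules (of arbitrary finite projective dimension), partially ordered by: $T\ge U$ if $\operatorname{Ext}^i_\Lambda(T,U)=0$ for all $i>0$. For an integer $n\ge 0$, $\mathcal{P}_n(\Lambda)$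 is the full subcategory of $\mathsf{mod}\,\Lambda$ of modules of projective dimension at most $n$, and $\mathcal{P}_\infty(\Lambda)$ that of modules of finite projective dimension. A full subcategory $\mathcal{C}$ of $\mathsf{mod}\,\Lambda$ is contravariantly finite if for every $M\in\mathsf{mod}\,\Lambda$ there is a morphism $C_M\to M$ with $C_M\in\mathcal{C}$ such that $\operatorname{Hom}_\Lambda(C,C_M)\to\operatorname{Hom}_\Lambda(C,M)$ is surjective for all $C\in\mathcal{C}$. The same notions are used for $\Lambda^{\rm op}$. *)

(* Defs.v *)
From HB Require Import structures.
From mathcomp Require Import all_boot all_order all_algebra all_field.

Set Implicit Arguments.
Unset Strict Implicit.
Unset Printing Implicit Defensive.

Import GRing.Theory.
Local Open Scope ring_scope.

(* Everything is defined over a bare ring R, so that the same notions apply   *)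
(* to an algebra and to its opposite.  [oppring] must be used for the         *)
(* opposite: only the ring structure of R^c is the reversed one, whereas an   *)
(* algebra structure inferred on R^c would be that of R.                      *)
Definition oppring (R : nzRingType) : nzRingType := R^c.

Definition fin_gen (S : nzRingType) (M : lmodType S) : Prop :=
  exists (m : nat) (g : 'I_m -> M),
    forall x : M, exists c : 'I_m -> S, x = \sum_(i < m) c i *: g i.

(* Objects of mod R.  A right R-module is a left module over the converse     *)
(* ring R^c: (a *: x) stands for the right action x a.                        *)
Record rmod (R : nzRingType) := Rmod {
  rmod_car :> lmodType R^c;
  rmod_fin_gen : fin_gen rmod_car }.

Lemma regular_fin_gen (R : nzRingType) : fin_gen ((R^c)^o : lmodType R^c).
Proof.
exists 1%N, (fun _ => 1 : (R^c)^o) => x; exists (fun _ => x : R^c).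
by rewrite big_ord1 [RHS](mulr1 (x : R^c)).
Qed.

Definition regular (R : nzRingType) : rmod R := Rmod (@regular_fin_gen R).

Section Modules.

Variable R : nzRingType.
Implicit Types M N T U X : rmod R.

Definition trivial_mod (M : lmodType R^c) : Prop := forall x : M, x = 0.

Definition isomorphic (M N : lmodType R^c) : Prop :=
  exists f : {linear M -> N}, bijective f.

Definition indecomposable (M : lmodType R^c) : Prop :=
  ~ trivial_mod M /\
  forall N1 N2 : lmodType R^c,
    isomorphic M (N1 * N2)%type -> trivial_mod N1 \/ trivial_mod N2.

Definition exact_at (A B C : lmodType R^c) (f : A -> B) (g : B -> C) : Prop :=
  forall y : B, g y = 0 <-> exists x : A, f x = y.

Definition surj (A B : Type) (f : A -> B) : Prop :=
  forall y : B, exists x : A, f x = y.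

Definition projective (P : rmod R) : Prop :=
  forall M N (p : {linear M -> N}) (f : {linear P -> N}),
    surj p -> exists g : {linear P -> M}, forall x, p (g x) = f x.

Definition injective_mod (I : rmod R) : Prop :=
  forall M N (j : {linear M -> N}) (f : {linear M -> I}),
    injective j -> exists g : {linear N -> I}, forall x, g (j x) = f x.

(* Exact sequences ... -> X_1 -> X_0 -> M -> 0. *)
Record resolution (M : rmod R) := Resolution {
  res_ob :> nat -> rmod R;
  res_aug : {linear res_ob 0%N -> M};
  res_diff : forall i, {linear res_ob i.+1 -> res_ob i};
  res_aug_surj : surj res_aug;
  res_exact0 : exact_at (res_diff 0%N) res_aug;
  res_exact : forall i, exact_at (res_diff i.+1) (res_diff i) }.

(* Exact sequences 0 -> M -> X^0 -> X^1 -> ... *)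
Record coresolution (M : rmod R) := Coresolution {
  cores_ob :> nat -> rmod R;
  cores_aug : {linear M -> cores_ob 0%N};
  cores_diff : forall i, {linear cores_ob i -> cores_ob i.+1};
  cores_aug_inj : injective cores_aug;
  cores_exact0 : exact_at cores_aug (cores_diff 0%N);
  cores_exact : forall i, exact_at (cores_diff i) (cores_diff i.+1) }.

Definition pd_le M (n : nat) : Prop :=
  exists P : resolution M,
    (forall i, projective (P i)) /\ forall i, (n < i)%N -> trivial_mod (P i).

Definition id_le M (n : nat) : Prop :=
  exists I : coresolution M,
    (forall i, injective_mod (I i)) /\ forall i, (n < i)%N -> trivial_mod (I i).

Definition is_least (p : nat -> Prop) (d : nat) : Prop :=
  p d /\ forall m, p m -> (d <= m)%N.

(* pd M = d < oo and id M = d < oo; both are 0 for the zero module. *)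
Definition pd_eq M (d : nat) : Prop := is_least (pd_le M) d.
Definition id_eq M (d : nat) : Prop := is_least (id_le M) d.

(* Ext^i(M, N) = 0: the i-th cohomology of Hom(P, N) vanishes for a           *)
(* projective resolution P of M (it does not depend on the choice of P).      *)
Definition cohomology_vanishes M N (P : resolution M) (i : nat) : Prop :=
  match i with
  | 0%N => forall f : {linear P 0%N -> N},
      (forall x, f (res_diff P 0%N x) = 0) -> forall x, f x = 0
  | j.+1 => forall f : {linear P j.+1 -> N},
      (forall x, f (res_diff P j.+1 x) = 0) ->
      exists g : {linear P j -> N}, forall x, f x = g (res_diff P j x)
  end.

Definition Ext_vanishes (i : nat) M N : Prop :=
  exists P : resolution M,
    (forall j, projective (P j)) /\ cohomology_vanishes N P i.

Definition submodule (M : lmodType R^c) (S : M -> Prop) : Prop :=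
  S 0 /\ forall (a : R^c) (x y : M), S x -> S y -> S (a *: x + y).

Definition essential_image (M N : lmodType R^c) (f : M -> N) : Prop :=
  forall S : N -> Prop, submodule S -> (exists2 y, S y & y <> 0) ->
    exists2 x, S (f x) & f x <> 0.

Definition minimal_injective_resolution M (I : coresolution M) : Prop :=
  [/\ forall i, injective_mod (I i),
      essential_image (cores_aug I) &
      forall i, essential_image (cores_diff I i)].

(* A minimal injective resolution exists and is unique up to isomorphism. *)
Definition k_Gorenstein (k : nat) : Prop :=
  exists I : coresolution (regular R),
    minimal_injective_resolution I /\
    forall i : nat, (i < k)%N -> pd_le (I i) i.

(* M is a direct summand of T^m for some m. *)
Definition in_add T M : Prop :=
  exists (m : nat) (N : lmodType R^c), isomorphic (M * N)%type {ffun 'I_m -> T}.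

Definition add_equiv M N : Prop := forall X, in_add M X <-> in_add N X.

Definition tilting T : Prop :=
  exists d : nat,
    [/\ pd_eq T d,
        forall i, (1 <= i)%N -> Ext_vanishes i T T &
        exists C : coresolution (regular R),
          (forall i, in_add T (C i)) /\
          forall i, (d < i)%N -> trivial_mod (C i)].

(* Elements of tilt R: the additive equivalence classes of tilting modules,   *)
(* as predicates on modules.                                                  *)
Definition tilt (C : rmod R -> Prop) : Prop :=
  exists2 T, tilting T & forall U, C U <-> tilting U /\ add_equiv T U.

Definition tilt_ge (C D : rmod R -> Prop) : Prop :=
  forall T U, C T -> D U -> forall i, (0 < i)%N -> Ext_vanishes i T U.

Definition tilt_minimum (C : rmod R -> Prop) : Prop :=
  tilt C /\ forall D, tilt D -> tilt_ge D C.

Definition tilt_has_minimum_pd_le (n : nat) : Prop :=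
  exists C, tilt_minimum C /\ exists T, C T /\ pd_le T n.

Definition Pn (n : nat) : rmod R -> Prop := fun M => pd_le M n.
Definition Pinfty : rmod R -> Prop := fun M => exists n, pd_le M n.

Definition contravariantly_finite (C : rmod R -> Prop) : Prop :=
  forall M, exists CM, C CM /\
    exists f : {linear CM -> M},
      forall X, C X -> forall g : {linear X -> M},
        exists h : {linear X -> CM}, forall x, f (h x) = g x.

(* In a decomposition of R into indecomposable right modules, distinct        *)
(* summands are non-isomorphic.                                               *)
Definition basic : Prop :=
  forall P Q N : rmod R, indecomposable P -> indecomposable Q ->
    isomorphic (regular R) (P * Q * N)%type -> ~ isomorphic P Q.

End Modules.

Arguments tilt_has_minimum_pd_le : clear implicits.
Arguments Pn : clear implicits.
Arguments Pinfty : clear implicits.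
Arguments k_Gorenstein : clear implicits.
Arguments basic : clear implicits.

Definition Iwanaga_Gorenstein (R : nzRingType) : Prop :=
  (exists m, id_le (regular R) m) /\
  (exists m, id_le (regular (oppring R)) m).

Definition connected (K : fieldType) (A : falgType K) : Prop :=
  forall (B C : falgType K) (f : {lrmorphism A -> (B * C)%type}), ~ bijective f.

(* Main.v *)
Require Import Defs.
From HB Require Import structures.
From mathcomp Require Import all_boot all_order all_algebra all_field.
From mathcomp Require Import boolp zify.

(** The argument.  Let L be the algebra and W = D(L) for D = Hom_K(-, K).  The
    minimality of the injective resolution 0 -> L -> I^0 -> I^1 -> ... plays no
    role, only pd I^i <= i does.

    The condition passes to the opposite algebra, that is, W has a projective
    resolution whose i-th term has injective dimension at most i.  It suffices
    that every X with id X <= j is a quotient of a projective module of injective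
    dimension at most j.  By induction on j, I^i has for i <= j a projective
    resolution ending in a projective Q^i with id Q^i <= i; splicing these yields
    0 -> L -> Q^0 + ... + Q^j -> V -> 0 with V a j-th syzygy, so that
    Ext^1(V, X) = 0 and every map L -> X extends to Q^0 + ... + Q^j.

    Let C be the (n+1)-st cosyzygy of L; it is a summand of the tilting module
    I^0 + ... + I^n + C and has finite projective dimension.  In (4) and in (6)
    this forces Ext^(n+1)(C, L) = 0, whence id L <= n.

    Suppose id L <= n.  Then the projective modules have finite coresolutions by
    injectives of finite projective dimension.  The Euler characteristics
    sum (-1)^i dim Ext^i(-, S), S simple, are linearly independent on the
    indecomposable projectives, so their number forces every indecomposable
    injective to occur in these coresolutions; hence pd W is finite, and then at
    most n, which is (3).  When both id L <= n and pd W <= n, the module W is the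
    minimum of tilt L, and approximations by modules of finite projective
    dimension are built from approximations by injectives. *)

Set Implicit Arguments.
Unset Strict Implicit.
Unset Printing Implicit Defensive.

Import GRing.Theory.
Local Open Scope ring_scope.

(** Ext groups are never constructed: only their vanishing is used, read as an extension property of
    maps, and the long exact sequence is reduced to implications between vanishing statements. The
    opposite algebra is available only as a bare ring, so the homological arguments rest on a short
    list of properties of a module category. These are checked in coordinates over K, for the
    algebra and its opposite alike, through an anti-isomorphism.

    The count of injectives needs control over the hulls that might be missing. Let T be a simple
    module in the socle of no injective of finite projective dimension. The coresolution of L by
    such injectives gives Hom(T, L) = 0 and Ext^i(T, L) = 0 for all i. Hence T never enters the
    socle of a cosyzygy of a projective module taken along injective hulls, and the hull of T has
    coefficient zero in every Euler characteristic of a projective. A square matrix with a zero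
    column is not invertible, which excludes T. *)

Definition mklin (S : nzRingType) (U V : lmodType S) (f : U -> V)
    (H : forall a x y, f (a *: x + y) = a *: f x + f y) : {linear U -> V} :=
  HB.pack f (GRing.isLinear.Build _ _ _ _ f H).

Lemma inj_surj_bij (A B : choiceType) (f : A -> B) :
  injective f -> surj f -> bijective f.
Proof.
move=> fI fS.
have [g gP] := choice fS.
by exists g => // x; apply: fI; rewrite gP.
Qed.

(** * Linear maps and finite dimensional modules *)

Section LinearTools.

Variable S : nzRingType.
Implicit Types U V W : lmodType S.

Lemma lin_inj U V (f : {linear U -> V}) :
  (forall x, f x = 0 -> x = 0) -> injective f.
Proof. by move=> H x y E; apply/subr0_eq/H; rewrite linearB E subrr. Qed.

Lemma inj_lin U V (f : {linear U -> V}) x : injective f -> f x = 0 -> x = 0.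
Proof. by move=> fI E; apply: fI; rewrite E linear0. Qed.

(** Two values of one argument differ by a value of 0, so the relation is a graph. Maps into
    pullbacks and out of pushouts are obtained this way, without formulas. *)
Lemma linear_of_rel U V (r : U -> V -> Prop) :
  (forall a u v u' v', r u v -> r u' v' -> r (a *: u + u') (a *: v + v')) ->
  (forall u, exists v, r u v) -> (forall v, r 0 v -> v = 0) ->
  exists F : {linear U -> V}, forall u, r u (F u).
Proof.
move=> rL rT r0; have [F FP] := choice rT.
have rU u v v' : r u v -> r u v' -> v = v'.
  move=> h h'; apply/esym/subr0_eq/r0; move: (rL (-1) _ _ _ _ h h').
  by rewrite !scaleN1r addNr addrC.
have FL a x y : F (a *: x + y) = a *: F x + F y.
  by apply: rU (FP _) _; apply: rL.
by exists (mklin FL).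
Qed.

Lemma lin_lift U V W (i : {linear U -> V}) (f : {linear W -> V}) :
  injective i -> (forall x, exists k, i k = f x) ->
  exists h : {linear W -> U}, forall x, i (h x) = f x.
Proof.
move=> iI fi; have [] := @linear_of_rel W U (fun x k => i k = f x).
- by move=> a u v u' v' h h'; rewrite !linearP h h'.
- exact: fi.
- by move=> v; rewrite linear0 => /(inj_lin iI).
by move=> h hP; exists h.
Qed.

Lemma fact_surj U V W (p : {linear U -> V}) (f : {linear U -> W}) :
  surj p -> (forall x, p x = 0 -> f x = 0) ->
  exists h : {linear V -> W}, forall x, h (p x) = f x.
Proof.
move=> pS pf.
have [] := @linear_of_rel V W (fun y z => exists2 x, p x = y & f x = z).
- move=> a u v u' v' [x <- <-] [x' <- <-].
  by exists (a *: x + x'); rewrite linearP.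
- by move=> u; have [x <-] := pS u; exists (f x), x.
- by move=> v [x /pf -> <-].
move=> h hP; exists h => x; have [y /eqP yx <-] := hP (p x).
apply/eqP; rewrite -subr_eq0 -linearB; apply/eqP/pf.
by rewrite linearB (eqP yx) subrr.
Qed.

Lemma lin_bij U V (f : {linear U -> V}) : injective f -> surj f ->
  exists g : {linear V -> U}, (forall x, g (f x) = x) /\ forall y, f (g y) = y.
Proof.
move=> fI fS; have [g gP] := lin_lift (f := idfun) fI fS.
by exists g; split=> // x; apply: fI; rewrite gP.
Qed.

Lemma fin_gen_fin U (I : finType) (g : I -> U) :
  (forall x, exists c : I -> S, x = \sum_i c i *: g i) -> fin_gen U.
Proof.
move=> H; pose e (i : 'I_#|I|) : I := enum_val i.
exists #|I|, (g \o e) => x; have [c ->] := H x.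
by exists (c \o e); rewrite (reindex e) //=; apply/onW_bij/enum_val_bij.
Qed.

Lemma fin_gen_prod U V : fin_gen U -> fin_gen V -> fin_gen (U * V)%type.
Proof.
move=> [m [g gP]] [n [h hP]].
pose k (i : 'I_m + 'I_n) : (U * V)%type :=
  match i with inl i => (g i, 0) | inr j => (0, h j) end.
apply: (@fin_gen_fin _ _ k) => -[x y]; have [c cx] := gP x.
have [d dy] := hP y.
exists (fun i => match i with inl i => c i | inr j => d j end).
rewrite big_sumType /= [LHS](_ : _ = (x, 0) + (0, y)); last first.
  by congr (_, _) => /=; rewrite ?addr0 ?add0r.
congr (_ + _).
  rewrite cx; apply: (big_rec2 (fun u v => (u, 0) = v)) => // i a b _ <-.
  by congr (_, _); rewrite /= scaler0 addr0.
rewrite dy; apply: (big_rec2 (fun u v => (0, u) = v)) => // i a b _ <-.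
by congr (_, _); rewrite /= scaler0 addr0.
Qed.

Lemma fin_gen_ffun U m : fin_gen U -> fin_gen ({ffun 'I_m -> U} : lmodType S).
Proof.
move=> [n [g gP]].
pose k (i : 'I_m * 'I_n) : {ffun 'I_m -> U} :=
  [ffun j => if j == i.1 then g i.2 else 0].
apply: (@fin_gen_fin _ _ k) => f.
have [c cP] := choice (fun i => gP (f i)).
exists (fun i => c i.1 i.2).
rewrite -(pair_bigA _ (fun i j => c i j *: k (i, j))) /=.
apply/ffunP=> i; rewrite sum_ffunE (bigD1 i) //= [X in _ + X]big1 ?addr0.
  rewrite sum_ffunE {1}cP; apply: eq_bigr => j _.
  by rewrite !ffunE eqxx.
move=> j ji; rewrite sum_ffunE big1 // => l _.
by rewrite !ffunE eq_sym (negPf ji) scaler0.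
Qed.

End LinearTools.

Section Rmod.

Variable R : nzRingType.

Definition prodm (M N : rmod R) : rmod R :=
  Rmod (fin_gen_prod (rmod_fin_gen M) (rmod_fin_gen N)).

Definition powm (m : nat) (M : rmod R) : rmod R :=
  Rmod (fin_gen_ffun m (rmod_fin_gen M)).

Definition ses (A B C : rmod R) (f : {linear A -> B}) (g : {linear B -> C}) :=
  [/\ injective f, exact_at f g & surj g].

End Rmod.

(** * Coordinates for finitely generated vector spaces *)

Section VectorSpaces.

Variable K : fieldType.

(** [Q] is an arbitrary predicate: rows from it are adjoined as long as the rank grows, and [m]
    bounds the rank still missing. It serves for submodules and for the set of matrices of
    homomorphisms. *)
Lemma spanning_matrix N (Q : 'rV[K]_N -> Prop) :
  exists r (B : 'M[K]_(r, N)), (forall i, Q (row i B)) /\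
    forall w, Q w -> (w <= B)%MS.
Proof.
suff H m r (B : 'M[K]_(r, N)) : (forall i, Q (row i B)) ->
    (N <= m + \rank B)%N -> exists r (B : 'M[K]_(r, N)),
    (forall i, Q (row i B)) /\ forall w, Q w -> (w <= B)%MS.
  apply: (@H N 0%N 0) => [[]//|]; exact: leq_addr.
elim: m r B => [|m IH] r B QB rB.
  exists r, B; split=> // w _; apply: submx_full.
  by rewrite /row_full eqn_leq rank_leq_col.
have [full|] := EM (forall w, Q w -> (w <= B)%MS); first by exists r, B.
move/existsNP => [w /not_implyP [Qw /negP wB]].
apply: (IH _ (col_mx B w)) => [i|].
  by case: (split_ordP i) => j ->; rewrite ?rowKu ?rowKd // row_id.
rewrite addSnnS in rB; apply: leq_trans rB _.
rewrite leq_add2l -addsmxE ltn_neqAle mxrankS ?addsmxSl // andbT; apply: contra wB => /eqP e.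
have /eqmxP E : (B == B + w)%MS.
  by rewrite -(mxrank_leqif_eq (addsmxSl B w)) e.
by rewrite E addsmxSr.
Qed.

Lemma coordinates_ex (V : lmodType K) : fin_gen V ->
  exists d (c : {linear V -> 'rV[K]_d}), bijective c.
Proof.
move=> [N [g gP]].
have eL a (x y : 'rV[K]_N) : \sum_i (a *: x + y) 0 i *: g i =
    a *: (\sum_i x 0 i *: g i) + \sum_i y 0 i *: g i.
  rewrite scaler_sumr -big_split; apply: eq_bigr => i _ /=.
  by rewrite !mxE scalerDl scalerA.
pose e := mklin eL.
have eS : surj e.
  move=> v; have [c ->] := gP v; exists (\row_i c i).
  by apply: eq_bigr => i _; rewrite mxE.
have [r [U [UK UP]]] := spanning_matrix (fun u => e u = 0).
(* The cokernel matrix has the right kernel but N columns; its column base keeps the kernel and is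
   onto. *)
pose T := col_base (cokermx U).
have cE (u : 'rV_N) : u *m cokermx U = u *m T *m row_base (cokermx U).
  by rewrite -mulmxA mulmx_base.
have eT u : u *m T = 0 <-> e u = 0.
  split=> [uT|/UP]; last first.
    rewrite submxE cE => /eqP u0; apply: (row_free_inj (row_base_free _)).
    by rewrite u0 mul0mx.
  have: (u <= U)%MS by rewrite submxE cE uT mul0mx.
  case/submxP => D ->; rewrite mulmx_sum_row linear_sum big1 // => i _.
  by rewrite linearZ; move: (UK i) => /= ->; rewrite scaler0.
have [|c cP] := fact_surj (f := mulmxr T) eS.
  by move=> x /eT.
exists _, c; apply: inj_surj_bij.
  apply: lin_inj => v; have [u <-] := eS v.
  by rewrite cP /= => /eT.
move=> y; exists (e (y *m pinvmx T)); rewrite cP /= mulmxKpV //.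
exact/submx_full/col_base_full.
Qed.

Lemma coordinates_dim (V : lmodType K) d e (c : {linear V -> 'rV[K]_d})
  (c' : {linear V -> 'rV[K]_e}) : bijective c -> bijective c' -> d = e.
Proof.
have H d1 e1 (f : {linear 'rV[K]_d1 -> 'rV[K]_e1}) : bijective f -> (d1 <= e1)%N.
  move=> fB; have : row_free (lin1_mx f).
    rewrite -kermx_eq0; apply/rowV0P => v /sub_kermxP.
    rewrite mul_rV_lin1; exact/inj_lin/bij_inj.
  by move/eqP <-; exact: rank_leq_col.
move=> cB c'B.
have lb n (f : {linear V -> 'rV[K]_n}) : bijective f ->
    exists g : {linear 'rV[K]_n -> V}, bijective g /\ cancel f g.
  move=> fB; have [||g [gf fg]] := lin_bij (f := f).
  - exact: bij_inj.
  - by case: fB => g _ gP y; exists (g y).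
  by exists g; split=> //; exists f.
have [g [gB _]] := lb _ _ cB; have [g' [gB' _]] := lb _ _ c'B.
apply/eqP; rewrite eqn_leq; apply/andP; split.
  by apply: (H _ _ (c' \o g)); apply: bij_comp.
by apply: (H _ _ (c \o g')); apply: bij_comp.
Qed.

End VectorSpaces.

(* The structure is put on a bare ring because [oppring A] is not a [falgType]. *)
Record fdalg (K : fieldType) (R : nzRingType) := Fdalg {
  emb :> K -> R;
  embD : {morph emb : x y / x + y};
  embM : {morph emb : x y / x * y};
  emb1 : emb 1 = 1;
  embC : forall k a, emb k * a = a * emb k;
  emb_gen : exists N (g : 'I_N -> R), forall a, exists c : 'I_N -> K,
    a = \sum_i emb (c i) * g i }.

(** A copy of M, so that its K-structure, which depends on [F], is not confused with its structure
    over [R^c]. *)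
Definition kmod (K : fieldType) (R : nzRingType) (F : fdalg K R)
  (M : lmodType R^c) : Type := M.

Section Kmod.

Variables (K : fieldType) (R : nzRingType) (F : fdalg K R) (M : lmodType R^c).

Definition kscale (k : K) (x : kmod F M) : kmod F M := (F k : R^c) *: (x : M).

HB.instance Definition _ := GRing.Zmodule.on (kmod F M).

Fact kscaleA a b v : kscale a (kscale b v) = kscale (a * b) v.
Proof. by rewrite /kscale scalerA mulrC embM. Qed.
Fact kscale1 : left_id 1 kscale.
Proof. by move=> v; rewrite /kscale emb1 scale1r. Qed.
Fact kscaleDr : right_distributive kscale +%R.
Proof. by move=> a u v; rewrite /kscale -scalerDr. Qed.
Fact kscaleDl v : {morph kscale^~ v : a b / a + b}.
Proof. by move=> a b; rewrite /kscale embD scalerDl. Qed.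

HB.instance Definition _ := GRing.Zmodule_isLmodule.Build K (kmod F M)
  kscaleA kscale1 kscaleDr kscaleDl.

Lemma kscaleE (k : K) (x : kmod F M) : k *: x = (F k : R^c) *: (x : M).
Proof. by []. Qed.

End Kmod.

(** * Modules as matrix representations; submodules and quotients *)

Section Coordinates.

Variables (K : fieldType) (R : nzRingType) (F : fdalg K R).
Implicit Types M N : rmod R.

Lemma kmod_fin_gen M : fin_gen (kmod F M : lmodType K).
Proof.
have [m [g gP]] := rmod_fin_gen M; have [n [h hP]] := emb_gen F.
pose k (i : 'I_m * 'I_n) : kmod F M := (h i.2 : R^c) *: g i.1.
apply: (@fin_gen_fin _ _ _ k) => x; have [c ->] := gP x.
have [d dP] := choice (fun i => hP (c i)).
exists (fun i => d i.1 i.2).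
rewrite -(pair_bigA _ (fun i j => d i j *: k (i, j))) /=.
apply: eq_bigr => i _; rewrite dP scaler_suml; apply: eq_bigr => j _.
by rewrite embC kscaleE /k /= scalerA.
Qed.

(** The sigma type makes the coordinates a function of the module: [dimm], [co] and [oc] are one
    fixed choice. *)
Lemma rmod_coordinates M : {d : nat & {c : {linear kmod F M -> 'rV[K]_d} &
  {o : {linear 'rV[K]_d -> kmod F M} | cancel c o /\ cancel o c}}}.
Proof.
have [d /cid[c cB]] := cid (coordinates_ex (kmod_fin_gen M)).
exists d, c; apply: cid.
have [||o [co oc]] := lin_bij (f := c); last by exists o.
  exact: bij_inj.
by case: cB => g _ gP y; exists (g y).
Qed.

Definition dimm M : nat := projT1 (rmod_coordinates M).
Definition co M : {linear kmod F M -> 'rV[K]_(dimm M)} :=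
  projT1 (projT2 (rmod_coordinates M)).
Definition oc M : {linear 'rV[K]_(dimm M) -> kmod F M} :=
  sval (projT2 (projT2 (rmod_coordinates M))).

Arguments co {M}.
Arguments oc {M}.

Lemma coK M : cancel (@co M) (@oc M).
Proof. by have [] := svalP (projT2 (projT2 (rmod_coordinates M))). Qed.
Lemma ocK M : cancel (@oc M) (@co M).
Proof. by have [] := svalP (projT2 (projT2 (rmod_coordinates M))). Qed.

Lemma dimm_eq M d (c : {linear kmod F M -> 'rV[K]_d}) : bijective c -> dimm M = d.
Proof.
by apply: coordinates_dim; exists (@oc M); [exact: coK | exact: ocK].
Qed.

Lemma klinP M N (f : {linear M -> N}) a (x y : kmod F M) :
  (f (a *: x + y) : kmod F N) = a *: (f x : kmod F N) + f y.
Proof. by rewrite [LHS]linearP. Qed.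

Definition klin M N (f : {linear M -> N}) : {linear kmod F M -> kmod F N} :=
  mklin (klinP f).

Definition mx M N (f : {linear M -> N}) : 'M[K]_(dimm M, dimm N) :=
  lin1_mx (@co N \o klin f \o @oc M).

Lemma co_mx M N (f : {linear M -> N}) (x : M) : co (f x) = co x *m mx f.
Proof. by rewrite mul_rV_lin1 /= coK. Qed.

Lemma actP M a (k : K) (x y : kmod F M) :
  ((a : R^c) *: (k *: x + y : M) : kmod F M) =
  k *: ((a : R^c) *: (x : M) : kmod F M) + (a : R^c) *: (y : M).
Proof.
rewrite [LHS](scalerDr (a : R^c) (k *: x : M) (y : M)); congr (_ + _).
apply: etrans (scalerA (a : R^c) (F k : R^c) (x : M)) _.
apply: etrans _ (esym (scalerA (F k : R^c) (a : R^c) (x : M))).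
by have -> : a * (F k : R^c) = (F k : R^c) * a := embC F k a.
Qed.

Definition act M (a : R) : 'M[K]_(dimm M) :=
  lin1_mx (@co M \o mklin (@actP M a) \o @oc M).

Lemma co_act M a (x : M) : co ((a : R^c) *: x) = co x *m act M a.
Proof. by rewrite mul_rV_lin1 /= coK. Qed.

Lemma co_inj M : injective (@co M).
Proof. exact: can_inj (@coK M). Qed.

Lemma rV_mx m n (A B : 'M[K]_(m, n)) :
  (forall u : 'rV_m, u *m A = u *m B) -> A = B.
Proof. by move=> H; apply/row_matrixP => i; rewrite !rowE H. Qed.

Lemma actD M : {morph act M : a b / a + b}.
Proof.
move=> a b; apply: rV_mx => u; rewrite -(ocK u) mulmxDr -!co_act.
by rewrite [X in co X]scalerDl linearD.
Qed.

Lemma actM M a b : act M (a * b) = act M a *m act M b.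
Proof.
apply: rV_mx => u; rewrite -(ocK u) mulmxA -!co_act.
by congr (co _); rewrite scalerA.
Qed.

Lemma act1 M : act M 1 = 1%:M.
Proof.
by apply: rV_mx => u; rewrite -(ocK u) mulmx1 -!co_act [X in co X]scale1r.
Qed.

Lemma act_emb M k : act M (F k) = k%:M.
Proof.
apply: rV_mx => u; rewrite -{1}(ocK u) -co_act.
have -> : co ((F k : R^c) *: (oc u : M)) = co (k *: oc u) by [].
by rewrite linearZ ocK mul_mx_scalar.
Qed.

Lemma mx_act M N (f : {linear M -> N}) a : act M a *m mx f = mx f *m act N a.
Proof.
apply: rV_mx => u; rewrite -(ocK u) !mulmxA -co_act -!co_mx -co_act.
by rewrite linearZ.
Qed.

(** Row vectors are acted on from the right, so the matrices of a right module multiply in the order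
    of R. *)
Record mrep d := Mrep {
  rp :> R -> 'M[K]_d;
  rpD : {morph rp : a b / a + b};
  rpM : forall a b, rp (a * b) = rp a *m rp b;
  rp1 : rp 1 = 1%:M;
  rp_emb : forall k, rp (F k) = k%:M }.

Definition act_rep M : mrep (dimm M) :=
  Mrep (@actD M) (@actM M) (act1 M) (act_emb M).

Definition repty d (r : mrep d) : Type := 'rV[K]_d.

Section Repty.

Variables (d : nat) (r : mrep d).

HB.instance Definition _ := GRing.Zmodule.on (repty r).

Definition rscale (a : R^c) (x : repty r) : repty r := (x : 'rV_d) *m r a.

Fact rscaleA a b v : rscale a (rscale b v) = rscale (a * b) v.
Proof. by rewrite /rscale -mulmxA -rpM. Qed.
Fact rscale1 : left_id 1 rscale.
Proof. by move=> v; rewrite /rscale rp1 mulmx1. Qed.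
Fact rscaleDr : right_distributive rscale +%R.
Proof. by move=> a u v; rewrite /rscale -mulmxDl. Qed.
Fact rscaleDl v : {morph rscale^~ v : a b / a + b}.
Proof. by move=> a b; rewrite /rscale rpD mulmxDr. Qed.

HB.instance Definition _ := GRing.Zmodule_isLmodule.Build R^c (repty r)
  rscaleA rscale1 rscaleDr rscaleDl.

Lemma repty_fin_gen : fin_gen (repty r : lmodType R^c).
Proof.
exists d, (fun i => delta_mx 0 i : 'rV_d) => x.
exists (fun i => F ((x : 'rV_d) 0 i) : R^c).
rewrite [LHS]row_sum_delta; apply: eq_bigr => i _.
by rewrite -mul_mx_scalar -(rp_emb r).
Qed.

Definition repmod : rmod R := Rmod repty_fin_gen.

Lemma repmod_scale a (x : repmod) : a *: x = (x : 'rV_d) *m r a :> 'rV_d.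
Proof. by []. Qed.

Lemma dimm_repmod : dimm repmod = d.
Proof.
have idP a (x y : kmod F repmod) :
    (a *: x + y : 'rV[K]_d) = a *: (x : 'rV[K]_d) + (y : 'rV[K]_d).
  congr (_ + _); rewrite -mul_mx_scalar -(rp_emb r).
  by [].
by apply: (dimm_eq (c := mklin idP)); exists id.
Qed.

End Repty.

(** In coordinates the submodule is the row space of a row-free [B], stable under each [act M a].
    The restricted action is the matrix [rho a] determined by [rho a *m B = B *m act M a], and its
    uniqueness gives multiplicativity. *)
Lemma sub_ex M (Q : M -> Prop) : submodule Q ->
  exists (N : rmod R) (i : {linear N -> M}), injective i /\
    forall y, Q y <-> exists x, i x = y.
Proof.
move=> [Q0 QL]; pose Q' (u : 'rV[K]_(dimm M)) := Q (oc u).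
have Q'L k u v : Q' u -> Q' v -> Q' (k *: u + v).
  by move=> Qu Qv; rewrite /Q' linearP; apply: (QL (F k)).
have Q'0 : Q' 0 by rewrite /Q' linear0.
have [r [U [UQ QU]]] := spanning_matrix Q'.
have UP u : Q' u <-> (u <= row_base U)%MS.
  rewrite eq_row_base; split=> [/QU//|/submxP[D ->]].
  rewrite mulmx_sum_row; elim/big_ind: _ => [//|x y Qx Qy|i _].
    by rewrite -[x]scale1r; apply: Q'L.
  by rewrite -[_ *: _]addr0; apply: Q'L.
pose B := row_base U; have BF : row_free B by apply: row_base_free.
have Bst a : (B *m act M a <= B)%MS.
  apply/row_subP => i; rewrite row_mul -UP /Q'.
  have /UP QB : (row i B <= B)%MS by apply: row_sub.
  rewrite -(ocK (row i B)) -co_act coK -[X in Q X]addr0.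
  exact: QL.
have BK p (C : 'M_(p, _)) : C *m B *m pinvmx B = C by rewrite mulmxKp.
pose rho a := B *m act M a *m pinvmx B.
have rB a : rho a *m B = B *m act M a by rewrite mulmxKpV.
have rD : {morph rho : a b / a + b}.
  by move=> a b; rewrite /rho actD mulmxDr mulmxDl.
have rM a b : rho (a * b) = rho a *m rho b.
  by rewrite {1}/rho actM mulmxA -rB -!mulmxA /rho -!mulmxA.
have r1 : rho 1 = 1%:M by rewrite /rho act1 mulmx1 -{1}[B]mul1mx BK.
have rE k : rho (F k) = k%:M.
  by rewrite /rho act_emb mul_mx_scalar -scalemxAl -{1}[B]mul1mx BK scalemx1.
pose N := repmod (Mrep rD rM r1 rE).
have iL a (x y : N) : (oc (((a *: x + y : N) : 'rV_(\rank U)) *m B) : M) =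
    a *: (oc ((x : 'rV_(\rank U)) *m B) : M) + oc ((y : 'rV_(\rank U)) *m B).
  apply: (@co_inj M); rewrite linearD co_act !ocK mulmxDl; congr (_ + _).
  by rewrite repmod_scale /= -mulmxA rB mulmxA.
exists N, (mklin iL); split.
  apply: lin_inj => x /= E; apply: (row_free_inj BF); rewrite mul0mx.
  by rewrite -[_ *m _]ocK E linear0.
move=> y; rewrite -[y](coK (y : kmod F M)) -/(Q' _) UP; split.
  case/submxP => D ->; exists D; by [].
by case=> x /= /(can_inj (@ocK M)) <-; apply: submxMl.
Qed.

(** [B] has kernel [Q] and [G] is a linear section of it. Stability of [Q] makes the action
    [G *m act M a *m B] independent of the section, hence multiplicative. *)
Lemma quot_ex M (Q : M -> Prop) : submodule Q ->
  exists (N : rmod R) (p : {linear M -> N}), surj p /\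
    forall x, p x = 0 <-> Q x.
Proof.
move=> [Q0 QL]; pose Q' (u : 'rV[K]_(dimm M)) := Q (oc u).
have Q'L k u v : Q' u -> Q' v -> Q' (k *: u + v).
  by move=> Qu Qv; rewrite /Q' linearP; apply: (QL (F k)).
have Q'0 : Q' 0 by rewrite /Q' linear0.
have [r [U [UQ QU]]] := spanning_matrix Q'.
have UP u : Q' u <-> (u <= U)%MS.
  split=> [/QU//|/submxP[D ->]].
  rewrite mulmx_sum_row; elim/big_ind: _ => [//|x y Qx Qy|i _].
    by rewrite -[x]scale1r; apply: Q'L.
  by rewrite -[_ *: _]addr0; apply: Q'L.
pose C := cokermx U; pose B := col_base C.
have BF : row_full B by apply: col_base_full.
have BP u : u *m B = 0 <-> Q' u.
  have E : u *m C = u *m B *m row_base C by rewrite -mulmxA mulmx_base.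
  rewrite UP submxE E; split=> [->|/eqP E0]; first by rewrite mul0mx.
  by apply: (row_free_inj (row_base_free C)); rewrite E0 mul0mx.
have [G BB] : exists G, G *m B = 1%:M.
  by exists (pinvmx B); rewrite -[pinvmx B]mul1mx mulmxKpV // submx_full.
clearbody B.
have BK' u : Q' (u *m B *m G - u).
  by apply/BP; rewrite mulmxBl -!mulmxA BB mulmx1 subrr.
have Bst a u : Q' u -> u *m act M a *m B = 0.
  move=> Qu; apply/BP; rewrite /Q' -(ocK u) -co_act coK -[X in Q X]addr0.
  exact: QL.
pose rho a := G *m act M a *m B.
have rB a : B *m rho a = act M a *m B.
  apply: rV_mx => u; apply/subr0_eq; rewrite /rho !mulmxA -!mulmxBl.
  by apply: Bst; apply: BK'.
have rD : {morph rho : a b / a + b}.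
  by move=> a b; rewrite /rho actD mulmxDr mulmxDl.
have rM a b : rho (a * b) = rho a *m rho b.
  by rewrite {2}/rho -mulmxA rB /rho actM !mulmxA.
have r1 : rho 1 = 1%:M by rewrite /rho act1 mulmx1.
have rE k : rho (F k) = k%:M.
  by rewrite /rho act_emb mul_mx_scalar -scalemxAl BB scalemx1.
pose N := repmod (Mrep rD rM r1 rE).
have pL a (x y : M) : (co (a *: x + y) *m B : N) =
    a *: (co x *m B : N) + (co y *m B : N).
  by rewrite linearD mulmxDl co_act repmod_scale /= -mulmxA -rB mulmxA.
exists N, (mklin pL); split.
  move=> y; exists (oc ((y : 'rV_(\rank C)) *m G)).
  by rewrite /= ocK -mulmxA BB mulmx1.
by move=> x; rewrite /= BP /Q' coK.
Qed.

End Coordinates.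

Arguments co {K R} F {M}.
Arguments oc {K R} F {M}.

(** * Exactness as rank and dimension conditions *)

Section Dimensions.

Variables (K : fieldType) (R : nzRingType) (F : fdalg K R).
Implicit Types M N : rmod R.

Local Notation mx := (@mx K R F _ _).
Local Notation dimm := (dimm F).
Local Notation co := (@co K R F _).
Local Notation oc := (@oc K R F _).

Lemma mx_free M N (f : {linear M -> N}) : injective f <-> row_free (mx f).
Proof.
split=> fI.
  rewrite -kermx_eq0; apply/rowV0P => v /sub_kermxP.
  rewrite -[v](@ocK _ _ F M) -co_mx => /(inj_lin (@co_inj _ _ F N)).
  by move/(inj_lin fI) => ->; rewrite linear0.
apply: lin_inj => x fx; apply: (@co_inj _ _ F M); apply: (row_free_inj fI).
by rewrite -co_mx fx !linear0 mul0mx.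
Qed.

Lemma mx_full M N (f : {linear M -> N}) : surj f <-> row_full (mx f).
Proof.
split=> fS.
  have [g gP] := choice fS.
  apply/row_fullP; exists (\matrix_i co (g (oc (row i 1%:M)))).
  by apply/row_matrixP => i; rewrite row_mul rowK -co_mx gP ocK.
move=> y; exists (oc (co y *m pinvmx (mx f))); apply: (@co_inj _ _ F N).
by rewrite co_mx ocK mulmxKpV // submx_full.
Qed.

Lemma dim_surj M N (f : {linear M -> N}) : surj f -> (dimm N <= dimm M)%N.
Proof. by move/mx_full/eqP <-; apply: rank_leq_row. Qed.

Lemma inj_surj M N (f : {linear M -> N}) :
  injective f -> (dimm N <= dimm M)%N -> surj f.
Proof.
move/mx_free/eqP => r d; apply/mx_full; rewrite /row_full r eqn_leq d andbT.
by rewrite -{1}r rank_leq_col.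
Qed.

Lemma dim0P M : dimm M = 0%N <-> trivial_mod M.
Proof.
split=> [d x|M0]; last first.
  have cP (a : K) (x y : kmod F M) : (0 : 'rV[K]_0) = a *: 0 + 0 by rewrite scaler0 addr0.
  rewrite (@dimm_eq _ _ F M 0 (mklin cP)) //.
  exists (fun=> 0) => x /=; first by rewrite (M0 x).
  by rewrite (thinmx0 x).
apply: (@co_inj _ _ F M); rewrite linear0; move: (co x); rewrite d => v.
by rewrite (thinmx0 v).
Qed.

(** Exactness in the middle becomes the vanishing of the composite together with an equality of
    dimensions; these conditions visibly pass to duals. *)
Lemma ses_dim (A B C : rmod R) (f : {linear A -> B}) (g : {linear B -> C}) :
  ses f g <-> [/\ injective f, surj g, (forall x, g (f x) = 0) &
                 dimm B = (dimm A + dimm C)%N].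
Proof.
have ker : row_full (mx g) -> \rank (kermx (mx g)) = (dimm B - dimm C)%N.
  by rewrite mxrank_ker => /eqP ->.
have kerP y : g y = 0 <-> (co y <= kermx (mx g))%MS.
  rewrite (sameP sub_kermxP eqP) -co_mx; split=> [->|/eqP]; first by rewrite linear0.
  exact: inj_lin (@co_inj _ _ F C).
split=> [[fI fg gS]|[fI gS gf d]].
  have gf x : g (f x) = 0 by apply/fg; exists x.
  split=> //; have := dim_surj gS; move/mx_full/ker: (gS) => r le.
  rewrite -[LHS](subnK le) -r; congr (_ + _)%N.
  move/mx_free/eqP: fI => <-; apply/eqP; rewrite eqn_leq; apply/andP; split.
    apply: mxrankS; apply/row_subP => i.
    rewrite -[row i _](@ocK _ _ F B); set y := oc _.
    have /kerP/fg[x <-] : (co y <= kermx (mx g))%MS by rewrite ocK row_sub.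
    by rewrite co_mx submxMl.
  apply: mxrankS; apply/row_subP => i.
  rewrite -[row i _](@ocK _ _ F B) rowE.
  rewrite -[delta_mx 0 i](@ocK _ _ F A) -co_mx coK; apply/kerP.
  exact: gf.
split=> // y; split=> [|[x <-]]; last exact: gf.
have E : (mx f == kermx (mx g))%MS.
  have sub : (mx f <= kermx (mx g))%MS.
    apply/row_subP => i.
    rewrite -[row i _](@ocK _ _ F B) rowE.
    by rewrite -[delta_mx 0 i](@ocK _ _ F A) -co_mx coK; apply/kerP/gf.
  rewrite -(mxrank_leqif_eq sub) ker; last exact/mx_full.
  by move/mx_free/eqP: fI => ->; rewrite d addnK.
move/kerP; rewrite -(eqmxP E) => /submxP[D yD].
by exists (oc D); apply: (@co_inj _ _ F B); rewrite co_mx ocK yD.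
Qed.

End Dimensions.

(** Both directions are recorded so that the inverse is again an anti-isomorphism; the duality from
    R to S then also serves from S to R. *)
Record antiiso (K : fieldType) (R S : nzRingType) (F : fdalg K R) (G : fdalg K S) :=
  Antiiso {
    ai :> S -> R;
    aiD : {morph ai : x y / x + y};
    aiM : forall x y, ai (x * y) = ai y * ai x;
    ai1 : ai 1 = 1;
    ai_emb : forall k, ai (G k) = F k;
    ia : R -> S;
    aiK : cancel ai ia;
    iaK : cancel ia ai }.

Section AntiisoInverse.

Variables (K : fieldType) (R S : nzRingType) (F : fdalg K R) (G : fdalg K S).
Variable p : antiiso F G.

Let aiI := can_inj (aiK p).

Lemma iaD : {morph ia p : x y / x + y}.
Proof. by move=> x y; apply: aiI; rewrite aiD !iaK. Qed.
Lemma iaM x y : ia p (x * y) = ia p y * ia p x.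
Proof. by apply: aiI; rewrite aiM !iaK. Qed.
Lemma ia1 : ia p 1 = 1.
Proof. by apply: aiI; rewrite iaK ai1. Qed.
Lemma ia_emb k : ia p (F k) = G k.
Proof. by apply: aiI; rewrite iaK ai_emb. Qed.

Definition antiinv : antiiso G F :=
  @Antiiso _ _ _ G F (ia p) iaD iaM ia1 ia_emb p (@iaK _ _ _ _ _ p)
    (@aiK _ _ _ _ _ p).

End AntiisoInverse.

(** * The K-dual *)

Section Duality.

Variables (K : fieldType) (R S : nzRingType) (F : fdalg K R) (G : fdalg K S).
Variable p : antiiso F G.
Implicit Types (M N : rmod R) (X Y : rmod S).

Definition tr_rep d (r : mrep F d) : mrep G d.
Proof.
apply: (@Mrep _ _ G d (fun s => (r (p s))^T)).
- by move=> a b; rewrite aiD rpD linearD.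
- by move=> a b; rewrite aiM rpM trmx_mul.
- by rewrite ai1 rp1 trmx1.
- by move=> k; rewrite ai_emb rp_emb tr_scalar_mx.
Defined.

(** Hom_K(M, K) in the dual basis: transposition reverses products and so does [p], which leaves a
    right module over S. *)
Definition dual M : rmod S := repmod (tr_rep (act_rep F M)).

Lemma dual_mapP M N (f : {linear M -> N}) (a : S^c) (x y : dual N) :
  (((a *: x + y : dual N) : 'rV[K]_(dimm F N)) *m (mx F f)^T : dual M) =
  a *: ((x : 'rV[K]_(dimm F N)) *m (mx F f)^T : dual M) +
  (y : 'rV[K]_(dimm F N)) *m (mx F f)^T.
Proof.
rewrite mulmxDl; congr (_ + _); rewrite !repmod_scale /= -!mulmxA.
by rewrite -!trmx_mul mx_act.
Qed.

Definition dmap M N (f : {linear M -> N}) : {linear dual N -> dual M} :=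
  mklin (dual_mapP f).

Lemma dmapE M N (f : {linear M -> N}) (y : dual N) :
  dmap f y = (y : 'rV[K]_(dimm F N)) *m (mx F f)^T.
Proof. by []. Qed.

Lemma mx_comp M N N' (f : {linear M -> N}) (g : {linear N -> N'}) :
  mx F (g \o f) = mx F f *m mx F g.
Proof.
apply: rV_mx => u; rewrite -[u](@ocK _ _ F M) mulmxA -!co_mx.
by [].
Qed.

Lemma mx_ext M N (f g : {linear M -> N}) : (forall x, f x = g x) -> mx F f = mx F g.
Proof.
by move=> E; apply: rV_mx => u; rewrite -[u](@ocK _ _ F M) -!co_mx E.
Qed.

Lemma dmap_comp M N N' (f : {linear M -> N}) (g : {linear N -> N'})
  (h : {linear M -> N'}) : (forall x, g (f x) = h x) ->
  forall y, dmap f (dmap g y) = dmap h y.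
Proof.
move=> E y; rewrite !dmapE -(@mx_ext _ _ (g \o f) h) //.
by rewrite mx_comp trmx_mul mulmxA.
Qed.

(** Over K the map [h] is a matrix [H]. Its S-linearity says that [H] intertwines the transposed
    actions, hence [H^T] the original ones. *)
Lemma dmap_full M N (h : {linear dual N -> dual M}) :
  exists f : {linear M -> N}, forall y, dmap f y = h y.
Proof.
have hL (a : K) (x y : 'rV[K]_(dimm F N)) :
    (h (a *: x + y) : 'rV[K]_(dimm F M)) =
    a *: (h x : 'rV[K]_(dimm F M)) + (h y : 'rV[K]_(dimm F M)).
  have E n (r : mrep G n) (k : K) (u : repmod r) :
      (k *: (u : 'rV[K]_n) : repmod r) = (G k : S^c) *: u.
    by rewrite repmod_scale rp_emb mul_mx_scalar.
  transitivity (h ((G a : S^c) *: (x : dual N) + (y : dual N))).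
    by congr (h (_ + _)); apply: E.
  by rewrite linearP; congr (_ + _); rewrite -E.
pose H := lin1_mx (mklin hL).
have hE y : h y = (y : 'rV[K]_(dimm F N)) *m H by rewrite mul_rV_lin1.
have HA a : H *m (act F M a)^T = (act F N a)^T *m H.
  apply: rV_mx => u; rewrite !mulmxA -!hE.
  have : h ((ia p a : S^c) *: (u : dual N)) = (ia p a : S^c) *: h u.
    by rewrite linearZ.
  by rewrite !repmod_scale /= !iaK !hE => ->.
have fL a (x y : M) : (oc F (co F (a *: x + y) *m H^T) : N) =
    a *: (oc F (co F x *m H^T) : N) + oc F (co F y *m H^T).
  apply: (@co_inj _ _ F N); rewrite !linearD /= co_act !ocK co_act ocK mulmxDl.
  congr (_ + _); rewrite -!mulmxA; congr (_ *m _).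
  by rewrite -[act F M a]trmxK -!trmx_mul HA trmx_mul trmxK.
exists (mklin fL) => y; rewrite dmapE hE; congr (_ *m _).
apply: trmx_inj; rewrite trmxK; apply: rV_mx => u.
by rewrite -[u](@ocK _ _ F M) -co_mx /= !ocK.
Qed.

Lemma dim_dual M : dimm G (dual M) = dimm F M.
Proof. exact: dimm_repmod. Qed.

(** M is X with the action transposed along the inverse anti-isomorphism. The coordinates chosen for
    [M] need not be the row vectors it consists of; [B] is the change between them. *)
Lemma dual_ess_surj X : exists M (f : {linear dual M -> X}), injective f /\ surj f.
Proof.
have tD : {morph (fun a => (act G X (ia p a))^T) : a b / a + b}.
  by move=> a b; rewrite iaD actD linearD.
have tM a b : (act G X (ia p (a * b)))^T =
    (act G X (ia p a))^T *m (act G X (ia p b))^T.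
  by rewrite iaM actM trmx_mul.
have t1 : (act G X (ia p 1))^T = 1%:M by rewrite ia1 act1 trmx1.
have tE k : (act G X (ia p (F k)))^T = k%:M.
  by rewrite ia_emb act_emb tr_scalar_mx.
pose r := Mrep tD tM t1 tE; pose M := repmod r.
have cL (a : K) (x y : 'rV[K]_(dimm G X)) : co F (a *: x + y : M) =
    a *: co F (x : M) + co F (y : M).
  rewrite linearD; congr (_ + _); rewrite -linearZ; congr (co F _).
  by rewrite kscaleE [RHS]repmod_scale rp_emb mul_mx_scalar.
pose B := lin1_mx (mklin cL).
have BE (x : M) : co F x = (x : 'rV[K]_(dimm G X)) *m B by rewrite mul_rV_lin1.
have BA a : r a *m B = B *m act F M a.
  apply: rV_mx => u; rewrite !mulmxA -[u *m r a]/((a : R^c) *: (u : M)).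
  by rewrite -!BE co_act.
have fL a (x y : dual M) : (oc G ((a *: x + y : 'rV[K]_(dimm F M)) *m B^T) : X) =
    a *: (oc G ((x : 'rV[K]_(dimm F M)) *m B^T) : X) + 
    oc G ((y : 'rV[K]_(dimm F M)) *m B^T).
  apply: (@co_inj _ _ G X); rewrite linearD /= co_act !ocK mulmxDl.
  congr (_ + _); rewrite repmod_scale /= -!mulmxA; congr (_ *m _).
  by rewrite -trmx_mul -BA trmx_mul trmxK aiK.
pose f := mklin fL.
suff fI : injective f.
  exists M, f; split=> //; apply: (inj_surj (F := G) fI).
  by rewrite dim_dual dimm_repmod.
apply: lin_inj => x /= /(inj_lin (can_inj (@ocK _ _ G X))) xB.
have BI : row_free B.
  rewrite -kermx_eq0; apply/rowV0P => v /sub_kermxP; rewrite -BE.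
  exact: inj_lin (@co_inj _ _ F M).
have BF : row_full B by rewrite /row_full (eqP BI) dimm_repmod.
have := congr1 (mulmx^~ (pinvmx B)^T) xB; rewrite mul0mx -mulmxA -trmx_mul.
by rewrite -[pinvmx B]mul1mx mulmxKpV ?submx_full // trmx1 mulmx1.
Qed.

Lemma dmap_inj M N (f : {linear M -> N}) : surj f -> injective (dmap f).
Proof.
move/(mx_full F) => /row_fullP[B BE]; apply: lin_inj => x; rewrite dmapE => x0.
by rewrite -[x]mulmx1 -trmx1 -BE trmx_mul mulmxA x0 mul0mx.
Qed.

Lemma dmap_surj M N (f : {linear M -> N}) : injective f -> surj (dmap f).
Proof.
move/(mx_free F) => /row_freeP[B BE] x; exists ((x : 'rV[K]_(dimm F M)) *m B^T).
by rewrite dmapE -mulmxA -trmx_mul BE trmx1 mulmx1.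
Qed.

Lemma dmap_eq0 M N (f : {linear M -> N}) :
  (forall y, dmap f y = 0) <-> (forall x, f x = 0).
Proof.
split=> H x; last first.
  rewrite dmapE [mx F f](_ : _ = 0) ?trmx0 ?mulmx0 //; apply: rV_mx => u.
  by rewrite -[u](@ocK _ _ F M) -co_mx H linear0 mulmx0.
apply: (@co_inj _ _ F N); rewrite linear0 co_mx.
suff -> : mx F f = 0 by rewrite mulmx0.
apply/trmx_inj/rV_mx => u; rewrite trmx0 mulmx0; exact: H.
Qed.

Lemma surj_dmap M N (f : {linear M -> N}) : injective (dmap f) -> surj f.
Proof.
move=> fI; apply/(mx_full F); rewrite /row_full -mxrank_tr -/(row_free _).
rewrite -kermx_eq0; apply/rowV0P => v /sub_kermxP.
exact: (inj_lin fI).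
Qed.

Lemma inj_dmap M N (f : {linear M -> N}) : surj (dmap f) -> injective f.
Proof.
move=> fS; apply/(mx_free F); rewrite /row_free -mxrank_tr -/(row_full _).
rewrite -sub1mx; apply/row_subP => i.
by have [y <-] := fS (row i 1%:M); rewrite dmapE submxMl.
Qed.

Lemma dual_ses (A B C : rmod R) (f : {linear A -> B}) (g : {linear B -> C}) :
  ses f g -> ses (dmap g) (dmap f).
Proof.
case/(ses_dim F) => fI gS gf d; apply/(ses_dim G); split.
- exact: dmap_inj.
- exact: dmap_surj.
- move=> y; rewrite (@dmap_comp _ _ _ f g \0) //.
  by move: y; apply/dmap_eq0.
by rewrite !dim_dual addnC.
Qed.

(** By [dual_ess_surj] and [dmap_full], every extension problem over S is isomorphic to the dual of
    a lifting problem over R. *)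
Lemma dual_proj M : projective M -> injective_mod (dual M).
Proof.
move=> MP X Y j f jI.
have [X' [x [xI xS]]] := dual_ess_surj X.
have [Y' [y [yI yS]]] := dual_ess_surj Y.
have [x' [xK x'K]] := lin_bij xI xS; have [y' [yK y'K]] := lin_bij yI yS.
have [j' j'E] := @dmap_full Y' X' (y' \o j \o x).
have [f' f'E] := @dmap_full M X' (f \o x).
have j'S : surj j'.
  apply: surj_dmap => u v; rewrite !j'E /= => /(can_inj y'K)/jI; exact: xI.
have [g gE] := MP _ _ j' f' j'S.
exists (dmap g \o y') => u.
transitivity (dmap g (dmap j' (x' u))); first by rewrite j'E /= x'K.
by rewrite (dmap_comp gE) f'E /= x'K.
Qed.

Lemma dual_inj M : injective_mod M -> projective (dual M).
Proof.
move=> MI X Y q f qS.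
have [X' [x [xI xS]]] := dual_ess_surj X.
have [Y' [y [yI yS]]] := dual_ess_surj Y.
have [x' [xK x'K]] := lin_bij xI xS; have [y' [yK y'K]] := lin_bij yI yS.
have [q' q'E] := @dmap_full Y' X' (y' \o q \o x).
have [f' f'E] := @dmap_full Y' M (y' \o f).
have q'I : injective q'.
  apply: inj_dmap => u; have [v vu] := qS (y u).
  by exists (x' v); rewrite q'E /= x'K vu yK.
have [g gE] := MI _ _ q' f' q'I.
exists (x \o dmap g) => u; apply: (can_inj y'K).
transitivity (dmap q' (dmap g u)); first by rewrite q'E.
by rewrite (dmap_comp gE) f'E.
Qed.

(** The dualised problem has a solution, and it comes back because [dmap] is full and faithful. *)
Lemma proj_dual M : projective (dual M) -> injective_mod M.
Proof.
move=> MP X Y j f jI.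
have [g gE] := MP _ _ (dmap j) (dmap f) (dmap_surj jI).
have [g' g'E] := dmap_full g.
exists g' => x; apply/eqP; rewrite -subr_eq0; apply/eqP.
move: x; apply/(@dmap_eq0 _ _ ((g' \o j) \- f)) => y.
have -> : dmap ((g' \o j) \- f) y = dmap j (dmap g' y) - dmap f y.
  rewrite !dmapE -mulmxA -trmx_mul -mx_comp -mulmxBr -linearB; congr (_ *m _^T).
  apply: rV_mx => u; rewrite -[u](@ocK _ _ F X) mulmxBr -!co_mx -linearB.
  by [].
by rewrite g'E gE subrr.
Qed.

Lemma inj_dual M : injective_mod (dual M) -> projective M.
Proof.
move=> MI X Y q f qS.
have [g gE] := MI _ _ (dmap q) (dmap f) (dmap_inj qS).
have [g' g'E] := dmap_full g.
exists g' => x; apply/eqP; rewrite -subr_eq0; apply/eqP.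
move: x; apply/(@dmap_eq0 _ _ ((q \o g') \- f)) => y.
have -> : dmap ((q \o g') \- f) y = dmap g' (dmap q y) - dmap f y.
  rewrite !dmapE -mulmxA -trmx_mul -mx_comp -mulmxBr -linearB; congr (_ *m _^T).
  apply: rV_mx => u; rewrite -[u](@ocK _ _ F M) mulmxBr -!co_mx -linearB.
  by [].
by rewrite g'E gE subrr.
Qed.

End Duality.

Definition zerom (R : nzRingType) : rmod R := powm 0 (regular R).

Lemma zeromP (R : nzRingType) (x : zerom R) : x = 0.
Proof. by apply/ffunP => -[]. Qed.

(** * Exact sequences *)

(* These properties of mod R, which do not mention the base field, are all that *)
(* the homological arguments use; they are applied to A and to its opposite. *)
Class modcat (R : nzRingType) := Modcat {
  mdim : rmod R -> nat;
  ses_mdim : forall (A B C : rmod R) (f : {linear A -> B}) (g : {linear B -> C}),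
    ses f g -> mdim B = (mdim A + mdim C)%N;
  mdim_eq0 : forall M, mdim M = 0%N -> trivial_mod M;
  submodule_ex : forall (M : rmod R) (Q : M -> Prop), submodule Q ->
    exists (N : rmod R) (i : {linear N -> M}), injective i /\
      forall y, Q y <-> exists x, i x = y;
  quotient_ex : forall (M : rmod R) (Q : M -> Prop), submodule Q ->
    exists (N : rmod R) (p : {linear M -> N}), surj p /\
      forall x, p x = 0 <-> Q x;
  enough_inj : forall M : rmod R, exists (J : rmod R) (j : {linear M -> J}),
    injective_mod J /\ injective j;
  add_approx : forall M N : rmod R, exists r (f : {linear powm r M -> N}),
    forall g : {linear M -> N}, exists h : {linear M -> powm r M},
      forall x, f (h x) = g x }.

(** * Free modules, finite sums, retracts and split sequences *)

Section FreeModules.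

Variable R : nzRingType.
Implicit Types A B C D E H I J L M N P Q T U V W X Y Z : rmod R.

Lemma powm_in_subproof m M i a (x y : M) :
  [ffun j => if j == i then a *: x + y else 0] =
  a *: [ffun j => if j == i then x else 0] +
  [ffun j => if j == i then y else 0] :> {ffun 'I_m -> M}.
Proof.
by apply/ffunP => j; rewrite !ffunE; case: eqP; rewrite ?scaler0 ?addr0.
Qed.

Lemma powm_sum_subproof m M N (f : 'I_m -> {linear M -> N}) a
  (x y : {ffun 'I_m -> M}) : \sum_i f i ((a *: x + y) i) =
  a *: (\sum_i f i (x i)) + \sum_i f i (y i).
Proof.
rewrite scaler_sumr -big_split; apply: eq_bigr => i _ /=.
by rewrite !ffunE linearP.
Qed.

Definition powm_in m M i : {linear M -> powm m M} := mklin (@powm_in_subproof m M i).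
Arguments powm_in {m} M i.

Definition powm_sum m M N (f : 'I_m -> {linear M -> N}) : {linear powm m M -> N} :=
  mklin (powm_sum_subproof f).

Lemma powm_eta m M (x : powm m M) : x = \sum_i powm_in M i (x i).
Proof.
apply/ffunP => j; rewrite sum_ffunE (bigD1 j) //= ffunE eqxx big1 ?addr0 //.
by move=> i ij; rewrite ffunE eq_sym (negPf ij).
Qed.

Lemma powm_pr_subproof m M i a (x y : {ffun 'I_m -> M}) :
  (a *: x + y) i = a *: x i + y i.
Proof. by rewrite !ffunE. Qed.

Lemma powm_map_subproof m M N (f : 'I_m -> {linear N -> M}) a x y :
  [ffun i => f i (a *: x + y)] = a *: [ffun i => f i x] + [ffun i => f i y].
Proof. by apply/ffunP => i; rewrite !ffunE linearP. Qed.

Definition powm_pr m M i : {linear powm m M -> M} := mklin (@powm_pr_subproof m M i).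
Arguments powm_pr {m} M i.

Definition powm_map m M N (f : 'I_m -> {linear N -> M}) : {linear N -> powm m M} :=
  mklin (powm_map_subproof f).

Lemma powm_mapE m M N (f : 'I_m -> {linear N -> M}) i x :
  powm_pr M i (powm_map f x) = f i x.
Proof. by rewrite /= ffunE. Qed.

Lemma powm_ext m M (x y : powm m M) :
  (forall i, powm_pr M i x = powm_pr M i y) -> x = y.
Proof. by move=> H; apply/ffunP => i; apply: H. Qed.

Lemma regular_map M (x : M) : exists f : {linear regular R -> M},
  f (1 : R^c) = x.
Proof.
have fL (a : R^c) (u v : (R^c)^o) : (a *: u + v : R^c) *: x = a *: ((u : R^c) *: x) + (v : R^c) *: x.
  by rewrite scalerDl scalerA.
by exists (mklin fL); rewrite /= scale1r.
Qed.

Lemma regular_projective : projective (regular R).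
Proof.
move=> M N p f pS; have [y yE] := pS (f (1 : R^c)).
have [g gE] := regular_map y; exists g => x.
have xE : x = (x : R^c) *: (1 : (R^c)^o) by rewrite [RHS]mulr1.
by rewrite [x]xE !linearZ gE yE.
Qed.

Lemma powm_projective m (P : rmod R) : projective P -> projective (powm m P).
Proof.
move=> PP M N p f pS.
have [g gE] := choice (fun i => PP _ _ p (f \o powm_in P i) pS).
exists (powm_sum g) => x; rewrite /= [in RHS](powm_eta x) !linear_sum.
by apply: eq_bigr => i _; rewrite gE.
Qed.

Lemma enough_free M : exists m (p : {linear powm m (regular R) -> M}), surj p.
Proof.
have [m [g gP]] := rmod_fin_gen M.
have [f fE] := choice (fun i => regular_map (g i)).
exists m, (powm_sum f) => x; have [c ->] := gP x.
exists [ffun i => c i]; apply: eq_bigr => i _; rewrite ffunE.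
have cE : c i = c i *: (1 : (R^c)^o) by rewrite [RHS]mulr1.
by rewrite [in LHS]cE linearZ fE.
Qed.

Lemma enough_proj M : exists (P : rmod R) (p : {linear P -> M}), projective P /\ surj p.
Proof.
have [m [p pS]] := enough_free M; exists (powm m (regular R)), p.
by split=> //; apply/powm_projective/regular_projective.
Qed.

(** Direct summands, without naming the complement. *)
Definition retract M N := exists (s : {linear M -> N}) (r : {linear N -> M}),
  forall x, r (s x) = x.

Lemma retract_trans M N L : retract M N -> retract N L -> retract M L.
Proof.
move=> [s [r rs]] [s' [r' rs']]; exists (s' \o s), (r \o r') => x /=.
by rewrite rs' rs.
Qed.

Lemma retract_proj M (P : rmod R) : projective P -> retract M P -> projective M.
Proof.
move=> PP [s [r rs]] A B p f pS; have [g gE] := PP _ _ p (f \o r) pS.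
by exists (g \o s) => x /=; rewrite gE /= rs.
Qed.

Lemma retract_injm M (J : rmod R) : injective_mod J -> retract M J -> injective_mod M.
Proof.
move=> JJ [s [r rs]] A B j f jI; have [g gE] := JJ _ _ j (s \o f) jI.
by exists (r \o g) => x /=; rewrite gE /= rs.
Qed.

Lemma powm_injm m (J : rmod R) : injective_mod J -> injective_mod (powm m J).
Proof.
move=> JJ A B j f jI.
have [g gE] := choice (fun i => JJ _ _ j (powm_pr J i \o f) jI).
by exists (powm_map g) => x; apply: powm_ext => i; rewrite powm_mapE gE.
Qed.

Lemma pairl_subproof M N a (x y : M) :
  (a *: x + y, 0) = a *: (x, 0) + (y, 0) :> prodm M N.
Proof. by congr (_, _); rewrite /= scaler0 addr0. Qed.

Lemma pairr_subproof M N a (x y : N) :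
  (0, a *: x + y) = a *: (0, x) + (0, y) :> prodm M N.
Proof. by congr (_, _); rewrite /= scaler0 addr0. Qed.

Lemma pair_map_subproof M N (L : rmod R) (f : {linear L -> M}) (g : {linear L -> N}) a
  (x y : L) : (f (a *: x + y), g (a *: x + y)) =
  a *: (f x, g x) + (f y, g y) :> prodm M N.
Proof. by rewrite !linearP. Qed.

Definition pairl M N : {linear M -> prodm M N} := mklin (@pairl_subproof M N).
Definition pairr M N : {linear N -> prodm M N} := mklin (@pairr_subproof M N).
Definition pair_map M N (L : rmod R) (f : {linear L -> M}) (g : {linear L -> N}) :
  {linear L -> prodm M N} := mklin (pair_map_subproof f g).
Definition copair M N (L : rmod R) (f : {linear M -> L}) (g : {linear N -> L}) :
  {linear prodm M N -> L} := (f \o fst) \+ (g \o snd).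

Lemma retract_prodl M N : retract M (prodm M N).
Proof. by exists (pairl M N), fst. Qed.

Lemma retract_prodr M N : retract N (prodm M N).
Proof. by exists (pairr M N), snd. Qed.

Lemma proj_prodm (P Q : rmod R) : projective P -> projective Q -> projective (prodm P Q).
Proof.
move=> PP QQ A B p f pS.
have [g gE] := PP _ _ p (f \o pairl P Q) pS.
have [h hE] := QQ _ _ p (f \o pairr P Q) pS.
exists (copair g h) => x; rewrite /= linearD gE hE /= -linearD; congr (f _).
by case: x => u v; congr (_, _); rewrite /= ?addr0 ?add0r.
Qed.

Lemma injm_prodm (I J : rmod R) : injective_mod I -> injective_mod J ->
  injective_mod (prodm I J).
Proof.
move=> II JJ A B j f jI.
have [g gE] := II _ _ j (fst \o f) jI.
have [h hE] := JJ _ _ j (snd \o f) jI.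
by exists (pair_map g h) => x; rewrite /= gE hE /=; case: (f x).
Qed.

Lemma ses_prod M N : ses (pairl M N) (snd : {linear prodm M N -> N}).
Proof.
split=> [x y []//|[x y]|y]; last by exists (0, y).
by split=> /= [->|[z [_ ->]]//]; exists x.
Qed.

Lemma proj_zero : projective (zerom R).
Proof. by apply/powm_projective/regular_projective. Qed.

Lemma ses_idr M : exists z : {linear zerom R -> M}, ses z (idfun : {linear M -> M}).
Proof.
exists \0; split=> [x y _|y|y]; first by rewrite (zeromP x) (zeromP y).
  by split=> [/= ->|[x <-]//]; exists 0.
by exists y.
Qed.

Lemma ses_idl M : exists z : {linear M -> zerom R}, ses (idfun : {linear M -> M}) z.
Proof.
exists \0; split=> [x y //|y|y]; last by exists 0; rewrite (zeromP y).
by split=> // _; exists y.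
Qed.

Section Ses.

Variables (A B C : rmod R) (f : {linear A -> B}) (g : {linear B -> C}).
Hypothesis fg : ses f g.

Lemma sesK x : g (f x) = 0.
Proof. by case: fg => _ e _; apply/e; exists x. Qed.

Lemma ses_sec (s : {linear C -> B}) : (forall x, g (s x) = x) ->
  exists r : {linear B -> A}, (forall x, r (f x) = x) /\
    forall y, f (r y) + s (g y) = y.
Proof.
move=> sg; case: (fg) => fI fE gS.
have [|r rE] := lin_lift (f := idfun \- (s \o g)) fI.
  by move=> y; apply/fE; rewrite /= linearB sg subrr.
exists r; split=> [x|y]; last by rewrite rE /= subrK.
by apply: fI; rewrite rE /= sesK linear0 subr0.
Qed.

Lemma ses_ret (r : {linear B -> A}) : (forall x, r (f x) = x) ->
  exists s : {linear C -> B}, (forall x, g (s x) = x) /\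
    forall y, f (r y) + s (g y) = y.
Proof.
move=> rf; case: (fg) => fI fE gS.
have [|s sE] := fact_surj (f := idfun \- (f \o r)) gS.
  by move=> y /fE[x <-]; rewrite /= rf subrr.
exists s; split=> [x|y]; last by rewrite sE /= addrC subrK.
by have [y <-] := gS x; rewrite sE /= linearB sesK subr0.
Qed.

Lemma ses_proj_retract : projective C -> retract A B /\ retract C B.
Proof.
case: (fg) => fI fE gS CP; have [s sE] := CP _ _ g idfun gS.
have [r [rf _]] := ses_sec sE; split; first by exists f, r.
by exists s, g.
Qed.

Lemma ses_inj_retract : injective_mod A -> retract A B /\ retract C B.
Proof.
case: (fg) => fI fE gS AJ; have [r rE] := AJ _ _ f idfun fI.
have [s [sf _]] := ses_ret rE; split; first by exists f, r.
by exists s, g.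
Qed.

Lemma ses_fact (M : rmod R) (h : {linear M -> B}) : (forall x, g (h x) = 0) ->
  exists k : {linear M -> A}, forall x, f (k x) = h x.
Proof.
by case: fg => fI fE gS gh; apply: (lin_lift fI) => x; apply/fE; apply: gh.
Qed.

Lemma ses_cofact (M : rmod R) (h : {linear B -> M}) : (forall x, h (f x) = 0) ->
  exists k : {linear C -> M}, forall x, k (g x) = h x.
Proof.
by case: fg => fI fE gS hf; apply: (fact_surj gS) => x /fE[y <-]; apply: hf.
Qed.

End Ses.

End FreeModules.

(** * Pullbacks, pushouts and syzygies of short exact sequences *)

Section Diagrams.

Context {R : nzRingType} {HR : modcat R}.
Implicit Types A B C D E H I J L M N P Q T U V W X Y Z : rmod R.

Lemma ker_ex M N (f : {linear M -> N}) :
  exists (L : rmod R) (i : {linear L -> M}), injective i /\ exact_at i f.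
Proof.
have [|L [i [iI iE]]] := @submodule_ex R HR M (fun x => f x = 0).
  split=> [|a x y fx fy]; first exact: linear0.
  by rewrite linearP fx fy scaler0 addr0.
by exists L, i.
Qed.

Lemma ses_ker M N (f : {linear M -> N}) : surj f ->
  exists (L : rmod R) (i : {linear L -> M}), ses i f.
Proof. by move=> fS; have [L [i [iI iE]]] := ker_ex f; exists L, i. Qed.

Lemma ses_coker M N (f : {linear M -> N}) : injective f ->
  exists (L : rmod R) (q : {linear N -> L}), ses f q.
Proof.
move=> fI.
have [|L [q [qS qE]]] := @quotient_ex R HR N (fun y => exists x, f x = y).
  split=> [|a x y [u <-] [v <-]]; first by exists 0; rewrite linear0.
  by exists (a *: u + v); rewrite linearP.
by exists L, q.
Qed.

Lemma proj_cover M : exists (N P : rmod R) (f : {linear N -> P})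
  (g : {linear P -> M}), projective P /\ ses f g.
Proof.
have [P [g [PP gS]]] := enough_proj M; have [N [f fg]] := ses_ker gS.
by exists N, P, f, g.
Qed.

Lemma inj_hull M : exists (J N : rmod R) (f : {linear M -> J})
  (g : {linear J -> N}), injective_mod J /\ ses f g.
Proof.
have [J [g [JJ gS]]] := enough_inj M; have [N [f fg]] := ses_coker gS.
by exists J, N, g, f.
Qed.

Lemma image_ex M N (f : {linear M -> N}) : exists (L : rmod R)
  (q : {linear M -> L}) (i : {linear L -> N}),
  [/\ surj q, injective i & forall x, i (q x) = f x].
Proof.
have [k [i [iI iE]]] := ker_ex f; have [L [q [qI qE qS]]] := ses_coker iI.
have [|h hE] := fact_surj (f := f) qS.
  by move=> x /qE[z <-]; apply/iE; exists z.
exists L, q, h; split=> //; apply: lin_inj => y; have [x <-] := qS y.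
by rewrite hE => /iE[z <-]; apply/qE; exists z.
Qed.

Lemma pullback A B C (f : {linear A -> C}) (g : {linear B -> C}) :
  exists (P : rmod R) (a : {linear P -> A}) (b : {linear P -> B}),
  [/\ forall z, f (a z) = g (b z),
      forall x y, f x = g y -> exists z, a z = x /\ b z = y &
      forall z, a z = 0 -> b z = 0 -> z = 0].
Proof.
have [P [i [iI iE]]] := ker_ex ((f \o fst : {linear prodm A B -> C}) \- (g \o snd)).
exists P, (fst \o i), (snd \o i); split=> [z|x y fg|z /= z1 z2].
- by apply/subr0_eq/(iE (i z)); exists z.
- have /iE[z zE] : ((f \o fst) \- (g \o snd)) ((x, y) : prodm A B) = 0.
    by rewrite /= fg subrr.
  by exists z; rewrite /= zE.
by apply: (inj_lin iI); case: (i z) z1 z2 => u v /= -> ->.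
Qed.

Lemma pullback_ses A B C D (f : {linear A -> B}) (g : {linear B -> C})
  (h : {linear D -> C}) : ses f g -> exists (P : rmod R) (f' : {linear A -> P})
  (g' : {linear P -> D}) (k : {linear P -> B}),
  [/\ ses f' g', forall x, k (f' x) = f x, forall z, g (k z) = h (g' z),
     forall z, k z = 0 -> g' z = 0 -> z = 0 &
     forall x y, g x = h y -> exists z, k z = x /\ g' z = y].
Proof.
move=> fg; case: (fg) => fI fE gS.
have [P [k [g' [E1 E2 E3]]]] := pullback g h.
have F x : exists z, k z = f x /\ g' z = 0.
  by apply: E2; rewrite linear0 (sesK fg).
have [||| f' f'E] := @linear_of_rel _ A P (fun x z => k z = f x /\ g' z = 0).
- move=> a u v u' v' [h1 h2] [h3 h4]; rewrite !linearP h1 h2 h3 h4.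
  by rewrite scaler0 addr0.
- exact: F.
- by move=> v [h1 h2]; apply: E3; rewrite // h1 linear0.
exists P, f', g', k; split=> [|x|z|z h1 h2|]; rewrite ?E1 //; last by apply: E3.
  split=> [|z|y].
  - by apply: lin_inj => x x0; have [] := f'E x; rewrite x0 linear0 => /esym/(inj_lin fI).
  - split=> [z0|[x <-]]; last by have [] := f'E x.
    have /fE[x xE] : g (k z) = 0 by rewrite E1 z0 linear0.
    have [h1 h2] := f'E x.
    by exists x; apply/subr0_eq/E3; rewrite linearB ?h1 ?h2 ?xE ?z0 subrr.
  have [x xE] := gS (h y); have [z [_ <-]] := E2 _ _ xE; by exists z.
by have [-> _] := f'E x.
Qed.

(* N and E are the syzygies of B and C with respect to the common cover P. *)
Lemma ses_syz A B C N P (f : {linear A -> B}) (g : {linear B -> C})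
  (n : {linear N -> P}) (q : {linear P -> B}) : ses f g -> ses n q ->
  exists (E : rmod R) (e : {linear E -> P}) (u : {linear N -> E})
    (v : {linear E -> A}), ses e (g \o q) /\ ses u v.
Proof.
move=> fg nq; case: (fg) => fI fE gS; case: (nq) => nI nE qS.
have [|E [e eg]] := @ses_ker _ _ (g \o q).
  by move=> y; have [x <-] := gS y; have [z <-] := qS x; exists z.
exists E, e; case: (eg) => eI eE _.
have [|v vE] := ses_fact fg (h := q \o e); first by move=> x; apply: (sesK eg).
have [|u uE] := ses_fact eg (h := n).
  by move=> x /=; rewrite (sesK nq) linear0.
exists u, v; split=> //; split.
- by apply: lin_inj => x x0; apply: (inj_lin nI); rewrite -uE x0 linear0.
- move=> y; split=> [y0|[x <-]].
    have /nE[x xE] : q (e y) = 0 by rewrite -[q _]vE y0 linear0.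
    by exists x; apply: eI; rewrite uE.
  by apply: (inj_lin fI); rewrite vE /= uE (sesK nq).
move=> x; have [z zE] := qS (f x).
have /eE[y yE] : (g \o q) z = 0 by rewrite /= zE (sesK fg).
by exists y; apply: fI; rewrite vE /= yE.
Qed.

(** U is the fibre product of B and P over C; its projections to P and to B have kernels A and N.
    Comparing the two sequences is the idea of Schanuel's lemma. *)
Lemma ses_pullback A B C N P (f : {linear A -> B}) (g : {linear B -> C})
  (n : {linear N -> P}) (q : {linear P -> C}) : ses f g -> ses n q ->
  exists (U : rmod R) (a : {linear A -> U}) (b : {linear U -> P})
    (c : {linear N -> U}) (d : {linear U -> B}), [/\ ses a b, ses c d,
    forall z, g (d z) = q (b z) & forall x, d (a x) = f x].
Proof.
move=> fg nq; case: (nq) => nI nE qS.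
have [U [a [b [d [ab da db E E']]]]] := pullback_ses q fg.
have NF x : exists z, d z = 0 /\ b z = n x.
  by apply: E'; rewrite linear0 (sesK nq).
have [||| c cE] := @linear_of_rel _ N U (fun x z => d z = 0 /\ b z = n x).
- move=> k u v u' v' [h1 h2] [h3 h4]; rewrite !linearP h1 h2 h3 h4.
  by rewrite scaler0 addr0.
- exact: NF.
- by move=> v [h1 h2]; apply: E; rewrite // h2 linear0.
exists U, a, b, c, d; split=> //; split.
- by apply: lin_inj => x x0; have [_] := cE x; rewrite x0 linear0 => /esym/(inj_lin nI).
- move=> z; split=> [z0|[x <-]]; last by have [] := cE x.
  have /nE[x xE] : q (b z) = 0 by rewrite -db z0 linear0.
  have [h1 h2] := cE x.
  by exists x; apply/subr0_eq/E; rewrite linearB ?h1 ?h2 ?xE ?z0 subrr.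
move=> y; have [z zE] := qS (g y); have [x [<- _]] := E' _ _ (esym zE).
by exists x.
Qed.

Lemma ses_cosyz A B C J D (f : {linear A -> B}) (g : {linear B -> C})
  (j : {linear B -> J}) (q : {linear J -> D}) : ses f g -> ses j q ->
  exists (E : rmod R) (e : {linear J -> E}) (u : {linear C -> E})
    (v : {linear E -> D}), ses (j \o f) e /\ ses u v.
Proof.
move=> fg jq; case: (fg) => fI fE gS; case: (jq) => jI jE qS.
have [|E [e ej]] := @ses_coker _ _ (j \o f); first by move=> x y /= /jI/fI.
exists E, e; case: (ej) => _ eE eS.
have [|u uE] := ses_cofact fg (h := e \o j); first by move=> x; apply: (sesK ej).
have [|v vE] := ses_cofact ej (h := q).
  by move=> x /=; rewrite (sesK jq).
exists u, v; split=> //; split.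
- apply: lin_inj => x; have [y <-] := gS x; rewrite uE /= => /eE[z zE].
  by apply/fE; exists z; apply: jI.
- move=> y; split=> [|[x <-]]; last first.
    by have [z <-] := gS x; rewrite uE /= vE (sesK jq).
  by have [z <-] := eS y; rewrite vE => /jE[x <-]; exists (g x); rewrite uE.
by move=> x; have [z <-] := qS x; exists (e z).
Qed.

Lemma ses_pushout A B C J D (f : {linear A -> B}) (g : {linear B -> C})
  (j : {linear A -> J}) (q : {linear J -> D}) : ses f g -> ses j q ->
  exists (U : rmod R) (a : {linear J -> U}) (b : {linear U -> C})
    (c : {linear B -> U}) (d : {linear U -> D}), ses a b /\ ses c d.
Proof.
move=> fg jq; case: (fg) => fI fE gS; case: (jq) => jI jE qS.
(* U is the quotient of B x J by the pairs [(f x, j x)], taken without a sign, so [c \o f] is minus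
   [a \o j]. *)
have [|U [e ej]] := @ses_coker _ _ (pair_map f j).
  by move=> x y [] /fI.
case: (ej) => _ eE eS; have eK x : e (f x, j x) = 0 by apply: (sesK ej).
have [a aE] : exists a : {linear J -> U}, forall z, a z = e (0, z).
  by exists (e \o pairr B J).
have [c cE] : exists c : {linear B -> U}, forall y, c y = e (y, 0).
  by exists (e \o pairl B J).
have ac y z : e (y, z) = c y + a z.
  by rewrite aE cE -linearD; congr (e (_, _)); rewrite /= ?addr0 ?add0r.
have [|b bE] := ses_cofact ej (h := g \o fst).
  by move=> x /=; rewrite (sesK fg).
have [|d dE] := ses_cofact ej (h := q \o snd).
  by move=> x /=; rewrite (sesK jq).
exists U, a, b, c, d; split; split.
- apply: lin_inj => x; rewrite aE => /eE[y [y0 <-]].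
  by rewrite (inj_lin fI y0) linear0.
- move=> x; split=> [|[z <-]]; last by rewrite aE bE /= linear0.
  have [[y z] <-] := eS x; rewrite bE /= => /fE[w <-].
  have E := eK w; rewrite (ac (f w) (j w)) addrC in E.
  by exists (z - j w); rewrite (ac (f w) z) linearB (addr0_eq E) addrC.
- by move=> x; have [y <-] := gS x; exists (c y); rewrite cE bE.
- apply: lin_inj => x; rewrite cE => /eE[y [<- y0]].
  by rewrite (inj_lin jI y0) linear0.
- move=> x; split=> [|[z <-]]; last by rewrite cE dE /= linear0.
  have [[y z] <-] := eS x; rewrite dE /= => /jE[w <-].
  have E := eK w; rewrite (ac (f w) (j w)) in E.
  by exists (y - f w); rewrite (ac y (j w)) linearB (addr0_eq E).
by move=> x; have [y <-] := qS x; exists (a y); rewrite aE dE.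
Qed.

End Diagrams.

(** * Vanishing of Ext *)

(** Ext^1(C, A) = 0 as an extension property: by pushing out along [h], it amounts to the splitting
    of every extension of C by A. *)
Definition E1 (R : nzRingType) (C A : rmod R) : Prop :=
  forall (U V : rmod R) (f : {linear U -> V}) (g : {linear V -> C}),
    ses f g -> forall h : {linear U -> A}, exists k : {linear V -> A},
      forall x, k (f x) = h x.

(* [Ext i C A] says that Ext^(i+1)(C, A) = 0. *)
Fixpoint Ext (R : nzRingType) (i : nat) (C A : rmod R) : Prop :=
  match i with
  | 0%N => E1 C A
  | j.+1 => forall (N P : rmod R) (f : {linear N -> P}) (g : {linear P -> C}),
      projective P -> ses f g -> Ext j N A
  end.

Section ExtTheory.

Context {R : nzRingType} {HR : modcat R}.
Implicit Types A B C D E H I J L M N P Q T U V W X Y Z : rmod R.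

(** The pullback of the sequence along [h] is an extension of X by A, which splits. *)
Lemma E1_lift X A B C (f : {linear A -> B}) (g : {linear B -> C})
  (h : {linear X -> C}) : E1 X A -> ses f g ->
  exists k : {linear X -> B}, forall x, g (k x) = h x.
Proof.
move=> e fg.
have [P [a [b [k [ab ka kb _ _]]]]] := pullback_ses h fg.
have [r ra] := e _ _ _ _ ab idfun.
have [s [bs _]] := ses_ret ab ra.
by exists (k \o s) => x /=; rewrite kb bs.
Qed.

(** An extension of [f \o h] to V induces a map from X to C; lifting that map through [g] gives the
    correction that brings the extension into A. *)
Lemma E1_of_lift X A B C (f : {linear A -> B}) (g : {linear B -> C}) :
  ses f g -> E1 X B -> (forall h : {linear X -> C},
  exists k : {linear X -> B}, forall x, g (k x) = h x) -> E1 X A.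
Proof.
move=> fg e lift U V u v uv h.
have [k kE] := e _ _ _ _ uv (f \o h).
have [|l lE] := ses_cofact uv (h := g \o k).
  by move=> x; rewrite /= kE /= (sesK fg).
have [m mE] := lift l.
have [|n nE] := ses_fact fg (h := k \- (m \o v)).
  by move=> x; rewrite /= linearB mE lE subrr.
exists n => x; case: (fg) => fI _ _; apply: fI.
by rewrite nE /= kE (sesK uv) linear0 subr0.
Qed.

Lemma E1_inj X A : injective_mod A -> E1 X A.
Proof. by move=> AJ U V f g [fI _ _] h; apply: AJ. Qed.

(** One projective presentation decides, because every extension of C is its pushout along some map
    [l] of the kernel. *)
Lemma E1_cover N P C X (n : {linear N -> P}) (q : {linear P -> C}) :
  projective P -> ses n q -> (forall h : {linear N -> X},
  exists k : {linear P -> X}, forall x, k (n x) = h x) -> E1 C X.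
Proof.
move=> PP nq ext U V u v uv h; case: (uv) => uI uE vS.
have [k kE] := PP _ _ v q vS.
have [|l lE] := ses_fact uv (h := k \o n).
  by move=> x; rewrite /= kE (sesK nq).
have [m mE] := ext (h \o l).
(* V is the pushout of n and l, and m \o n = h \o l. *)
have [] := @linear_of_rel _ V X (fun y z => exists x w, y = u x + k w /\ z = h x + m w).
- move=> a y z y' z' [x [w [-> ->]]] [x' [w' [-> ->]]].
  exists (a *: x + x'), (a *: w + w'); rewrite !linearP !scalerDr.
  by split; rewrite addrACA.
- move=> y; case: (nq) => _ _ qS; have [w wE] := qS (v y).
  have /uE[x xE] : v (y - k w) = 0 by rewrite linearB kE wE subrr.
  by exists (h x + m w), x, w; rewrite xE subrK.
- move=> z [x [w [E ->]]]; have qw : q w = 0.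
    by rewrite -kE -[LHS]add0r -{1}(sesK uv x) -linearD -E linear0.
  case: (nq) => _ nE _; move/nE: qw => [y yE].
  have xE : x = - l y.
    apply: uI; rewrite linearN lE /= yE. apply/eqP; rewrite -addr_eq0.
    by rewrite -E.
  by rewrite xE -yE mE /= linearN addNr.
move=> F FE; exists F => x; have [x' [w [E ->]]] := FE (u x).
have qw : q w = 0.
  by rewrite -kE -[LHS]add0r -{1}(sesK uv x') -linearD -E (sesK uv).
case: (nq) => _ nE _; move/nE: qw => [y yE].
rewrite -yE mE /= -linearD; congr (h _); apply: uI.
by rewrite linearD lE /= yE -E.
Qed.

Lemma E1_proj C A : projective C -> E1 C A.
Proof.
move=> CP U V f g fg h; case: (fg) => _ _ gS; have [s sE] := CP _ _ g idfun gS.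
by have [r [rf _]] := ses_sec fg sE; exists (h \o r) => x /=; rewrite rf.
Qed.

Section Mixed.

Variables (N P C A J A' : rmod R).
Variables (n : {linear N -> P}) (q : {linear P -> C}).
Variables (j : {linear A -> J}) (r : {linear J -> A'}).
Hypotheses (PP : projective P) (JJ : injective_mod J).
Hypotheses (nq : ses n q) (jr : ses j r).

(** Both sides say that Ext^2(C, A) = 0, once through a syzygy of C and once through a cosyzygy of
    A. Independence from the chosen presentations rests on this exchange. *)
Lemma E1_mixed : E1 N A <-> E1 C A'.
Proof.
case: (nq) (jr) => nI nE qS [jI jE rS]; split=> e.
  apply: (E1_cover PP nq) => h.
  have [k kE] := E1_lift h e jr; have [l lE] := JJ k nI.
  by exists (r \o l) => x; rewrite /= lE kE.
apply: (E1_of_lift jr); first exact: E1_inj.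
move=> h; have [k kE] := e _ _ _ _ nq h.
have [l lE] := PP k rS.
by exists (l \o n) => x; rewrite /= lE kE.
Qed.

End Mixed.

Lemma Ext_shiftI_down i C A J A' (j : {linear A -> J}) (r : {linear J -> A'}) :
  injective_mod J -> ses j r -> Ext i.+1 C A -> Ext i C A'.
Proof.
move=> JJ jr; elim: i C => [|i IH] C e.
  have [N [P [f [g [PP fg]]]]] := proj_cover C.
  by apply/(E1_mixed PP JJ fg jr); apply: e fg.
by move=> N P f g PP fg; apply: IH; apply: e fg.
Qed.

Lemma Ext_shiftI_up i C A J A' (j : {linear A -> J}) (r : {linear J -> A'}) :
  injective_mod J -> ses j r -> Ext i C A' -> Ext i.+1 C A.
Proof.
move=> JJ jr; elim: i C => [|i IH] C e N P f g PP fg.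
  by apply/(E1_mixed PP JJ fg jr).
by apply: IH; apply: e fg.
Qed.

(** [Ext] quantifies over all presentations of C. Passing to cosyzygies of A, with C fixed, shows
    that one presentation suffices. *)
Lemma Ext_shiftP_up i N P C A (n : {linear N -> P}) (q : {linear P -> C}) :
  projective P -> ses n q -> Ext i N A -> Ext i.+1 C A.
Proof.
move=> PP nq; elim: i A => [|i IH] A e;
  have [J [A' [j [r [JJ jr]]]]] := inj_hull A.
  by apply: (Ext_shiftI_up JJ jr); apply/(E1_mixed PP JJ nq jr).
by apply: (Ext_shiftI_up JJ jr); apply: IH; apply: (Ext_shiftI_down JJ jr e).
Qed.

Lemma Ext_inj i C A : injective_mod A -> Ext i C A.
Proof.
move=> AJ; elim: i C => [|i IH] C; first exact: E1_inj.
by move=> N P f g _ _; apply: IH.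
Qed.

Lemma Ext_proj i C A : projective C -> Ext i C A.
Proof.
elim: i C => [|i IH] C CP; first exact: E1_proj.
move=> N P f g PP fg; apply: IH.
by apply: retract_proj PP _; case: (ses_proj_retract fg CP).
Qed.

(** The induction runs over cosyzygies of A, since a retraction of C need not restrict to a
    retraction of arbitrarily chosen syzygies. *)
Lemma Ext_retractl i C D A : retract C D -> Ext i D A -> Ext i C A.
Proof.
move=> [s [r rs]]; elim: i A => [|i IH] A e;
  have [J [A' [j [q [JJ jq]]]]] := inj_hull A.
  apply: (E1_of_lift jq); first exact: E1_inj.
  move=> h; have [k kE] := E1_lift (h \o r) e jq.
  by exists (k \o s) => x; rewrite /= kE /= rs.
by apply: (Ext_shiftI_up JJ jq); apply: IH; apply: (Ext_shiftI_down JJ jq e).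
Qed.

Lemma Ext_retractr i X A B : retract A B -> Ext i X B -> Ext i X A.
Proof.
move=> [s [r rs]]; elim: i X => [|i IH] X e; last first.
  by move=> N P f g PP fg; apply: IH; apply: e fg.
move=> U V f g fg h; have [k kE] := e _ _ _ _ fg (s \o h).
by exists (r \o k) => x; rewrite /= kE /= rs.
Qed.

Lemma Ext_powr i X Y m : Ext i X Y -> Ext i X (powm m Y).
Proof.
elim: i X => [|i IH] X e; last first.
  by move=> N P f g PP fg; apply: IH; apply: e fg.
move=> U V f g fg h; have [k kE] := choice (fun i => e _ _ _ _ fg (powm_pr Y i \o h)).
by exists (powm_map k) => x; apply: powm_ext => i; rewrite powm_mapE kE.
Qed.

Lemma Ext_powl i X Y m : Ext i X Y -> Ext i (powm m X) Y.
Proof.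
elim: i Y => [|i IH] Y e;
  have [J [A' [j [q [JJ jq]]]]] := inj_hull Y.
  apply: (E1_of_lift jq); first exact: E1_inj.
  move=> h; have [k kE] := choice (fun i => E1_lift (h \o powm_in X i) e jq).
  exists (powm_sum k) => x; rewrite /= [in RHS](powm_eta x) !linear_sum.
  by apply: eq_bigr => a _; rewrite kE.
by apply: (Ext_shiftI_up JJ jq); apply: IH; apply: (Ext_shiftI_down JJ jq e).
Qed.

(** * Fragments of the long exact sequence *)

Section LongExact.

Variables (A B C : rmod R) (f : {linear A -> B}) (g : {linear B -> C}).
Hypothesis fg : ses f g.

(** In the names of this family, left, mid and right tell the term of the sequence for which
    vanishing is concluded, and l or r the argument of [Ext] in which the sequence is placed. *)
Lemma Ext_midl i X : Ext i A X -> Ext i C X -> Ext i B X.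
Proof.
elim: i X => [|i IH] X a c;
  have [J [X' [j [q [JJ jq]]]]] := inj_hull X; last first.
  by apply: (Ext_shiftI_up JJ jq); apply: IH; [exact: (Ext_shiftI_down JJ jq a)
    | exact: (Ext_shiftI_down JJ jq c)].
apply: (E1_of_lift jq); first exact: E1_inj.
move=> h; have [k kE] := E1_lift (h \o f) a jq.
case: (fg) => fI _ _; have [k' k'E] := JJ _ _ f k fI.
have [|l lE] := ses_cofact fg (h := h \- (q \o k')).
  by move=> x; rewrite /= k'E kE subrr.
have [m mE] := E1_lift l c jq.
exists ((m \o g) \+ k') => x; rewrite linearD /= mE lE /=.
by rewrite subrK.
Qed.

End LongExact.

Lemma Ext_midr A B C (f : {linear A -> B}) (g : {linear B -> C}) i X :
  ses f g -> Ext i X A -> Ext i X C -> Ext i X B.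
Proof.
move=> fg; elim: i X => [|i IH] X a c; last first.
  by move=> N P u v PP uv; apply: IH; [apply: a uv | apply: c uv].
have [N [P [u [v [PP uv]]]]] := proj_cover X.
apply: (E1_cover PP uv) => h.
have [k kE] := c _ _ _ _ uv (g \o h).
case: (fg) => _ _ gS; have [k' k'E] := PP _ _ g k gS.
have [|l lE] := ses_fact fg (h := h \- (k' \o u)).
  by move=> x; rewrite /= linearB k'E kE subrr.
have [m mE] := a _ _ _ _ uv l.
exists ((f \o m) \+ k') => x; rewrite /= mE lE /=.
by rewrite subrK.
Qed.

(** Covering B and C by the same P gives an exact sequence 0 -> N -> E -> A -> 0 with N a syzygy of
    B and E one of C, which lowers the degree by one. *)
Lemma Ext_rightl A B C (f : {linear A -> B}) (g : {linear B -> C}) i X :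
  ses f g -> Ext i A X -> Ext i.+1 B X -> Ext i.+1 C X.
Proof.
move=> fg a b; have [N [P [u [v [PP uv]]]]] := proj_cover B.
have [E [e [n [m [eE nm]]]]] := ses_syz fg uv.
apply: (Ext_shiftP_up PP eE); apply: (Ext_midl nm) => //.
exact: b uv.
Qed.

(** The fibre product of B and P over C is an extension of B by a syzygy of C, and it contains A as
    a summand because P is projective. *)
Lemma Ext_leftl A B C (f : {linear A -> B}) (g : {linear B -> C}) i X :
  ses f g -> Ext i B X -> Ext i.+1 C X -> Ext i A X.
Proof.
move=> fg b c; have [N [P [u [v [PP uv]]]]] := proj_cover C.
have [U [s [t [s' [t' [st st' _ _]]]]]] := ses_pullback fg uv.
have [AU _] := ses_proj_retract st PP.
by apply: Ext_retractl AU _; apply: (Ext_midl st') => //; apply: c uv.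
Qed.

Lemma Ext_leftr A B C (f : {linear A -> B}) (g : {linear B -> C}) i X :
  ses f g -> Ext i X C -> Ext i.+1 X B -> Ext i.+1 X A.
Proof.
move=> fg c b; have [J [D [u [v [JJ uv]]]]] := inj_hull B.
have [E [e [n [m [eE nm]]]]] := ses_cosyz fg uv.
apply: (Ext_shiftI_up JJ eE); apply: (Ext_midr nm) => //.
exact: (Ext_shiftI_down JJ uv b).
Qed.

Lemma Ext_rightr A B C (f : {linear A -> B}) (g : {linear B -> C}) i X :
  ses f g -> Ext i X B -> Ext i.+1 X A -> Ext i X C.
Proof.
move=> fg b a; have [J [D [u [v [JJ uv]]]]] := inj_hull A.
have [U [s [t [s' [t' [st st']]]]]] := ses_pushout fg uv.
have [_ CU] := ses_inj_retract st JJ.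
apply: Ext_retractr CU _; apply: (Ext_midr st') => //.
exact: (Ext_shiftI_down JJ uv a).
Qed.

Lemma Ext_proj_split A B C (f : {linear A -> B}) (g : {linear B -> C}) :
  ses f g -> E1 C A -> retract A B /\ retract C B.
Proof.
move=> fg e; have [r rE] := e _ _ _ _ fg idfun.
have [s [sE _]] := ses_ret fg rE; split; first by exists f, r.
by exists s, g.
Qed.

Lemma E1_all_proj C : (forall X, E1 C X) -> projective C.
Proof.
move=> e; have [N [P [f [g [PP fg]]]]] := proj_cover C.
by apply: retract_proj PP _; case: (Ext_proj_split fg (e N)).
Qed.

Lemma E1_all_inj A : (forall X, E1 X A) -> injective_mod A.
Proof.
move=> e; have [J [N [f [g [JJ fg]]]]] := inj_hull A.
by apply: retract_injm JJ _; case: (Ext_proj_split fg (e N)).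
Qed.

(** Because of the shift in [Ext], index n stands for the vanishing of Ext^(n+1), that is for
    dimension at most n. *)
Definition pd_bound M n := forall X, Ext n M X.
Definition id_bound M n := forall X, Ext n X M.

Lemma pd_bound0 M : pd_bound M 0 <-> projective M.
Proof. by split=> [/E1_all_proj|MP X]; last exact: E1_proj. Qed.

Lemma id_bound0 M : id_bound M 0 <-> injective_mod M.
Proof. by split=> [/E1_all_inj|MP X]; last exact: E1_inj. Qed.

Lemma Ext_pd M n m X : pd_bound M n -> (n <= m)%N -> Ext m M X.
Proof.
move=> Mn; elim: m X => [|m IH] X; first by rewrite leqn0 => /eqP <-.
rewrite leq_eqVlt => /predU1P[<-//|nm].
have [J [A' [j [q [JJ jq]]]]] := inj_hull X.
by apply: (Ext_shiftI_up JJ jq); apply: IH.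
Qed.

Lemma Ext_id M n m X : id_bound M n -> (n <= m)%N -> Ext m X M.
Proof.
move=> Mn; elim: m X => [|m IH] X; first by rewrite leqn0 => /eqP <-.
rewrite leq_eqVlt => /predU1P[<-//|nm] N P f g PP fg; exact: IH.
Qed.

Lemma pd_mono M n m : (n <= m)%N -> pd_bound M n -> pd_bound M m.
Proof. by move=> nm Mn X; apply: Ext_pd Mn nm. Qed.

Lemma id_mono M n m : (n <= m)%N -> id_bound M n -> id_bound M m.
Proof. by move=> nm Mn X; apply: Ext_id Mn nm. Qed.

Lemma pd_syz N P M (f : {linear N -> P}) (g : {linear P -> M}) n :
  projective P -> ses f g -> pd_bound M n.+1 <-> pd_bound N n.
Proof.
move=> PP fg; split=> H X; first exact: H fg.
exact: (Ext_shiftP_up PP fg).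
Qed.

Lemma id_cosyz N J M (f : {linear M -> J}) (g : {linear J -> N}) n :
  injective_mod J -> ses f g -> id_bound M n.+1 <-> id_bound N n.
Proof.
move=> JJ fg; split=> H X; first exact: (Ext_shiftI_down JJ fg).
exact: (Ext_shiftI_up JJ fg).
Qed.

Lemma pd_retract M N n : retract M N -> pd_bound N n -> pd_bound M n.
Proof. by move=> MN Nn X; apply: Ext_retractl MN _. Qed.

Lemma id_retract M N n : retract M N -> id_bound N n -> id_bound M n.
Proof. by move=> MN Nn X; apply: Ext_retractr MN _. Qed.

Lemma pd_powm m M n : pd_bound M n -> pd_bound (powm m M) n.
Proof. by move=> Mn X; apply: Ext_powl. Qed.

Lemma id_powm m M n : id_bound M n -> id_bound (powm m M) n.
Proof. by move=> Mn X; apply: Ext_powr. Qed.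

Lemma pd_prodm M N n : pd_bound M n -> pd_bound N n -> pd_bound (prodm M N) n.
Proof. by move=> Mn Nn X; apply: (Ext_midl (ses_prod M N)); [apply: Mn | apply: Nn]. Qed.

Section Bounds.

Variables (A B C : rmod R) (f : {linear A -> B}) (g : {linear B -> C}).
Hypothesis fg : ses f g.

Lemma pd_right n : pd_bound A n -> pd_bound B n.+1 -> pd_bound C n.+1.
Proof. by move=> a b X; apply: (Ext_rightl fg); [apply: a | apply: b]. Qed.

Lemma pd_left n : pd_bound B n -> pd_bound C n.+1 -> pd_bound A n.
Proof. by move=> a b X; apply: (Ext_leftl fg); [apply: a | apply: b]. Qed.

Lemma id_left n : id_bound C n -> id_bound B n.+1 -> id_bound A n.+1.
Proof. by move=> a b X; apply: (Ext_leftr fg); [apply: a | apply: b]. Qed.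

Lemma id_right n : id_bound B n -> id_bound A n.+1 -> id_bound C n.
Proof. by move=> a b X; apply: (Ext_rightr fg); [apply: a | apply: b]. Qed.

End Bounds.

(** The last cosyzygy itself lies in [Q], so a coresolution of length n has n + 1 terms. *)
Fixpoint cores (Q : rmod R -> Prop) n M : Prop :=
  match n with
  | 0%N => Q M
  | m.+1 => exists (X N : rmod R) (f : {linear M -> X}) (g : {linear X -> N}),
      [/\ Q X, ses f g & cores Q m N]
  end.

Fixpoint resl (Q : rmod R -> Prop) n M : Prop :=
  match n with
  | 0%N => Q M
  | m.+1 => exists (X N : rmod R) (f : {linear N -> X}) (g : {linear X -> M}),
      [/\ Q X, ses f g & resl Q m N]
  end.

Lemma cores_id n M : cores (@injective_mod R) n M <-> id_bound M n.
Proof.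
elim: n M => [|n IH] M /=; first by rewrite id_bound0.
split=> [[J [N [f [g [JJ fg /IH Nn]]]]]|Mn].
  exact/(id_cosyz _ JJ fg).
have [J [N [f [g [JJ fg]]]]] := inj_hull M.
by exists J, N, f, g; split=> //; apply/IH/(id_cosyz _ JJ fg).
Qed.

Lemma resl_pd n M : resl (@projective R) n M <-> pd_bound M n.
Proof.
elim: n M => [|n IH] M /=; first by rewrite pd_bound0.
split=> [[J [N [f [g [JJ fg /IH Nn]]]]]|Mn].
  exact/(pd_syz _ JJ fg).
have [N [J [f [g [JJ fg]]]]] := proj_cover M.
by exists J, N, f, g; split=> //; apply/IH/(pd_syz _ JJ fg).
Qed.

Lemma cores_pad (Q : rmod R -> Prop) n M : Q (zerom R) -> cores Q n M -> cores Q n.+1 M.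
Proof.
move=> Q0; elim: n M => [|n IH] M.
  by move=> MQ; have [z zE] := ses_idl M; exists M, (zerom R), idfun, z.
move=> [X [N [f [g [XQ fg /IH Nn]]]]].
by exists X, N, f, g.
Qed.

Lemma cores_sub (Q Q' : rmod R -> Prop) n M : (forall X, Q X -> Q' X) ->
  cores Q n M -> cores Q' n M.
Proof.
move=> QQ; elim: n M => [|n IH] M; first exact: QQ.
move=> [X [N [f [g [XQ fg /IH Nn]]]]].
by exists X, N, f, g; split=> //; apply: QQ.
Qed.

End ExtTheory.

(** * Resolutions *)

Section Resolutions.

Context {R : nzRingType} {HR : modcat R}.
Implicit Types A B C D E H I J L M N P Q T U V W X Y Z : rmod R.

Section Tail.

Variables (M K : rmod R) (P : resolution M) (k : {linear K -> P 0%N}).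
Variable (e : {linear P 1%N -> K}).
Hypotheses (kI : ses k (res_aug P)) (eE : forall x, k (e x) = res_diff P 0 x).

Lemma tail_surj : surj e.
Proof.
move=> y; have /(res_exact0 (r := P)) [x xE] : res_aug P (k y) = 0 by apply: (sesK kI).
by exists x; case: kI => I _ _; apply: I; rewrite eE.
Qed.

Lemma tail_exact : exact_at (res_diff P 1) e.
Proof.
move=> y; rewrite -(res_exact (r := P) (i := 0%N)) -eE; split=> [->|]; first by rewrite linear0.
by case: kI => I _ _; apply: inj_lin.
Qed.

Definition res_tail : resolution K := @Resolution _ K (fun i => P i.+1) e
  (fun i => res_diff P i.+1) tail_surj tail_exact (fun i => res_exact (r := P) (i:=i.+1)).

End Tail.

Lemma tail_ex M (P : resolution M) : exists (K : rmod R)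
  (k : {linear K -> P 0%N}) (e : {linear P 1%N -> K}),
  ses k (res_aug P) /\ forall x, k (e x) = res_diff P 0 x.
Proof.
have [K [k kE]] := ses_ker (@res_aug_surj _ _ P).
have [|e eE] := ses_fact kE (h := res_diff P 0).
  by move=> x; apply/(res_exact0 (r := P)); exists x.
by exists K, k, e.
Qed.

Lemma resl_of_resolution (Q : rmod R -> Prop) n M (P : resolution M) :
  (forall X Y, retract X Y -> Q Y -> Q X) -> (forall i, Q (P i)) ->
  (forall i, (n < i)%N -> trivial_mod (P i)) -> resl Q n M.
Proof.
move=> Qr; elim: n M P => [|n IH] M P PQ P0.
  apply: Qr (PQ 0%N); have [||s [sK Ks]] := lin_bij (f := res_aug P).
  - apply: lin_inj => x /(res_exact0 (r := P))[y <-].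
    by rewrite (P0 1%N isT y) linear0.
  - exact: res_aug_surj.
  by exists s, (res_aug P).
have [K [k [e [kE eE]]]] := tail_ex P.
exists (P 0%N), K, k, (res_aug P); split=> //.
by apply: (IH _ (res_tail kE eE)) => [i|i ni]; [apply: (PQ i.+1) | apply: P0].
Qed.

Definition res_zero : resolution (zerom R).
Proof.
apply: (@Resolution _ (zerom R) (fun=> zerom R) \0 (fun=> \0)).
- by move=> y; exists 0; rewrite (zeromP y).
- by move=> y; split=> // _; exists 0; rewrite (zeromP y).
- by move=> _ y; split=> // _; exists 0; rewrite (zeromP y).
Defined.

Section Cons.

Variables (N X M : rmod R) (f : {linear N -> X}) (g : {linear X -> M}).
Hypothesis fg : ses f g.
Variable P : resolution N.

Definition cons_ob (i : nat) : rmod R := if i is j.+1 then P j else X.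
Definition cons_diff (i : nat) : {linear cons_ob i.+1 -> cons_ob i} :=
  match i with 0%N => f \o res_aug P | j.+1 => res_diff P j end.

Lemma cons_exact0 : exact_at (cons_diff 0) g.
Proof.
case: fg => fI fE gS y; split=> [/fE[x <-]|[x <-]]; last exact: (sesK fg).
by have [z <-] := @res_aug_surj _ _ P x; exists z.
Qed.

Lemma cons_exact i : exact_at (cons_diff i.+1) (cons_diff i).
Proof.
case: i => [|i]; last exact: (res_exact (r := P)).
move=> y; rewrite -(res_exact0 (r := P)) /=; case: fg => fI fE gS.
by split=> [/(inj_lin fI)//|->]; rewrite linear0.
Qed.

Definition res_cons : resolution M :=
  @Resolution _ M cons_ob g cons_diff (let: And3 _ _ gS := fg in gS) cons_exact0
    cons_exact.

End Cons.

Lemma resolution_of_resl (Q : rmod R -> Prop) n M : Q (zerom R) -> resl Q n M ->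
  exists P : resolution M, (forall i, Q (P i)) /\
    forall i, (n < i)%N -> trivial_mod (P i).
Proof.
move=> Q0; elim: n M => [|n IH] M.
  move=> MQ; have [z zE] := ses_idr M; exists (res_cons zE res_zero).
  by split=> -[|i]//= _ x; rewrite (zeromP x).
move=> [X [N [f [g [XQ fg /IH[P [PQ P0]]]]]]].
by exists (res_cons fg P); split=> -[|i] //= ni; apply: P0.
Qed.

Lemma pd_leP M n : pd_le M n <-> pd_bound M n.
Proof.
rewrite -resl_pd; split=> [[P [PP P0]]|].
  by apply: resl_of_resolution PP P0 => X Y XY YP; apply: retract_proj XY.
by apply: resolution_of_resl; apply: proj_zero.
Qed.

Section CoTail.

Variables (M K : rmod R) (C : coresolution M) (q : {linear C 0%N -> K}).
Variable (e : {linear K -> C 1%N}).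
Hypotheses (qS : ses (cores_aug C) q) (eE : forall x, e (q x) = cores_diff C 0 x).

Lemma cotail_inj : injective e.
Proof.
apply: lin_inj => y; case: qS => _ qE qS'; have [x <-] := qS' y.
by rewrite eE => /(cores_exact0 (c := C))[z <-]; apply: (sesK qS).
Qed.

Lemma cotail_exact : exact_at e (cores_diff C 1).
Proof.
move=> y; rewrite (cores_exact (c := C) (i := 0%N)); case: qS => _ _ qS'.
split=> [[x <-]|[x <-]]; first by exists (q x); rewrite eE.
by have [z <-] := qS' x; exists z; rewrite eE.
Qed.

Definition cores_tail : coresolution K := @Coresolution _ K (fun i => C i.+1) e
  (fun i => cores_diff C i.+1) cotail_inj cotail_exact
  (fun i => cores_exact (c := C) (i:=i.+1)).

End CoTail.

Lemma cotail_ex M (C : coresolution M) : exists (K : rmod R)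
  (q : {linear C 0%N -> K}) (e : {linear K -> C 1%N}),
  ses (cores_aug C) q /\ forall x, e (q x) = cores_diff C 0 x.
Proof.
have [K [k kE]] := ses_coker (@cores_aug_inj _ _ C).
have [|e eE] := ses_cofact kE (h := cores_diff C 0).
  by move=> x; apply/(cores_exact0 (c := C)); exists x.
by exists K, k, e.
Qed.

Lemma cores_of_coresolution (Q : rmod R -> Prop) n M (C : coresolution M) :
  (forall X Y, retract X Y -> Q Y -> Q X) -> (forall i, Q (C i)) ->
  (forall i, (n < i)%N -> trivial_mod (C i)) -> cores Q n M.
Proof.
move=> Qr; elim: n M C => [|n IH] M C CQ C0.
  apply: Qr (CQ 0%N); have [||s [sK Ks]] := lin_bij (f := cores_aug C).
  - exact: cores_aug_inj.
  - by move=> y; apply/(cores_exact0 (c := C)); apply: C0.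
  by exists (cores_aug C), s.
have [K [k [e [kE eE]]]] := cotail_ex C.
exists (C 0%N), K, (cores_aug C), k; split=> //.
by apply: (IH _ (cores_tail kE eE)) => [i|i ni]; [apply: (CQ i.+1) | apply: C0].
Qed.

Definition cores_zero : coresolution (zerom R).
Proof.
apply: (@Coresolution _ (zerom R) (fun=> zerom R) \0 (fun=> \0)).
- by move=> x y _; rewrite (zeromP x) (zeromP y).
- by move=> y; split=> // _; exists 0; rewrite (zeromP y).
- by move=> _ y; split=> // _; exists 0; rewrite (zeromP y).
Defined.

Section CoCons.

Variables (M X N : rmod R) (f : {linear M -> X}) (g : {linear X -> N}).
Hypothesis fg : ses f g.
Variable C : coresolution N.

Definition cocons_ob (i : nat) : rmod R := if i is j.+1 then C j else X.
Definition cocons_diff (i : nat) : {linear cocons_ob i -> cocons_ob i.+1} :=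
  match i with 0%N => cores_aug C \o g | j.+1 => cores_diff C j end.

Lemma cocons_exact0 : exact_at f (cocons_diff 0).
Proof.
case: fg => fI fE gS y; rewrite -fE /=; split=> [|->]; last by rewrite linear0.
exact/inj_lin/cores_aug_inj.
Qed.

Lemma cocons_exact i : exact_at (cocons_diff i) (cocons_diff i.+1).
Proof.
case: i => [|i]; last exact: (cores_exact (c := C)).
move=> y; rewrite (cores_exact0 (c := C)) /=; case: fg => fI fE gS.
split=> [[x <-]|[x <-]]; last by exists (g x).
by have [z <-] := gS x; exists z.
Qed.

Definition cores_cons : coresolution M :=
  @Coresolution _ M cocons_ob f cocons_diff (let: And3 fI _ _ := fg in fI)
    cocons_exact0 cocons_exact.

End CoCons.

Lemma coresolution_of_cores (Q : rmod R -> Prop) n M : Q (zerom R) -> cores Q n M ->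
  exists C : coresolution M, (forall i, Q (C i)) /\
    forall i, (n < i)%N -> trivial_mod (C i).
Proof.
move=> Q0; elim: n M => [|n IH] M.
  move=> MQ; have [z zE] := ses_idl M; exists (cores_cons zE cores_zero).
  by split=> -[|i]//= _ x; rewrite (zeromP x).
move=> [X [N [f [g [XQ fg /IH[P [PQ P0]]]]]]].
by exists (cores_cons fg P); split=> -[|i] //= ni; apply: P0.
Qed.

Lemma injm_zero : injective_mod (zerom R).
Proof. by move=> A B j f jI; exists \0 => x; rewrite (zeromP (f x)). Qed.

Lemma id_leP M n : id_le M n <-> id_bound M n.
Proof.
rewrite -cores_id; split=> [[P [PP P0]]|].
  by apply: cores_of_coresolution PP P0 => X Y XY YP; apply: retract_injm XY.
by apply: coresolution_of_cores; apply: injm_zero.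
Qed.

(** A cocycle on [P 1] is a map on the first syzygy, so cohomology in degree one vanishes exactly
    when such maps extend to [P 0]; higher degrees follow by dropping [P 0]. *)
Lemma cohomology_Ext M N (P : resolution M) i : (forall j, projective (P j)) ->
  cohomology_vanishes N P i.+1 <-> Ext i M N.
Proof.
elim: i M P => [|i IH] M P PP; have [K [k [e [kE eE]]]] := tail_ex P.
  case: (kE) => kI _ _; have eS := tail_surj kE eE; have ex := tail_exact kE eE.
  split=> [H|H f f0].
    apply: (E1_cover (PP 0%N) kE) => h.
    have [|g gE] := H (h \o e).
      by move=> x /=; rewrite (_ : e _ = 0) ?linear0 //; apply/ex; exists x.
    exists g => y; have [x <-] := eS y; by rewrite eE -gE.
  have [|h hE] := fact_surj (f := f) eS.
    by move=> x /ex[y <-].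
  have [g gE] := H _ _ _ _ kE h; exists g => x.
  by rewrite -eE gE hE.
rewrite -[X in X <-> _]/(cohomology_vanishes N (res_tail kE eE) i.+1).
rewrite IH; last by move=> j; apply: (PP j.+1).
by split=> H; [apply: (Ext_shiftP_up (PP 0%N) kE) | apply: H kE].
Qed.

Lemma Ext_vanishes_Ext i M N : Ext_vanishes i.+1 M N -> Ext i M N.
Proof. by move=> [P [PP /cohomology_Ext]]; apply. Qed.

(** [Ext_vanishes] asserts that some projective resolution exists, and the bound on pd M provides
    it. *)
Lemma Ext_vanishesP i M N n : pd_bound M n -> Ext_vanishes i.+1 M N <-> Ext i M N.
Proof.
move=> /pd_leP[P [PP _]]; split=> [|e]; first exact: Ext_vanishes_Ext.
by exists P; split=> //; apply/cohomology_Ext.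
Qed.

Lemma in_addP T M : in_add T M <-> exists m, retract M (powm m T).
Proof.
split=> [[m [N [f fB]]]|[m [s [r rs]]]].
  exists m; have [||g [gf fg]] := lin_bij (f := f).
  - exact: bij_inj.
  - by case: fB => g _ gP y; exists (g y).
  have iL a (x y : M) : f (a *: x + y, 0) = a *: f (x, 0) + f (y, 0).
    rewrite -linearP; congr (f (_, _)); by rewrite /= scaler0 addr0.
  exists (mklin iL), (fst \o g) => x; by rewrite /= gf.
have [K [k [kI kE]]] := ker_ex r.
exists m, K; exists (copair s k).
apply: inj_surj_bij => [|y].
  apply: lin_inj => -[x z] /= E.
  have x0 : x = 0.
    have := congr1 r E; rewrite linearD rs linear0.
    have -> : r (k z) = 0 by apply/kE; exists z.
    by rewrite addr0.
  by rewrite x0 linear0 add0r in E *; rewrite (inj_lin kI E).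
have /kE[z zE] : r (y - s (r y)) = 0 by rewrite linearB rs subrr.
by exists (r y, z); rewrite /= zE addrC subrK.
Qed.

Lemma in_add_retract T M N : retract M N -> in_add T N -> in_add T M.
Proof.
move=> MN /in_addP[m NT]; apply/in_addP; exists m; exact: retract_trans NT.
Qed.

Lemma in_add_zero T : in_add T (zerom R).
Proof.
apply/in_addP; exists 0%N, \0, \0 => x; by rewrite (zeromP x).
Qed.

Lemma in_add_refl T : in_add T T.
Proof.
apply/in_addP; exists 1%N, (powm_in T ord0), (powm_pr T ord0) => x.
by rewrite /= ffunE.
Qed.

Lemma Ext_addl i T M X : in_add T M -> Ext i T X -> Ext i M X.
Proof.
by move=> /in_addP[m MT] e; apply: Ext_retractl MT _; apply: Ext_powl.
Qed.

Lemma Ext_addr i T M X : in_add T M -> Ext i X T -> Ext i X M.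
Proof.
by move=> /in_addP[m MT] e; apply: Ext_retractr MT _; apply: Ext_powr.
Qed.

Lemma proj_in_add P : projective P -> in_add (regular R) P.
Proof.
move=> PP; have [m [p pS]] := enough_free P; have [s sE] := PP _ _ p idfun pS.
by apply/in_addP; exists m, s, p.
Qed.

End Resolutions.

(** * The Auslander condition for the opposite algebra *)

Section AuslanderSymmetry.

Context {R : nzRingType} {HR : modcat R}.
Implicit Types A B C D E H I J L M N P Q T U V W X Y Z : rmod R.

(* [AG k 0 (regular R)] is the k-Gorenstein condition for some injective resolution, *)
(* [coAG k 0 (D R)] the dual of the same condition for the opposite ring. *)
Fixpoint AG (k s : nat) M : Prop :=
  match k with
  | 0%N => True
  | l.+1 => exists (I N : rmod R) (f : {linear M -> I}) (g : {linear I -> N}),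
      [/\ injective_mod I, pd_bound I s, ses f g & AG l s.+1 N]
  end.

Fixpoint coAG (k s : nat) M : Prop :=
  match k with
  | 0%N => True
  | l.+1 => exists (P N : rmod R) (f : {linear N -> P}) (g : {linear P -> M}),
      [/\ projective P, id_bound P s, ses f g & coAG l s.+1 N]
  end.

Fixpoint syz (m : nat) V C : Prop :=
  match m with
  | 0%N => V = C
  | l.+1 => exists (P N : rmod R) (f : {linear N -> P}) (g : {linear P -> C}),
      [/\ projective P, ses f g & syz l V N]
  end.

Lemma Ext_syz i m V C X : syz m V C -> Ext (i + m) C X -> Ext i V X.
Proof.
elim: m C => [|m IH] C /=; first by move=> ->; rewrite addn0.
by move=> [P [N [f [g [PP fg /IH H]]]]]; rewrite addnS => e; apply/H/(e _ _ _ _ PP fg).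
Qed.

(** The section makes U the sum of M and Y, so adding Y to the cover P leaves the syzygy N
    unchanged. *)
Lemma ses_add_split N P M U Y (n : {linear N -> P}) (q : {linear P -> M})
  (i : {linear M -> U}) (p : {linear U -> Y}) (s : {linear Y -> U}) :
  ses n q -> ses i p -> (forall y, p (s y) = y) ->
  ses (pairl P Y \o n) (copair (i \o q) s).
Proof.
move=> nq ip ps; case: (nq) (ip) => nI nE qS [iI iE pS]; split=> [x y []|[x y]|z].
- exact: nI.
- split=> /= [E|[z [<- <-]]]; last by rewrite (sesK nq) !linear0 addr0.
  have y0 : y = 0.
    by have := congr1 p E; rewrite linearD (sesK ip) ps add0r linear0.
  move: E; rewrite y0 linear0 addr0 => /(inj_lin iI)/nE[z <-]; by exists z.
have /iE[m mE] : p (z - s (p z)) = 0 by rewrite linearB ps subrr.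
have [x xE] := qS m; exists (x, p z); by rewrite /= xE mE subrK.
Qed.

(** Rotating the given sequence and taking syzygies gives, up to projective summands, an exact
    sequence from the (m+1)-st syzygy of I through that of C' to the m-th syzygy of C. Here V' is
    built so that the prescribed Z and V occur exactly. *)
Lemma syz_pullback m V C I C' Z (f : {linear C -> I}) (g : {linear I -> C'}) :
  syz m V C -> ses f g -> syz m.+1 Z I ->
  exists (V' : rmod R) (a : {linear Z -> V'}) (b : {linear V' -> V}),
    syz m.+1 V' C' /\ ses a b.
Proof.
elim: m C I C' f g => [|m IH] C I C' f g.
  move=> -> fg [P [N [n [q [PP nq ->]]]]].
  have [E [e [u [v [eE uv]]]]] := ses_syz fg nq.
  by exists E, u, v; split=> //; exists P, E, e, (g \o q).
move=> [Y [C1 [c [y [YP cy VC1]]]]] fg [Q [N [n [q [QP nq]]]]].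
move=> [Q1 [N1 [n1 [q1 [Q1P nq1 ZN1]]]]].
have [E [e [u [v [eE uv]]]]] := ses_syz fg nq.
have [U [a [b [s [t [ab st _ _]]]]]] := ses_pullback uv cy.
have [sec secE] : exists k : {linear Y -> U}, forall z, b (k z) = z.
  by apply: (YP _ _ b idfun); case: ab.
have ZU : syz m.+1 Z U.
  exists (prodm Q1 Y), N1, (pairl Q1 Y \o n1), (copair (a \o q1) sec).
  by split=> //; [apply: proj_prodm | apply: ses_add_split nq1 ab secE].
have [V' [a' [b' [V'E ab']]]] := IH _ _ _ _ _ VC1 st ZU.
exists V', a', b'; split=> //.
by exists Q, E, e, (g \o q).
Qed.

Lemma ses_proj_mid A B C (f : {linear A -> B}) (g : {linear B -> C}) :
  ses f g -> projective A -> projective C -> projective B.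
Proof.
move=> fg AP CP; apply/pd_bound0 => X.
by apply: (Ext_midl fg); apply: Ext_proj.
Qed.

Definition small_cover j X := exists (P N : rmod R) (f : {linear N -> P})
  (g : {linear P -> X}), [/\ projective P, id_bound P j & ses f g].

(* Only the last term of the resolution of M has to be controlled. *)
Lemma small_syzygy j d i M : (forall k X, (k < j)%N -> id_bound X k -> small_cover k X) ->
  (i + d <= j)%N -> pd_bound M d -> id_bound M i ->
  exists Z, [/\ syz d Z M, projective Z & id_bound Z (i + d)].
Proof.
move=> IH; elim: d i M => [|d IHd] i M ij Md Mi.
  by exists M; rewrite addn0; split=> //; apply/pd_bound0.
rewrite addnS in ij.
have [P [N [f [g [PP Pi fg]]]]] := IH i M (leq_ltn_trans (leq_addr d i) ij) Mi.
have Nd : pd_bound N d by apply/(pd_syz _ PP fg).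
have Ni : id_bound N i.+1 by apply: (id_left fg Mi); apply: id_mono Pi.
have [|Z [ZN ZP Zi]] := IHd i.+1 N _ Nd Ni; first by rewrite addSn.
by exists Z; rewrite -addSnnS; split=> //; exists P, N, f, g.
Qed.

Hypothesis R_AG : forall k, AG k 0 (regular R).

(** In the induction C is the (s+1)-st cosyzygy of the regular module and V an s-th syzygy of C.
    Each further injective enters only through its last projective syzygy Z. *)
Lemma small_approx j : (forall k X, (k < j)%N -> id_bound X k -> small_cover k X) ->
  exists (Q V C : rmod R) (a : {linear regular R -> Q}) (b : {linear Q -> V}),
    [/\ ses a b, projective Q, id_bound Q j & syz j V C].
Proof.
move=> IH; suff H s : (s <= j)%N ->
    exists (Q V C : rmod R) (a : {linear regular R -> Q}) (b : {linear Q -> V}),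
    [/\ ses a b, projective Q, id_bound Q j, syz s V C & AG (j - s) s.+1 C].
  have [Q [V [C [a [b [ab QP Qj VC _]]]]]] := H j (leqnn j).
  by exists Q, V, C, a, b.
elim: s => [_|s IHs sj].
  have [I [N [f [g [IJ /pd_bound0 IP fg NG]]]]] := R_AG j.+1.
  exists I, N, N, f, g; split=> //; last by rewrite subn0.
  by apply: (id_mono (n := 0)) => //; apply/id_bound0.
have [Q [V [C [a [b [ab QP Qj VC]]]]]] := IHs (ltnW sj).
rewrite -subnSK // => -[I [N [f [g [IJ Is fg NG]]]]].
have [|Z [ZI ZP Zs]] := small_syzygy (i := 0) IH sj Is; first exact/id_bound0.
have [V' [a' [b' [V'N ab']]]] := syz_pullback VC fg ZI.
(* U is the fibre product of Q and V' over V. As an extension of Q by Z it is projective of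
   injective dimension at most j, and its quotient by the regular module is V'. *)
have [U [c [d [c' [d' [cd cd' _ _]]]]]] := ses_pullback ab ab'.
exists U, V', N, c, d; split=> //; first exact: ses_proj_mid cd' ZP QP.
by move=> X; apply: (Ext_midr cd'); [apply: (id_mono sj Zs) | apply: Qj].
Qed.

Lemma small_cover_ex j X : id_bound X j -> small_cover j X.
Proof.
elim/ltn_ind: j X => j IH X Xj.
have [|Q [V [C [a [b [ab QP Qj VC]]]]]] := @small_approx j.
  by move=> k Y kj Yk; apply: IH.
have e : E1 V X by apply: (Ext_syz (i := 0) VC); apply: Xj.
have [m [p pS]] := enough_free X.
have [q qE] := choice (fun i => e _ _ _ _ ab (p \o powm_in (regular R) i)).
have qS : surj (powm_sum q).
  move=> x; have [u <-] := pS x.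
  exists (powm_map (fun i => a \o powm_pr _ i) u).
  rewrite /= [in RHS](powm_eta u) linear_sum.
  by apply: eq_bigr => i _; rewrite ffunE qE.
have [N [n nE]] := ses_ker qS.
exists (powm m Q), N, n, (powm_sum q); split=> //; first exact: powm_projective.
exact: id_powm.
Qed.

(** The kernel of a projective cover of injective dimension at most s has injective dimension at
    most s + 1, as the next step requires. *)
Lemma coAG_ex k s X : id_bound X s -> coAG k s X.
Proof.
elim: k s X => //= k IH s X Xs.
have [P [N [f [g [PP Ps fg]]]]] := small_cover_ex Xs.
exists P, N, f, g; split=> //; apply: IH; apply: (id_left fg Xs).
exact: id_mono Ps.
Qed.

End AuslanderSymmetry.

(** * Tilting modules and approximations *)

Section Tilting.

Context {R : nzRingType} {HR : modcat R}.
Implicit Types A B C D E H I J L M N P Q T U V W X Y Z : rmod R.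

Local Notation reg := (regular R).

Lemma id_proj n P : id_bound reg n -> projective P -> id_bound P n.
Proof.
by move=> Rn /proj_in_add/in_addP[m Pm]; apply: id_retract Pm _; apply: id_powm.
Qed.

(** In a projective resolution of length d + 1 the last inclusion represents a class in Ext^(d+1)(M,
    P), with P the last term; its vanishing splits the inclusion. *)
Lemma pd_descent d M : (forall P, projective P -> Ext d M P) ->
  pd_bound M d.+1 -> pd_bound M d.
Proof.
elim: d M => [|d IH] M e Md; have [N [P [f [g [PP fg]]]]] := proj_cover M;
  have /(pd_syz _ PP fg) Nd := Md.
  apply/pd_bound0; have [|_ MP] := Ext_proj_split fg; last exact: retract_proj MP.
  by apply: (e N); apply/pd_bound0.
apply/(pd_syz _ PP fg); apply: IH => // Q QP.
by apply: (e Q QP) fg.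
Qed.

Lemma pd_finite m n M : id_bound reg n -> pd_bound M m -> pd_bound M n.
Proof.
move=> Rn; elim: m M => [|m IH] M Mm; first exact: pd_mono Mm.
have [nm|mn] := leqP n m; last exact: pd_mono Mm.
by apply/IH/pd_descent => // P /(id_proj Rn) Pn; apply: Ext_id Pn nm.
Qed.

(* This reduces the length of the coresolution of R to the exact value of pd T. *)
Lemma cores_shorten T m c M : (forall Y i, in_add T Y -> (c <= i)%N -> Ext i Y M) ->
  (forall Y i, in_add T Y -> Ext i Y T) ->
  cores (in_add T) m M -> cores (in_add T) c M.
Proof.
move=> + TT; elim: m c M => [|m IH] c M e.
  move=> MT; elim: c {e} => [//|c IHc]; apply: cores_pad IHc.
  exact: in_add_zero.
move=> [X [N [f [g [XT fg Nm]]]]].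
have eN Y i : in_add T Y -> (c <= i.+1)%N -> Ext i Y N.
  move=> YT ci; apply: (Ext_rightr fg); last exact: e.
  by apply: Ext_addr XT _; apply: TT.
(* For c = 0 the induction puts N in add T, so Ext^1(N, M) = 0 and M is a summand of X. Otherwise N
   satisfies the hypothesis with c lowered by one. *)
case: c e eN => [|c] e eN.
  have NT : in_add T N by apply: (IH 0%N N) => // Y i YT _; apply: eN.
  have [|MX _] := Ext_proj_split fg; first exact: (e N 0%N).
  exact: in_add_retract MX XT.
by exists X, N, f, g; split=> //; apply: IH Nm => Y i YT ci; apply: eN.
Qed.

(** [tilting] ties the length of the coresolution to the exact pd T. Ext^i(T, R) = 0 for i > pd T is
    what allows a longer coresolution to be shortened to it. *)
Lemma tilting_criterion T k m : pd_bound T k -> (forall i, Ext i T T) ->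
  cores (in_add T) m reg -> tilting T.
Proof.
move=> Tk TT Rm.
have ex : exists d, `[< pd_le T d >] by exists k; apply/asboolP/pd_leP.
case: (ex_minnP ex) => d /asboolP Td dmin.
have addTT Y i : in_add T Y -> Ext i Y T by move=> YT; apply: Ext_addl YT _.
exists d; split; first by split=> // j Tj; apply/dmin/asboolP.
  by case=> // i _; apply/(Ext_vanishesP _ _ Tk).
apply: coresolution_of_cores; first exact: in_add_zero.
apply: (cores_shorten _ addTT Rm) => Y i /in_addP[l Yl] di.
suff: Ext i T reg by move=> e; apply: Ext_retractl Yl _; apply: Ext_powl.
by apply: Ext_pd di; apply/pd_leP.
Qed.

(** Unlike in [cores], the end C is free: it is a k-th cosyzygy of M. *)
Fixpoint cochain (Q : rmod R -> Prop) (k : nat) M C : Prop :=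
  match k with
  | 0%N => M = C
  | l.+1 => exists (I N : rmod R) (f : {linear M -> I}) (g : {linear I -> N}),
      [/\ Q I, ses f g & cochain Q l N C]
  end.

(** If M and I have pd at most s, the cosyzygy has pd at most s + 1, so the bounds keep in step with
    the Auslander condition. *)
Lemma AG_cochain k s M : AG k s M -> pd_bound M s -> exists C,
  cochain (fun I => injective_mod I /\ pd_bound I (s + k)) k M C /\
  pd_bound C (s + k).
Proof.
elim: k s M => [|k IH] s M /=; first by move=> _ Ms; exists M; rewrite addn0.
move=> [I [N [f [g [II Is fg NG]]]]] Ms.
have [|C [NC Ck]] := IH _ _ NG.
  by apply: (pd_right fg Ms); apply: pd_mono Is.
rewrite addSnnS in NC Ck; exists C; split=> //; exists I, N, f, g; split=> //.
by split=> //; apply: pd_mono Is; apply: leq_addr.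
Qed.

Lemma cochain_Ext (Q : rmod R -> Prop) k M C i Y : (forall I, Q I -> injective_mod I) ->
  cochain Q k M C -> Ext (i + k) Y M -> Ext i Y C.
Proof.
move=> QI; elim: k M => [|k IH] M /=; first by move=> ->; rewrite addn0.
move=> [I [N [f [g [II fg NC]]]]]; rewrite addnS => e; apply: (IH N) => //.
exact: (Ext_shiftI_down (QI _ II) fg).
Qed.

(** Shifting along the coresolution turns the hypothesis into the vanishing of Ext^1 from C to the
    k-th cosyzygy of M. The last sequence, which ends in C, therefore splits. *)
Lemma cochain_id (Q : rmod R -> Prop) k M C : (forall I, Q I -> injective_mod I) ->
  cochain Q k.+1 M C -> Ext k C M -> id_bound M k.
Proof.
move=> QI; elim: k M => [|k IH] M [I [N [f [g [II fg NC]]]]] e.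
  have [|MI _] := Ext_proj_split fg; first by rewrite NC.
  by apply/id_bound0; apply: retract_injm MI; apply: QI.
apply/(id_cosyz _ (QI _ II) fg); apply: IH => //.
exact: (Ext_shiftI_down (QI _ II) fg).
Qed.

(** X is the sum of the middle terms. *)
Lemma cochain_cores (Q : rmod R -> Prop) k M C : (forall I J, Q I -> Q J -> Q (prodm I J)) ->
  Q (zerom R) -> cochain Q k M C -> exists X, Q X /\
  forall T, retract X T -> retract C T -> cores (in_add T) k M.
Proof.
move=> Qp Q0; elim: k M => [|k IH] M /=.
  move=> ->; exists (zerom R); split=> // T _ CT.
  exact: in_add_retract CT (in_add_refl T).
move=> [I [N [f [g [II fg /IH[X [XQ XC]]]]]]].
exists (prodm I X); split=> [|T XT CT]; first exact: Qp.
exists I, N, f, g; split=> //.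
  exact: in_add_retract (retract_trans (retract_prodl I X) XT) (in_add_refl T).
by apply: XC CT; apply: retract_trans (retract_prodr I X) XT.
Qed.

Lemma cores_Ext T d M Y i : cores (in_add T) d M -> (forall i, Ext i Y T) ->
  (d <= i)%N -> Ext i Y M.
Proof.
move=> + YT; elim: d M i => [|d IH] M i /=.
  by move=> MT _; apply: Ext_addr MT _.
move=> [X [N [f [g [XT fg Nd]]]]]; case: i => // i di.
apply: (Ext_leftr fg); first exact: IH.
by apply: Ext_addr XT _.
Qed.

(** * Consequences of the Auslander condition *)

Section FromAG.

Hypothesis R_AG : forall k, AG k 0 reg.

Lemma reg_cochain k : exists C,
  cochain (fun I => injective_mod I /\ pd_bound I k) k reg C /\ pd_bound C k.
Proof.
have [|C] := AG_cochain (R_AG k); first exact/pd_bound0/regular_projective.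
by rewrite add0n; exists C.
Qed.

(** T is the sum of the injective terms and C. The injective part receives no Ext, and Ext^i(T, C) =
    Ext^(i+k)(T, R) for i > 0, which vanishes because pd T <= k. *)
Lemma tilting_cosyzygy k C :
  cochain (fun I => injective_mod I /\ pd_bound I k) k reg C -> pd_bound C k ->
  exists T, [/\ tilting T, pd_bound T k & retract C T].
Proof.
move=> RC Ck; have [||X [[XI Xk] XC]] := cochain_cores _ _ RC.
- move=> I J [II Ik] [JJ Jk]; split; first exact: injm_prodm.
  exact: pd_prodm.
- split; first exact: injm_zero.
  by apply: (@pd_mono _ _ _ 0) => //; apply/pd_bound0/proj_zero.
exists (prodm X C); split; last exact: retract_prodr; last exact: pd_prodm.
apply: (tilting_criterion (k := k) (m := k)); first exact: pd_prodm.
  have EC i Y : pd_bound Y k -> Ext i Y C.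
    move=> Yk; apply: (cochain_Ext _ RC) => [I []//|].
    by apply: Ext_pd Yk _; apply: leq_addl.
  move=> i; apply: (Ext_midl (ses_prod X C)); apply: (Ext_midr (ses_prod X C)).
  - exact: Ext_inj.
  - exact: EC.
  - exact: Ext_inj.
  exact: EC.
apply: XC; [exact: retract_prodl | exact: retract_prodr].
Qed.

(** [Tk] contains the (n+1)-st cosyzygy. Minimality of T gives Ext^i(Tk, T) = 0 for i > 0, and the
    coresolution of the regular module in add T, of length pd T <= n, shifts this to Ext^(n+1)(Tk,
    R) = 0. *)
Lemma id_of_minimum n : tilt_has_minimum_pd_le R n -> id_bound reg n.
Proof.
move=> [C [[[T0 T0t CE] Cmin] [T [CT Tn]]]].
have [M [RM Mn]] := reg_cochain n.+1.
have [Tk [Tkt Tkn MT]] := tilting_cosyzygy RM Mn.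
have [[d [[Td dmin] _ [S [ST S0]]]] _] := (CE T).1 CT.
apply: (cochain_id _ RM) => [I []//|].
have RT : cores (in_add T) d reg.
  apply: cores_of_coresolution ST S0 => X Y XY YT; exact: in_add_retract XY YT.
apply: cores_Ext RT _ (dmin _ Tn) => i; apply: Ext_retractl MT _.
apply: Ext_vanishes_Ext.
apply: (Cmin (fun U => tilting U /\ add_equiv Tk U)) => //.
by exists Tk.
Qed.

(** The (n+1)-st cosyzygy has pd at most n + 1, hence at most n, and Ext^(n+1) out of it
    vanishes. *)
Lemma id_of_Pinfty n : (forall M, Pinfty R M <-> Pn R n M) -> id_bound reg n.
Proof.
move=> H; have [M [RM Mn]] := reg_cochain n.+1.
apply: (cochain_id _ RM) => [I []//|].
suff /pd_leP : pd_le M n by apply.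
by apply/H; exists n.+1; apply/pd_leP.
Qed.

End FromAG.

(** * Minimum tilting module and approximations in the Gorenstein case *)

Section Gorenstein.

Variables (W : rmod R) (n : nat).
Hypothesis WI : injective_mod W.
Hypothesis W_cogen : forall J, injective_mod J -> in_add W J.
Hypotheses (Rn : id_bound reg n) (Wn : pd_bound W n).

Lemma pd_injm J : injective_mod J -> pd_bound J n.
Proof.
by move=> /W_cogen/in_addP[m Jm]; apply: pd_retract Jm _; apply: pd_powm.
Qed.

(** An injective module receives no Ext, so W lies below every tilting module; a finite injective
    coresolution of the regular module has its terms in add W. *)
Lemma minimum_of_Gorenstein : tilt_has_minimum_pd_le R n.
Proof.
have Wt : tilting W.
  apply: (tilting_criterion (k := n) (m := n)) => //.
    by move=> i; apply: Ext_inj.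
  by apply: cores_sub W_cogen _; apply/cores_id.
exists (fun U => tilting U /\ add_equiv W U); split.
  split; first by exists W.
  move=> D [T0 T0t DE] T U /DE[[d [[/pd_leP Td _] _ _]] _] [_ WU] [//|i] _.
  apply/(Ext_vanishesP _ _ Td); apply: Ext_inj.
  have /in_addP[m Um] : in_add W U by apply/WU/in_add_refl.
  by apply: retract_injm Um; apply: powm_injm.
by exists W; split; [split | apply/pd_leP].
Qed.

Lemma Pinfty_Pn M : Pinfty R M <-> Pn R n M.
Proof.
split=> [[m /pd_leP Mm]|Mn]; last by exists n.
by apply/pd_leP; apply: pd_finite Rn Mm.
Qed.

(** Over an Iwanaga-Gorenstein algebra these are the Gorenstein injective modules. *)
Definition Iperp Y := forall J i, injective_mod J -> Ext i J Y.

Lemma Ext_Iperp d M Y i : id_bound M d -> Iperp Y -> Ext i M Y.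
Proof.
move=> + YI; elim: d M i => [|d IH] M i.
  by move/id_bound0 => MJ; apply: YI.
have [J [N [f [g [JJ fg]]]]] := inj_hull M.
move=> /(id_cosyz _ JJ fg) Nd; apply: (Ext_leftl fg); first exact: YI.
exact: IH.
Qed.

(** An approximation of M by add W lifts every map from an injective. It is onto because maps from
    the regular module to M extend to an injective J: the cosyzygy in J has finite injective
    dimension, so Ext^1 from it to M vanishes. *)
Lemma Iperp_cover M : Iperp M -> exists (K T : rmod R) (f : {linear K -> T})
  (g : {linear T -> M}), [/\ injective_mod T, ses f g & Iperp K].
Proof.
move=> MI; have [r [f fE]] := add_approx W M.
have lift J (h : {linear J -> M}) : injective_mod J ->
    exists k : {linear J -> powm r W}, forall x, f (k x) = h x.
  move=> /W_cogen/in_addP[t [s [q qs]]].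
  have [k kE] := choice (fun i => fE (h \o q \o powm_in W i)).
  exists (powm_sum k \o s) => x.
  rewrite -[in RHS](qs x) [in RHS](powm_eta (s x)) !linear_sum.
  by apply: eq_bigr => i _; rewrite kE.
have fS : surj f.
  have [J [N [j [g [JJ jg]]]]] := inj_hull reg.
  have Nn : id_bound N n by apply/(id_cosyz _ JJ jg); apply: id_mono Rn.
  move=> x; have [u uE] := regular_map x.
  have [v vE] := (Ext_Iperp 0 Nn MI) _ _ _ _ jg u.
  have [k kE] := lift _ v JJ.
  by exists (k (j (1 : R^c))); rewrite kE vE.
have [K [k kf]] := ses_ker fS.
have TI : injective_mod (powm r W) by apply: powm_injm.
exists K, (powm r W), k, f; split=> // J [|i] JJ.
  by apply: (E1_of_lift kf) => [|h]; [apply: E1_inj | apply: lift].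
by apply: (Ext_leftr kf); [apply: MI | apply: Ext_inj].
Qed.

(* Auslander-Buchweitz approximation: the syzygies of a cosyzygy cover are pulled back to M. *)
Lemma fpd_cover m M : (forall J i, injective_mod J -> (m <= i)%N -> Ext i J M) ->
  exists (Y X : rmod R) (f : {linear Y -> X}) (g : {linear X -> M}) d,
    [/\ ses f g, Iperp Y & pd_bound X d].
Proof.
elim: m M => [|m IH] M e.
  have [|K [T [f [g [TI fg KI]]]]] := @Iperp_cover M.
    by move=> J i JJ; apply: e.
  by exists K, T, f, g, n; split=> //; apply: pd_injm.
have [J [C [f [g [JJ fg]]]]] := inj_hull M.
have [|Y [X [y [x [d [yx YI Xd]]]]]] := IH C.
  move=> I i II mi; apply: (Ext_shiftI_down JJ fg).
  exact: e.
have [U [a [b [c [k [ab ck _ _]]]]]] := ses_pullback fg yx.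
have [Y' [T [t [u [TI tu Y'I]]]]] := Iperp_cover YI.
(* Ext^1(J, Y) = 0 splits U into Y and J, so T x J maps onto U with kernel Y'. The kernel E of the
   composite T x J -> X has finite pd and is an extension of M by Y'. *)
have [s sE] := E1_lift (idfun : {linear J -> J}) (YI J 0%N JJ) ck.
have tu' := ses_add_split tu ck sE.
have [E [v [w [z [vE wz]]]]] := ses_syz ab tu'.
exists Y', E, w, z, (maxn n d); split=> //; apply: (pd_left vE).
  apply: pd_prodm; apply: (pd_mono (leq_maxl n d)); exact: pd_injm.
by apply: pd_mono Xd; rewrite leqW ?leq_maxr.
Qed.

Lemma fpd_fid m M : pd_bound M m -> exists d, id_bound M d.
Proof.
elim: m M => [|m IH] M; first by move/pd_bound0 => MP; exists n; apply: id_proj.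
have [N [P [f [g [PP fg]]]]] := proj_cover M.
move=> /(pd_syz _ PP fg)/IH[d Nd]; exists (maxn n d); apply: (id_right fg).
  by apply: (id_mono (leq_maxl n d)); apply: id_proj.
by apply: id_mono Nd; rewrite leqW ?leq_maxr.
Qed.

(** Modules of finite pd have finite injective dimension here, so Ext^1 from them to the kernel Y
    vanishes and their maps to M lift to X. *)
Lemma contravariantly_finite_of_Gorenstein : contravariantly_finite (Pinfty R).
Proof.
move=> M; have [|Y [X [f [g [d [fg YI Xd]]]]]] := @fpd_cover n M.
  by move=> J i /pd_injm Jn ni; apply: Ext_pd Jn ni.
exists X; split; first by exists d; apply/pd_leP.
exists g => Z [m /pd_leP /fpd_fid[e Ze]] h.
exact: (E1_lift h (Ext_Iperp 0 Ze YI) fg).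
Qed.

End Gorenstein.

End Tilting.

(** * Simple modules, hulls and covers *)

Section Length.

Context {R : nzRingType} {HR : modcat R}.
Implicit Types A B C D E H I J L M N P Q S T U V W X Y Z : rmod R.

Lemma mdim_zero M : trivial_mod M -> mdim M = 0%N.
Proof.
move=> M0; have zz : ses (idfun : {linear M -> M}) (\0 : {linear M -> M}).
  split=> // [y|y]; last by exists 0; rewrite (M0 y) linear0.
  by split=> // _; exists y.
apply/eqP; move: (@ses_mdim _ HR _ _ _ _ _ zz) => /eqP; rewrite -{1}[mdim M]addn0 eqn_add2l.
by rewrite eq_sym.
Qed.

Lemma mdim_surj M N (f : {linear M -> N}) : surj f -> (mdim N <= mdim M)%N.
Proof.
by move=> /ses_ker[L [q fq]]; rewrite (ses_mdim fq) leq_addl.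
Qed.

Lemma mdim_inj_surj M N (f : {linear M -> N}) :
  injective f -> (mdim N <= mdim M)%N -> surj f.
Proof.
move=> /ses_coker[L [q fq]]; rewrite (ses_mdim fq) => le y.
case: (fq) => _ fE _; apply/fE; apply: mdim_eq0.
by apply/eqP; rewrite -leqn0 -(leq_add2l (mdim M)) addn0.
Qed.

Lemma mdim_surj_inj M N (f : {linear M -> N}) :
  surj f -> (mdim M <= mdim N)%N -> injective f.
Proof.
move=> /ses_ker[L [i ff]]; rewrite (ses_mdim ff) => le; apply: lin_inj => x.
case: (ff) => _ fE _ /fE[y <-]; rewrite (_ : y = 0) ?linear0 //.
apply: (mdim_eq0 (M := L)).
by apply/eqP; rewrite -leqn0 -(leq_add2r (mdim N)) add0n.
Qed.

(** Squaring [g] until its image L stops shrinking makes it restrict to an automorphism of L, and L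
    becomes a summand. [Phi] carries the property of [g] that has to survive the iteration. *)
Lemma fitting M (Phi : {linear M -> M} -> Prop) (g : {linear M -> M}) :
  (forall a b, Phi a -> Phi b -> Phi (a \o b)) -> Phi g ->
  exists (h : {linear M -> M}) (L : rmod R) (q : {linear M -> L})
    (i : {linear L -> M}) (r : {linear M -> L}),
    [/\ Phi h, surj q, injective i, forall x, i (q x) = h x &
        forall y, r (i y) = y].
Proof.
move=> Pc Pg; have [L [q [i [qS iI iq]]]] := image_ex g.
have [m] := ubnP (mdim L); elim: m g L q i Pg qS iI iq => // m IH.
move=> g L q i Pg qS iI iq; rewrite ltnS => Lm.
have [qiS|qiS] := EM (surj (q \o i)).
  have [w [wK Kw]] := lin_bij (mdim_surj_inj qiS (leqnn _)) qiS.
  exists g, L, q, i, (w \o q); split=> // y; exact: wK.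
have [L' [q' [i' [q'S i'I iq']]]] := image_ex (q \o i).
apply: (IH (g \o g) L' (q' \o q) (i \o i')).
- exact: Pc.
- by move=> y; have [x <-] := q'S y; have [z <-] := qS x; exists z.
- exact: inj_comp.
- by move=> x; rewrite /= iq' /= !iq.
apply: leq_trans Lm; rewrite ltnNge; apply/negP => le; apply: qiS => y.
have [x <-] := mdim_inj_surj i'I le y; have [z <-] := q'S x.
by exists z; rewrite iq'.
Qed.

Definition essential M H (m : {linear M -> H}) := forall X (x : {linear X -> H}),
  injective x -> (forall a b, m a = x b -> b = 0) -> trivial_mod X.

(** If X meets M trivially, injectivity of H yields an endomorphism that is the identity on M and
    zero on X; [fitting] then gives a smaller summand of H that still contains M. *)
Lemma hull_ex M : exists (H : rmod R) (m : {linear M -> H}),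
  [/\ injective_mod H, injective m & essential m].
Proof.
have [H [m [HI mI]]] := enough_inj M.
have [d] := ubnP (mdim H); elim: d H m HI mI => // d IH H m HI mI.
rewrite ltnS => Hd.
have [ess|] := EM (essential m); first by exists H, m.
move/existsNP => [X /existsNP[x /not_implyP[xI /not_implyP[mx X0]]]].
have cI : injective (copair m x).
  apply: lin_inj => -[a b] /= E.
  have b0 : b = 0.
    apply: (mx (- a)); rewrite linearN; apply/eqP.
    by rewrite eq_sym -addr_eq0 addrC E.
  by move: E; rewrite b0 linear0 addr0 => /(inj_lin mI) ->.
have [g gE] := HI _ _ (copair m x) (m \o fst) cI.
pose Phi (g : {linear H -> H}) := (forall a, g (m a) = m a) /\ forall b, g (x b) = 0.
have [||h [L [q [i [r [[hm hx] qS iI iq ri]]]]]] := @fitting H Phi g.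
- move=> a b [a1 a2] [b1 b2]; split=> z /=; first by rewrite b1 a1.
  by rewrite b2 linear0.
- split=> z; first by have := gE (z, 0); rewrite /= linear0 addr0.
  by have := gE (0, z); rewrite /= !linear0 add0r.
apply: (IH L (q \o m)).
- by apply: (retract_injm HI); exists i, r.
- by apply: lin_inj => a /= qa; apply: (inj_lin mI); rewrite -hm -iq qa linear0.
apply: leq_trans Hd; rewrite ltnNge; apply/negP => le; apply: X0 => b.
apply: (inj_lin xI); apply: (inj_lin (mdim_surj_inj qS le)).
by apply: (inj_lin iI); rewrite iq hx.
Qed.

Definition simple S := (exists x : S, x <> 0) /\
  forall Q : S -> Prop, submodule Q -> (exists2 x, Q x & x <> 0) -> forall x, Q x.

Definition nonzero M N (u : {linear M -> N}) := exists x, u x <> 0.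

Lemma not_nonzero M N (u : {linear M -> N}) : ~ nonzero u -> forall x, u x = 0.
Proof. by move=> H x; apply: contrapT => ux; apply: H; exists x. Qed.

Lemma simple_inj S M (u : {linear S -> M}) : simple S -> nonzero u -> injective u.
Proof.
move=> [_ Smax] [x ux]; apply: lin_inj => y uy; apply: contrapT => y0.
apply: ux; apply: (Smax (fun x => u x = 0)); last by exists y.
split=> [|a b c ub uc]; first exact: linear0.
by rewrite linearP ub uc scaler0 addr0.
Qed.

Lemma simple_surj M S (u : {linear M -> S}) : simple S -> nonzero u -> surj u.
Proof.
move=> [_ Smax] [x ux]; apply: Smax; last by exists (u x) => //; exists x.
split=> [|a b c [b' <-] [c' <-]]; first by exists 0; rewrite linear0.
by exists (a *: b' + c'); rewrite linearP.
Qed.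

(** Isomorphism, for simple modules, by Schur's lemma. *)
Definition sim S T := exists u : {linear S -> T}, nonzero u.

Lemma sim_iso S T : simple S -> simple T -> sim S T ->
  exists (u : {linear S -> T}) (v : {linear T -> S}), cancel u v /\ cancel v u.
Proof.
move=> Ss Ts [u u0].
have [v [vK Kv]] := lin_bij (simple_inj Ss u0) (simple_surj Ts u0).
by exists u, v.
Qed.

Lemma simple_sub M : ~ trivial_mod M ->
  exists S (i : {linear S -> M}), simple S /\ injective i.
Proof.
have [d] := ubnP (mdim M); elim: d M => // d IH M; rewrite ltnS => Md M0.
have [Ms|Mns] := EM (simple M).
  by exists M; exists (idfun : {linear M -> M}); split=> // x y.
have [x x0] : exists x : M, x <> 0 by apply/existsNP.
have [Q [Qs [[y Qy y0] [z Qz]]]] : exists Q : M -> Prop, submodule Q /\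
    (exists2 x, Q x & x <> 0) /\ exists x, ~ Q x.
  apply: contrapT => H; apply: Mns; split; first by exists x.
  move=> Q Qs Qn z; apply: contrapT => Qz; apply: H.
  by exists Q; do 2!split=> //; exists z.
have [N [i [iI iQ]]] := submodule_ex Qs.
have [||S [j [Ss jI]]] := IH N.
- apply: leq_trans Md; rewrite ltnNge; apply/negP => le; apply: Qz; apply/iQ.
  exact: mdim_inj_surj.
- have /iQ[w wy] := Qy; move=> N0; apply: y0; by rewrite -wy (N0 w) linear0.
exists S, (i \o j); split=> //; exact: inj_comp.
Qed.

(** Dual to [hull_ex]: a simple quotient T of P not isomorphic to S gives a map of P onto S x T.
    Lifting [(p, 0)] through it yields an endomorphism, from which [fitting] cuts out a smaller
    summand that still maps onto S. *)
Lemma proj_cover_simple S : simple S -> exists P (p : {linear P -> S}),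
  [/\ projective P, nonzero p & forall T (f : {linear P -> T}), simple T ->
      nonzero f -> sim S T].
Proof.
move=> Ss; have [P [p [PP pS]]] := enough_proj S.
have [d] := ubnP (mdim P); elim: d P p PP pS => // d IH P p PP pS.
rewrite ltnS => Pd.
have [ok|] := EM (forall T (f : {linear P -> T}), simple T -> nonzero f -> sim S T).
  exists P, p; split=> //; case: Ss => -[x x0] _; have [y yx] := pS x.
  by exists y; rewrite yx.
move/existsNP => [T /existsNP[f /not_implyP[Ts /not_implyP[f0 nsim]]]].
(* If [f] vanishes on the kernel of [p], it factors through a nonzero map from S to T; otherwise
   simplicity of T makes it onto already on that kernel. *)
have fS : forall t, exists x, p x = 0 /\ f x = t.
  have [[x px fx]|nx] := EM (exists2 x, p x = 0 & f x <> 0).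
    case: (Ts) => _; apply; last by exists (f x) => //; exists x.
    split=> [|a b c [b' [pb <-]] [c' [pc <-]]]; first by exists 0; rewrite !linear0.
    by exists (a *: b' + c'); rewrite !linearP pb pc scaler0 addr0.
  have [|u uE] := fact_surj (f := f) pS.
    by move=> x px; apply: contrapT => fx; apply: nx; exists x.
  by case: nsim; case: f0 => x fx; exists u, (p x); rewrite uE.
have cS : surj (pair_map p f : {linear P -> prodm S T}).
  move=> [s t]; have [x xs] := pS s; have [y [py fy]] := fS (t - f x).
  by exists (x + y); rewrite /= !linearD py fy xs addr0 addrC subrK.
have [g gE] := PP _ _ (pair_map p f) (pairl S T \o p) cS.
pose Phi (g : {linear P -> P}) := (forall a, p (g a) = p a) /\ forall b, f (g b) = 0.
have [||h [L [q [i [r [[hp hf] qS iI iq ri]]]]]] := @fitting P Phi g.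
- by move=> a b [a1 a2] [b1 b2]; split=> z /=; rewrite ?a1 ?b1 ?a2.
- by split=> z; have [] := gE z.
apply: (IH L (p \o i)).
- by apply: (retract_proj PP); exists i, r.
- by move=> s; have [x <-] := pS s; exists (q x); rewrite /= iq hp.
apply: leq_trans Pd; rewrite ltnNge; apply/negP => le.
case: f0 => x; apply; have [y <-] := mdim_inj_surj iI le x.
by have [z <-] := qS y; rewrite iq hf.
Qed.

(** L lists the composition factors of M. *)
Lemma simples_of M : exists L : seq (rmod R),
  (forall i, (i < size L)%N -> simple (nth (zerom R) L i)) /\
  forall T (f : {linear M -> T}), simple T -> nonzero f ->
    exists2 i, (i < size L)%N & sim (nth (zerom R) L i) T.
Proof.
have [d] := ubnP (mdim M); elim: d M => // d IH M; rewrite ltnS => Md.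
have [M0|M0] := EM (trivial_mod M).
  by exists [::]; split=> // T f _ [x []]; rewrite (M0 x) linear0.
have [S [i [Ss iI]]] := simple_sub M0; have [N [p ip]] := ses_coker iI.
have [|L [Ls LT]] := IH N.
  apply: leq_trans Md; rewrite (ses_mdim ip) -[X in (X < _)%N]add0n ltn_add2r lt0n.
  apply/eqP => /mdim_eq0 S0; case: Ss => -[x x0] _; exact: x0 (S0 x).
exists (S :: L); split=> [[|j] //= jL|T f Ts f0]; first exact: Ls.
have [fi|fi] := EM (nonzero (f \o i)); first by exists 0%N => //; exists (f \o i).
have [|u uE] := ses_cofact ip (h := f); first by move=> x; apply: (not_nonzero fi).
have [|j jL jT] := LT T u Ts; last by exists j.+1.
by case: f0 => x fx; exists (p x); rewrite uE.
Qed.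

Lemma sim_sym S T : simple S -> simple T -> sim S T -> sim T S.
Proof.
move=> Ss Ts /(sim_iso Ss Ts)[u [v [uv vu]]]; exists v.
by case: Ss => -[x x0] _; exists (u x); rewrite uv.
Qed.

Lemma sim_trans S T U : simple S -> simple T -> simple U ->
  sim S T -> sim T U -> sim S U.
Proof.
move=> Ss Ts Us /(sim_iso Ss Ts)[u [v [uv vu]]] [w [x wx]].
by exists (w \o u), (v x); rewrite /= vu.
Qed.

Lemma prune_simples (L : seq (rmod R)) :
  (forall i, (i < size L)%N -> simple (nth (zerom R) L i)) ->
  exists L' : seq (rmod R),
  [/\ forall i, (i < size L')%N -> simple (nth (zerom R) L' i),
      forall i j, (i < size L')%N -> (j < size L')%N ->
        sim (nth (zerom R) L' i) (nth (zerom R) L' j) -> i = j &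
      forall T, simple T -> (exists2 i, (i < size L)%N & sim (nth (zerom R) L i) T) ->
        exists2 i, (i < size L')%N & sim (nth (zerom R) L' i) T].
Proof.
elim: L => [|S L IH] Ls; first by exists [::]; split=> // T Ts [].
have Ss : simple S := Ls 0%N isT.
have [|L' [L's L'i L'T]] := IH; first by move=> i iL; apply: (Ls i.+1).
have [[i iL iS]|nS] := EM (exists2 i, (i < size L')%N & sim (nth (zerom R) L' i) S).
  exists L'; split=> // T Ts [[|j] /= jL jT]; last by apply: L'T => //; exists j.
  by exists i => //; apply: sim_trans jT; rewrite //; apply: L's.
exists (S :: L'); split=> [[|i]//|[|i] [|j] //= iL jL ij|T Ts [[|j] /= jL jT]].
- exact: L's .
- by case: nS; exists j => //; apply: sim_sym ij => //; apply: L's.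
- by case: nS; exists i.
- by congr _.+1; apply: L'i.
- by exists 0%N.
by have [|i iL iT] := L'T T Ts; [exists j | exists i.+1].
Qed.

(** Every simple module is a quotient of the regular module, hence one of its composition
    factors. *)
Lemma simples_ex : exists s (S : 'I_s -> rmod R),
  [/\ forall l, simple (S l), forall k l, sim (S k) (S l) -> k = l &
      forall T, simple T -> exists l, sim (S l) T].
Proof.
have [L [Ls LT]] := simples_of (regular R).
have [L' [L's L'i L'T]] := prune_simples Ls.
exists (size L'), (fun i => nth (zerom R) L' i); split=> [l|k l kl|T Ts].
- exact: L's (ltn_ord l).
- by apply: val_inj; apply: (L'i k l (ltn_ord k) (ltn_ord l) kl).
have [|i iL iT] := L'T T Ts; last by exists (Ordinal iL).
case: (Ts) => -[x x0] _; have [f fE] := regular_map x.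
by apply: (LT T f Ts); exists (1 : R^c); rewrite fE.
Qed.

End Length.

(** * Euler characteristics *)

Section EulerCharacteristic.

Context {R : nzRingType} {HR : modcat R}.
Implicit Types A B C D E H I J L M N P Q S T U V W X Y Z : rmod R.

(** The reject of X in M. For simple X the quotient by it is the largest quotient of M that is a sum
    of copies of X. *)
Definition rej X M (x : M) := forall f : {linear M -> X}, f x = 0.

Lemma rej_submodule X M : submodule (@rej X M).
Proof.
split=> [f|a x y fx fy f]; first exact: linear0.
by rewrite linearP fx fy scaler0 addr0.
Qed.

Definition rejq X M : rmod R := sval (cid (quotient_ex (@rej_submodule X M))).

Lemma rejqP X M : exists p : {linear M -> rejq X M}, surj p /\
  forall x, p x = 0 <-> rej X x.
Proof. exact: svalP (cid (quotient_ex (@rej_submodule X M))). Qed.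

(* For simple X this is a fixed multiple of the multiplicity of X in the top of M; *)
(* unlike dim Hom(M, X), it needs no base field. *)
Definition topdim X M : nat := mdim (rejq X M).

Lemma topdimP X M Q (p : {linear M -> Q}) : surj p ->
  (forall x, p x = 0 <-> rej X x) -> topdim X M = mdim Q.
Proof.
move=> pS pE; have [q [qS qE]] := rejqP X M.
have [|u uE] := fact_surj (f := q) pS; first by move=> x /pE/qE.
have [|v vE] := fact_surj (f := p) qS; first by move=> x /qE/pE.
apply/eqP; rewrite eqn_leq; apply/andP; split.
  by apply: (mdim_surj (f := u)) => y; have [x <-] := qS y; exists (p x).
by apply: (mdim_surj (f := v)) => y; have [x <-] := pS y; exists (q x).
Qed.

Lemma topdim0 X M : (forall (f : {linear M -> X}) x, f x = 0) -> topdim X M = 0%N.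
Proof.
move=> H; have [q [qS qE]] := rejqP X M; apply: mdim_zero => y.
by have [x <-] := qS y; apply/qE => f; apply: H.
Qed.

Lemma topdim_neq0 X M (f : {linear M -> X}) : nonzero f -> topdim X M <> 0%N.
Proof.
move=> [x fx] /mdim_eq0 H; have [q [qS qE]] := rejqP X M; apply: fx.
by apply: (qE x).1; apply: H.
Qed.

Lemma mdim_prod M N : mdim (prodm M N) = (mdim M + mdim N)%N.
Proof. exact: ses_mdim (ses_prod M N). Qed.

Lemma topdim_ses X A B C (f : {linear A -> B}) (g : {linear B -> C}) :
  ses f g -> projective C -> topdim X B = (topdim X A + topdim X C)%N.
Proof.
move=> fg CP; case: (fg) => fI fE gS; have [s gs] := CP _ _ g idfun gS.
have [r [rf rs]] := ses_sec fg gs.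
have [p [pS pE]] := rejqP X A; have [q [qS qE]] := rejqP X C.
rewrite (@topdimP X B (prodm (rejq X A) (rejq X C)) (pair_map (p \o r) (q \o g))).
- exact: mdim_prod.
- move=> [y z]; have [a <-] := pS y; have [c <-] := qS z.
  exists (f a + s c); congr (_, _); rewrite /= linearD.
    rewrite rf (_ : r (s c) = 0) ?addr0 //; apply: (inj_lin fI).
    have := rs (s c); rewrite gs => /eqP; rewrite -subr_eq0 addrK => /eqP.
    by [].
  by rewrite (sesK fg) gs add0r.
move=> x; split=> [[/pE rx /qE gx] u|xr].
  rewrite -(rs x) linearD; have /= -> := rx (u \o f).
  by have /= -> := gx (u \o s); rewrite addr0.
have /pE r0 : rej X (r x) by move=> u; apply: (xr (u \o r)).
have /qE g0 : rej X (g x) by move=> u; apply: (xr (u \o g)).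
by rewrite /= r0 g0.
Qed.

Lemma topdim_prod X A B : projective B ->
  topdim X (prodm A B) = (topdim X A + topdim X B)%N.
Proof. exact: topdim_ses (ses_prod A B). Qed.

Lemma topdim_zero X : topdim X (zerom R) = 0%N.
Proof. by apply: topdim0 => f x; rewrite (zeromP x) linear0. Qed.

(** For simple X this is a fixed multiple of the alternating sum of dim Ext^i(M, X). It is a
    relation because independence from the resolution comes only from additivity, in
    [euler_char_uniq]. *)
Fixpoint euler X n M (c : int) : Prop :=
  match n with
  | 0%N => projective M /\ c = topdim X M
  | m.+1 => exists (N P : rmod R) (f : {linear N -> P}) (g : {linear P -> M}) c',
      [/\ projective P, ses f g, euler X m N c' & c = (topdim X P)%:Z - c']
  end.

Lemma euler_ex X n M : pd_bound M n -> exists c, euler X n M c.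
Proof.
elim: n M => [|n IH] M; first by move/pd_bound0 => MP; exists (topdim X M)%:Z.
have [N [P [f [g [PP fg]]]]] := proj_cover M.
move=> /(pd_syz _ PP fg)/IH[c Nc]; exists ((topdim X P)%:Z - c).
by exists N, P, f, g, c.
Qed.

Lemma eulerS X n M c : euler X n M c -> euler X n.+1 M c.
Proof.
elim: n M c => [|n IH] M c.
  move=> [MP ->]; have [z zE] := ses_idr M; exists (zerom R), M, z, idfun, 0.
  split=> //; last by rewrite subr0.
  by split; [exact: proj_zero | rewrite topdim_zero].
by move=> [N [P [f [g [c' [PP fg /IH Nc ->]]]]]]; exists N, P, f, g, c'.
Qed.

Lemma euler_mono X n m M c : (n <= m)%N -> euler X n M c -> euler X m M c.
Proof.
move=> /subnK <-; elim: (m - n)%N => [//|k IH] Mc; apply: eulerS; exact: IH.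
Qed.

Lemma euler_proj_ext X n M Z P (f : {linear M -> Z}) (g : {linear Z -> P}) c :
  ses f g -> projective P -> euler X n M c -> euler X n Z (c + (topdim X P)%:Z).
Proof.
move=> fg PP; case: n => [[MP ->]|n [N [Q [u [v [c' [QP uv Nc ->]]]]]]].
  split; first exact: ses_proj_mid fg MP PP.
  by rewrite (topdim_ses X fg PP) PoszD.
case: (fg) => _ _ gS; have [s gs] := PP _ _ g idfun gS.
exists N, (prodm Q P), (pairl Q P \o u), (copair (f \o v) s), c'; split=> //.
- exact: proj_prodm.
- exact: ses_add_split uv fg gs.
by rewrite topdim_prod // PoszD addrAC.
Qed.

Lemma ses_prod_ext A B C Q (f : {linear A -> B}) (g : {linear B -> C}) U
  (h : {linear U -> Q}) (k : {linear B -> U}) : projective Q -> ses f g -> ses k h ->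
  exists (c : {linear A -> U}) (d : {linear U -> prodm C Q}), ses c d.
Proof.
move=> QP fg kh; case: (fg) => fI fE gS; case: (kh) => kI kE hS.
have [s hs] := QP _ _ h idfun hS; have [r [rk rs]] := ses_sec kh hs.
exists (k \o f), (pair_map (g \o r) h); split=> [x y /= /kI/fI//|y|[y z]].
  split=> [[/fE[x xE] /kE[w wE]]|[x <-]].
    by exists x; rewrite /= xE -wE rk.
  by rewrite /= rk (sesK fg) (sesK kh).
have [b <-] := gS y; exists (k b + s z); congr (_, _); rewrite /= linearD.
  rewrite rk (_ : r (s z) = 0) ?addr0 //; apply: (inj_lin kI).
  have := rs (s z); rewrite hs => /eqP; rewrite -subr_eq0 addrK => /eqP.
  by [].
by rewrite (sesK kh) hs add0r.
Qed.

(** The three resolutions are unrelated, so the cover Q of B is compared with the cover P x O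
    assembled from those of A and C. The fibre product V of both over B is the sum of B' and P x O,
    and also an extension of C' x Q by A'; this is the same claim one step lower. *)
Lemma euler_ses X n A B C (f : {linear A -> B}) (g : {linear B -> C}) a b c :
  ses f g -> euler X n A a -> euler X n B b -> euler X n C c -> b = a + c.
Proof.
elim: n A B C f g a b c => [|n IH] A B C f g a b c fg.
  by move=> [AP ->] [BP ->] [CP ->]; rewrite (topdim_ses X fg CP) PoszD.
move=> [A' [P [i [p [a' [PP ip Aa ->]]]]]] [B' [Q [j [q [b' [QP jq Bb ->]]]]]].
move=> [C' [O [k [o [c' [OP ko Cc ->]]]]]].
have [U [u [v [w [z [uv wz _ _]]]]]] := ses_pullback fg ko.
case: (uv) => _ _ vS; have [s vs] := OP _ _ v idfun vS.
have cov := ses_add_split ip uv vs.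
have [E [e [x [y [eE xy]]]]] := ses_syz wz cov.
have POP : projective (prodm P O) by apply: proj_prodm.
have [V [d [h [d' [h' [dh dh' _ _]]]]]] := ses_pullback jq eE.
have EV := euler_proj_ext dh POP Bb.
have [c1 [d1 cd1]] := ses_prod_ext QP xy dh'.
have EC := euler_proj_ext (ses_prod C' Q) QP Cc.
have := IH _ _ _ _ _ _ _ _ cd1 Aa EV EC.
by rewrite topdim_prod // PoszD; lia.
Qed.

Definition euler_char X M c := exists n, euler X n M c.

Lemma euler_char_ses X A B C (f : {linear A -> B}) (g : {linear B -> C}) a b c :
  ses f g -> euler_char X A a -> euler_char X B b -> euler_char X C c -> b = a + c.
Proof.
move=> fg [l Al] [m Bm] [n Cn]; pose k := maxn l (maxn m n).
by apply: (euler_ses (n := k) fg); [apply: euler_mono Al | apply: euler_mono Bm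
  | apply: euler_mono Cn]; rewrite /k !leq_max leqnn ?orbT.
Qed.

Lemma euler_char_ex X n M : pd_bound M n -> exists c, euler_char X M c.
Proof. by move=> /(euler_ex X)[c Mc]; exists c, n. Qed.

Lemma euler_char_proj X P : projective P -> euler_char X P (topdim X P).
Proof. by move=> PP; exists 0%N. Qed.

Lemma euler_char_uniq X M b c : euler_char X M b -> euler_char X M c -> b = c.
Proof.
move=> Mb Mc; have [z zE] := ses_idr M.
have := euler_char_ses zE (euler_char_proj X (@proj_zero R)) Mb Mc.
by rewrite topdim_zero add0r.
Qed.

Lemma pd_trivial M : trivial_mod M -> pd_bound M 0.
Proof.
move=> M0; apply/pd_bound0; apply: retract_proj (@proj_zero R) _.
by exists \0, \0 => x; rewrite (M0 x).
Qed.

(** * Every injective module has finite projective dimension *)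

Section Count.

Variable n : nat.
Hypothesis Rn : id_bound (regular R) n.

Definition fpd M := exists d, pd_bound M d.
Definition finj I := injective_mod I /\ fpd I.
Hypothesis R_finj : cores finj n (regular R).

(* The simple modules not in the socle of an injective of finite projective dimension. *)
Definition bad T := simple T /\ forall I (u : {linear T -> I}), finj I -> ~ nonzero u.

Variables (s : nat) (S : 'I_s -> rmod R).
Hypothesis S_simple : forall l, simple (S l).
Hypothesis S_uniq : forall k l, sim (S k) (S l) -> k = l.
Hypothesis S_all : forall T, simple T -> exists l, sim (S l) T.

(** The hull of a simple module is a summand of any injective containing it, so it inherits finite
    pd when the simple is not bad. Bad simples get arbitrary values. *)
Lemma hulls : exists (H : 'I_s -> rmod R) (V : 'I_s -> 'I_s -> int),
  forall l, ~ bad (S l) -> [/\ finj (H l),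
    exists m : {linear S l -> H l}, injective m /\ essential m &
    forall k, euler_char (S k) (H l) (V l k)].
Proof.
suff H l : exists HV : rmod R * ('I_s -> int), ~ bad (S l) -> [/\ finj HV.1,
    exists m : {linear S l -> HV.1}, injective m /\ essential m &
    forall k, euler_char (S k) HV.1 (HV.2 k)].
  have [HV HVE] := choice H.
  by exists (fun l => (HV l).1), (fun l => (HV l).2).
have [Sb|Sb] := EM (bad (S l)); first by exists (zerom R, fun=> 0).
have [I [u [[II [d Id]] [x ux]]]] : exists I (u : {linear S l -> I}), finj I /\ nonzero u.
  apply: contrapT => H; apply: Sb; split=> // I u If u0.
  by apply: H; exists I, u.
have [H [m [HI mI me]]] := hull_ex (S l).
have HIr : retract H I.
  have [w wE] := II _ _ m u mI.
  have wI : injective w.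
    have [K [k [kI kE]]] := ker_ex w; apply: lin_inj => y /kE[z <-].
    rewrite (_ : z = 0) ?linear0 //; apply: (me _ k kI) => a b mab.
    have /(inj_lin (simple_inj (S_simple l) (ex_intro _ x ux))) a0 : u a = 0.
      by rewrite -wE mab; apply/kE; exists b.
    by apply: (inj_lin kI); rewrite -mab a0 linear0.
  by have [r rw] := HI _ _ w idfun wI; exists w, r.
have Hd : pd_bound H d by apply: pd_retract HIr Id.
have [V VE] := choice (fun k => euler_char_ex (S k) Hd).
exists (H, V) => _; split=> //=; last by exists m.
by split=> //; exists d.
Qed.

Variables (H : 'I_s -> rmod R) (V : 'I_s -> 'I_s -> int).
Hypothesis HV : forall l, ~ bad (S l) -> [/\ finj (H l),
    exists m : {linear S l -> H l}, injective m /\ essential m &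
    forall k, euler_char (S k) (H l) (V l k)].

Definition in_span M := exists b : 'I_s -> int,
  (forall l, bad (S l) -> b l = 0) /\
  forall k, euler_char (S k) M (\sum_l b l * V l k).

Definition bad_free M := forall T (u : {linear T -> M}), bad T -> ~ nonzero u.

(** The hull of a simple submodule splits off; the rest is smaller and still meets no bad simple. *)
Lemma injective_span I : injective_mod I -> bad_free I -> fpd I /\ in_span I.
Proof.
have [d] := ubnP (mdim I); elim: d I => // d IH I; rewrite ltnS => Id II Ib.
have [I0|I0] := EM (trivial_mod I).
  have I0' := pd_trivial I0; split; first by exists 0%N.
  exists (fun=> 0); split=> // k; rewrite big1 => [|l _]; last by rewrite mul0r.
  have E : topdim (S k) I = 0%N.
    by rewrite topdim0 // => f x; rewrite (I0 x) linear0.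
  have IP : projective I by apply/pd_bound0.
  by have := euler_char_proj (S k) IP; rewrite E.
have [T [t [Ts tI]]] := simple_sub I0.
have [l [e [x ex]]] := S_all Ts.
have ti : nonzero (t \o e) by exists x => /= /(inj_lin tI).
have lb : ~ bad (S l) by move/Ib => /(_ (t \o e)).
have [[HI [h Hh]] [m [mI me]] VE] := HV lb.
have [w wE] := II _ _ m (t \o e) mI.
have wI : injective w.
  have [K [k [kI kE]]] := ker_ex w; apply: lin_inj => y /kE[z <-].
  rewrite (_ : z = 0) ?linear0 //; apply: (me _ k kI) => a b mab.
  have /(inj_lin (simple_inj (S_simple l) ti)) a0 : (t \o e) a = 0.
    by rewrite -wE mab; apply/kE; exists b.
  by apply: (inj_lin kI); rewrite -mab a0 linear0.
have [J [q wq]] := ses_coker wI.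
have [_ [i [r ri]]] := ses_inj_retract wq HI.
have [|||[j Jj] [b [b0 bE]]] := IH J.
- apply: leq_trans Id; rewrite (ses_mdim wq) -[X in (X < _)%N]add0n ltn_add2r lt0n.
  apply/eqP => /mdim_eq0 H0; apply: ex; have x0 : x = 0.
    by apply: (inj_lin mI); apply: H0.
  by rewrite x0 linear0.
- by apply: (retract_injm II); exists i, r.
- move=> U u Ub [y uy]; apply: (Ib U (i \o u) Ub); exists y => /= iuy.
  by apply: uy; rewrite -(ri (u y)) iuy linear0.
have Ipd : pd_bound I (maxn h j).
  move=> X; apply: (Ext_midl wq).
    by apply: Ext_pd Hh _; apply: leq_maxl.
  by apply: Ext_pd Jj _; apply: leq_maxr.
split; first by exists (maxn h j).
exists (fun k => b k + (k == l)%:Z); split=> [k kb|k].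
  by rewrite b0 // add0r; case: eqP => // kl; case: lb; rewrite -kl.
have [c cE] := euler_char_ex (S k) Ipd.
have cV := euler_char_ses wq (VE k) cE (bE k).
have -> : \sum_l0 (b l0 + (l0 == l)%:Z) * V l0 k = c => //.
rewrite cV addrC; under eq_bigr do rewrite mulrDl.
rewrite big_split /=; congr (_ + _); rewrite (bigD1 l) //= eqxx mul1r big1 ?addr0 //.
by move=> i' /negPf ->; rewrite mul0r.
Qed.

(** In the hull sequence M -> J -> N, essentiality keeps bad simples out of the socle of J, and
    Ext^1(T, M) = 0 lifts a map from a bad T to N back to J. Additivity then expresses M as the
    difference of J and N. *)
Lemma finite_span r M : id_bound M r -> fpd M -> bad_free M ->
  (forall T i, bad T -> Ext i T M) -> in_span M.
Proof.
elim: r M => [|r IH] M.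
  by move=> /id_bound0 MI _ Mb _; case: (injective_span MI Mb).
move=> Mr [d Md] Mb Me; have [J [m [JI mI me]]] := hull_ex M.
have [N [q mq]] := ses_coker mI.
have Jb : bad_free J.
  move=> T u [Ts Tb] u0; have uI := simple_inj Ts u0.
  case: (u0) => x; apply; rewrite (_ : x = 0) ?linear0 //.
  apply: (me _ u uI) => a b ab; apply: contrapT => b0.
  have uM t : exists y, m y = u t.
    case: (Ts) => _ Tmax; apply: (Tmax (fun t => exists y, m y = u t)).
      split=> [|k v w [v' v'E] [w' w'E]]; first by exists 0; rewrite !linear0.
      by exists (k *: v' + w'); rewrite !linearP v'E w'E.
    by exists b => //; exists a.
  have [h hE] := lin_lift mI uM.
  apply: (Mb T h); first by split.
  by exists b => hb; apply: b0; apply: (inj_lin uI); rewrite -hE hb linear0.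
have [[e Je] [b [b0 bE]]] := injective_span JI Jb.
have Nd : pd_bound N (maxn d e).+1.
  apply: (pd_right mq); first by apply: pd_mono Md; apply: leq_maxl.
  by apply: pd_mono Je; rewrite leqW // leq_maxr.
have [||||c [c0 cE]] := IH N.
- by apply/(id_cosyz _ JI mq).
- by exists (maxn d e).+1.
- move=> T u Tb [x ux]; have [k kE] := E1_lift u (Me T 0%N Tb) mq.
  by apply: (Jb T k Tb); exists x => kx; apply: ux; rewrite -kE kx linear0.
- move=> T i Tb; apply: (Ext_rightr mq); [exact: Ext_inj | exact: Me].
exists (fun l => b l - c l); split=> [l lb|k]; first by rewrite b0 // c0 // subrr.
have [a aE] := euler_char_ex (S k) Md.
have E := euler_char_ses mq aE (bE k) (cE k).
have -> : \sum_l (b l - c l) * V l k = a => //.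
under eq_bigr do rewrite mulrBl.
by rewrite sumrB E addrK.
Qed.

(** A bad simple has no nonzero map to any term of the coresolution, which leaves no room for Hom or
    Ext into M. *)
Lemma cores_bad r M : cores finj r M ->
  bad_free M /\ forall T i, bad T -> Ext i T M.
Proof.
elim: r M => [|r IH] M.
  move=> MJ; split=> [T u [_ Tb]|T i _]; first exact: Tb.
  by apply: Ext_inj; case: MJ.
move=> [I [N [f [g [IJ fg /IH[Nb Ne]]]]]]; case: (fg) => fI _ _; split.
  move=> T u [_ Tb] [x ux]; apply: (Tb I (f \o u)) => //.
  by exists x => /= /(inj_lin fI).
move=> T [|i] Tb; last first.
  by apply: (Ext_leftr fg); [apply: Ne | apply: Ext_inj; case: IJ].
apply: (E1_of_lift fg); first by apply: E1_inj; case: IJ.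
move=> h; exists \0 => x; rewrite linear0.
by rewrite (not_nonzero (Nb T h Tb)).
Qed.

Lemma projective_span P : projective P -> in_span P.
Proof.
move=> PP; have [Rb Re] := cores_bad R_finj.
have /in_addP[t [i [r ri]]] : in_add (regular R) P by apply: proj_in_add.
apply: (finite_span (r := n)).
- exact: id_proj.
- by exists 0%N; apply/pd_bound0.
- move=> T u Tb [x ux]; apply: ux; rewrite -(ri (u x)).
  rewrite (_ : i (u x) = 0) ?linear0 //; apply: powm_ext => k; rewrite linear0.
  exact: (not_nonzero (Rb T (powm_pr _ k \o i \o u) Tb)).
move=> T k Tb; apply: (Ext_retractr (B := powm t (regular R))); first by exists i, r.
by apply: Ext_powr; apply: Re.
Qed.

(* Evaluating the Euler characteristics at projective covers gives D = B V with D *)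
(* diagonal and invertible, and the column of B at a bad simple is zero. *)
Lemma no_bad l : ~ bad (S l).
Proof.
move=> lb.
have cov k : exists P, projective P /\ exists (D : rat), D != 0 /\
    forall j, (topdim (S j) P)%:R = (if k == j then D else 0).
  have [P [p [PP p0 Pp]]] := proj_cover_simple (S_simple k).
  exists P; split=> //; exists (topdim (S k) P)%:R; split.
    by rewrite Num.Theory.pnatr_eq0; apply/eqP; apply: topdim_neq0 p0.
  move=> j; case: eqP => [->//|kj]; rewrite topdim0 // => f x.
  by apply: not_nonzero => f0; apply: kj; apply/S_uniq/(Pp _ f).
have [P PE] := choice cov.
have [D DE] := choice (fun k => (PE k).2).
have [b bE] := choice (fun k => projective_span (PE k).1).
pose B := \matrix_(k, j) ((b k j)%:~R : rat).
pose W := \matrix_(j, k) ((V j k)%:~R : rat).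
pose E := diag_mx (\row_k (D k)^-1).
have BW k j : (B *m W) k j = (if k == j then D k else 0).
  rewrite -(DE k).2 mxE pmulrn (euler_char_uniq (euler_char_proj (S j) (PE k).1)
    ((bE k).2 j)) rmorph_sum; apply: eq_bigr => i _.
  by rewrite !mxE rmorphM.
have BWE : B *m (W *m E) = 1%:M.
  rewrite mulmxA; apply/matrixP => k j; rewrite mul_mx_diag !mxE.
  have -> : \sum_i B k i * W i j = (B *m W) k j by rewrite mxE.
  rewrite BW; case: eqP => [->|_]; last by rewrite mul0r.
  by rewrite mulfV //; case: (DE j).
(* For square matrices the right inverse of [B] is also a left inverse, and the entry at (l, l) of
   that product sees only the column of [B] at l. *)
have /matrixP /(_ l l) := mulmx1C BWE; rewrite mxE big1 => [|i _].
  by rewrite mxE eqxx => /eqP; rewrite eq_sym oner_eq0.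
by rewrite [B i l]mxE (bE i).1 // mulr0.
Qed.

Lemma injective_fpd I : injective_mod I -> fpd I.
Proof.
move=> II; case: (injective_span II) => // T u [Ts Tb] _.
have [l lT] := S_all Ts; apply: (@no_bad l); split=> // J w Jf [x wx].
have [e [f [ef fe]]] := sim_iso (S_simple l) Ts lT.
by apply: (Tb J (w \o f) Jf); exists (e x); rewrite /= ef.
Qed.

End Count.

Theorem injectives_fpd n I : id_bound (regular R) n -> cores finj n (regular R) ->
  injective_mod I -> fpd I.
Proof.
move=> Rn Rf; have [s [S [S1 S2 S3]]] := simples_ex.
have [H [V HV]] := hulls S1.
exact: (injective_fpd Rn Rf S1 S2 S3 HV).
Qed.

End EulerCharacteristic.

(** * Modules over an algebra and over its opposite *)

Section FiniteDimensional.

Variables (K : fieldType) (R S : nzRingType) (F : fdalg K R) (G : fdalg K S).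
Variable p : antiiso F G.

Lemma dual_enough_inj (M : rmod R) : exists (J : rmod R) (j : {linear M -> J}),
  injective_mod J /\ injective j.
Proof.
have [P [q [PP qS]]] := enough_proj (dual p M).
have [J [f [fI fS]]] := dual_ess_surj p P.
have [g [gf fg]] := lin_bij fI fS.
have [j jE] := dmap_full (q \o f).
exists J, j; split.
  by apply: (@proj_dual _ _ _ _ _ p); apply: (retract_proj PP); exists f, g.
apply: (@inj_dmap _ _ _ _ _ p) => y; have [x <-] := qS y.
by exists (g x); rewrite jE /= fg.
Qed.

Lemma scale_central_subproof (c : K) (M : rmod R) (a : R^c) (x y : M) :
  (F c : R^c) *: (a *: x + y) = a *: ((F c : R^c) *: x) + (F c : R^c) *: y.
Proof.
rewrite scalerDr; congr (_ + _); rewrite !scalerA.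
by have -> : (F c : R^c) * a = a * (F c : R^c) by rewrite [LHS](esym (embC F c a)).
Qed.

(** Hom(M, N) is spanned over K by finitely many maps, and scalars from K are endomorphisms of M
    because they are central. *)
Lemma fd_add_approx (M N : rmod R) : exists r (f : {linear powm r M -> N}),
  forall g : {linear M -> N}, exists h : {linear M -> powm r M},
    forall x, f (h x) = g x.
Proof.
have [r [B [BE BS]]] := spanning_matrix
  (fun v => exists f : {linear M -> N}, mxvec (mx F f) = v).
have [f fE] := choice BE; exists r, (powm_sum f) => g.
have /submxP[D gD] : (mxvec (mx F g) <= B)%MS by apply: BS; exists g.
exists (powm_map (fun i => mklin (@scale_central_subproof (D 0 i) M))) => x.
have gE : mx F g = \sum_i D 0 i *: mx F (f i).
  apply: (can_inj mxvecK); rewrite gD mulmx_sum_row linear_sum.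
  by apply: eq_bigr => i _; rewrite linearZ -fE.
apply: (@co_inj _ _ F N); rewrite [RHS]co_mx gE mulmx_sumr /= linear_sum.
apply: eq_bigr => i _; rewrite ffunE /= -scalemxAr -co_mx.
have -> : f i ((F (D 0 i) : R^c) *: x) = D 0 i *: (f i x : kmod F N).
  by rewrite linearZ.
by rewrite linearZ.
Qed.

Definition fd_modcat : modcat R.
Proof.
apply: (@Modcat R (dimm F)).
- by move=> A B C f g /(ses_dim F)[].
- by move=> M /(dim0P F).
- exact: sub_ex F.
- exact: quot_ex F.
- exact: dual_enough_inj.
- exact: fd_add_approx.
Defined.

End FiniteDimensional.

(** * Homological bounds under duality *)

Section Transfer.

Variables (K : fieldType) (R S : nzRingType) (F : fdalg K R) (G : fdalg K S).
Variable p : antiiso F G.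
Context {HR : modcat R} {HS : modcat S}.
Implicit Types (M N : rmod R).

Lemma dual_id M n : id_bound M n <-> pd_bound (dual p M) n.
Proof.
elim: n M => [|n IH] M.
  rewrite id_bound0 pd_bound0; split; first exact: dual_inj.
  exact: proj_dual.
have [J [N [f [g [JJ fg]]]]] := inj_hull M.
have JP : projective (dual p J) by apply: dual_inj.
by rewrite (id_cosyz _ JJ fg) IH (pd_syz _ JP (dual_ses p fg)).
Qed.

Lemma dual_coAG k s M : coAG k s M -> AG k s (dual p M).
Proof.
elim: k s M => //= k IH s M [P [N [f [g [PP Ps fg /IH NG]]]]].
exists (dual p P), (dual p N), (dmap p g), (dmap p f); split=> //.
- exact: dual_proj.
- exact/dual_id.
exact: dual_ses.
Qed.

Lemma dual_pd M n : pd_bound M n <-> id_bound (dual p M) n.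
Proof.
elim: n M => [|n IH] M.
  rewrite id_bound0 pd_bound0; split; first exact: dual_proj.
  exact: inj_dual.
have [N [P [f [g [PP fg]]]]] := proj_cover M.
have PI : injective_mod (dual p P) by apply: dual_proj.
by rewrite (pd_syz _ PP fg) IH (id_cosyz _ PI (dual_ses p fg)).
Qed.

(** The dual of a power of W is not literally a power of the dual, so the retraction is transported
    component by component. *)
Lemma dual_in_add (W J : rmod R) : in_add (dual p W) (dual p J) -> in_add W J.
Proof.
move=> /in_addP[t [i [r ri]]]; apply/in_addP; exists t.
have [a aE] := choice (fun k => dmap_full (powm_pr (dual p W) k \o i)).
have [b bE] := choice (fun k => dmap_full (r \o powm_in (dual p W) k)).
exists (powm_map b), (powm_sum a) => x; apply/subr0_eq; move: x.
apply/(dmap_eq0 p ((powm_sum a \o powm_map b) \- idfun)) => y.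
have -> : dmap p ((powm_sum a \o powm_map b) \- idfun) y =
    \sum_k dmap p (b k) (dmap p (a k) y) - y.
  rewrite dmapE.
  have -> : mx F ((powm_sum a \o powm_map b) \- idfun) =
      \sum_k mx F (b k) *m mx F (a k) - 1%:M.
    apply: rV_mx => u; rewrite -[u](@ocK _ _ F J) -co_mx mulmxBr mulmx1 mulmx_sumr.
    rewrite linearB; congr (_ - _); rewrite /= linear_sum.
    by apply: eq_bigr => k _; rewrite ffunE !co_mx mulmxA.
  rewrite linearB /= trmx1 mulmxBr mulmx1 linear_sum mulmx_sumr; congr (_ - _).
  by apply: eq_bigr => k _; rewrite /= trmx_mul mulmxA.
rewrite -[in X in _ - X](ri y) [in X in _ - X](powm_eta (i y)) linear_sum.
apply/eqP; rewrite subr_eq0; apply/eqP; apply: eq_bigr => k _.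
by rewrite bE aE.
Qed.

End Transfer.

Section Regular.

Variables (K : fieldType) (R S : nzRingType) (F : fdalg K R) (G : fdalg K S).
Variable p : antiiso F G.
Context {HR : modcat R} {HS : modcat S}.
Implicit Types (M N : rmod R).

Lemma AG_iso k s M N (f : {linear N -> M}) (g : {linear M -> N}) :
  cancel f g -> cancel g f -> AG k s M -> AG k s N.
Proof.
case: k => //= k fg gf [I [L [i [q [II Is iq LG]]]]]; case: (iq) => iI iE qS.
exists I, L, (i \o f), q; split=> //; split=> // [|y].
  by apply: inj_comp iI _; apply: can_inj fg.
rewrite iE; split=> [[x <-]|[x <-]]; last by exists (f x).
by exists (g x); rewrite /= gf.
Qed.

End Regular.

Section Symmetry.

Variables (K : fieldType) (R S : nzRingType) (F : fdalg K R) (G : fdalg K S).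
Variable p : antiiso F G.
Context {HR : modcat R} {HS : modcat S}.
Implicit Types (M N : rmod R).

(** W is D(S), chosen so that [dual p W] is isomorphic to the regular module of S. It carries the
    injective dimension of S over to pd W, and the Auslander condition for S to its dual for W. *)
Lemma dual_regular : exists W : rmod R,
  [/\ injective_mod W, forall J, injective_mod J -> in_add W J,
      forall n, id_bound (regular S) n <-> pd_bound W n &
      (forall k, coAG k 0 W) -> forall k, AG k 0 (regular S)].
Proof.
have [W [f [fI fS]]] := dual_ess_surj p (regular S).
have [g [gf fg]] := lin_bij fI fS; exists W.
have r1 : retract (dual p W) (regular S) by exists f, g.
have r2 : retract (regular S) (dual p W) by exists g, f.
split.
- apply: (@proj_dual _ _ _ _ _ p).
  exact: retract_proj (@regular_projective S) r1.
- move=> J JJ; apply: (dual_in_add (p := p)).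
  have JP : projective (dual p J) by apply: dual_inj.
  have /in_addP[t Jt] : in_add (regular S) (dual p J) by apply: proj_in_add.
  apply/in_addP; exists t; apply: retract_trans Jt _.
  exists (powm_map (fun i => g \o powm_pr (regular S) i)).
  exists (powm_map (fun i => f \o powm_pr (dual p W) i)) => x.
  by apply: powm_ext => i; rewrite powm_mapE /= !ffunE fg.
- move=> n; rewrite (dual_pd p); split=> [Sn|Wn].
    exact: id_retract r1 Sn.
  exact: id_retract r2 Wn.
move=> H k; apply: (AG_iso fg gf); exact: (dual_coAG p).
Qed.

End Symmetry.

Section Equivalences.

Context {R : nzRingType} {HR : modcat R}.
Hypothesis R_AG : forall k, AG k 0 (regular R).

Lemma cochain_end (Q : rmod R -> Prop) k M C :
  cochain Q k M C -> Q C -> cores Q k M.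
Proof.
elim: k M => [|k IH] M /=; first by move=> ->.
by move=> [I [N [f [g [IQ fg /IH NC]]]]] CQ; exists I, N, f, g; split=> //; apply: NC.
Qed.

(** As id R <= n, the n-th cosyzygy is injective, and its pd is finite by the Auslander condition.
    The coresolution by injectives of finite pd required for the count is thus available. *)
Lemma pd_cogenerator n (W : rmod R) : id_bound (regular R) n -> injective_mod W ->
  pd_bound W n.
Proof.
move=> Rn WI; have [C [RC Cn]] := reg_cochain R_AG n.
have CI : injective_mod C.
  apply: E1_all_inj => X; apply: (cochain_Ext (i := 0) _ RC) => [I []//|].
  exact: Rn.
have RJ : cores finj n (regular R).
  apply: cores_sub (cochain_end RC (conj CI Cn)) => I [II In]; split=> //.
  by exists n.
have [d Wd] := injectives_fpd Rn RJ WI.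
exact: pd_finite Rn Wd.
Qed.

End Equivalences.

Lemma coresolution_AG (R : nzRingType) (HR : modcat R) k s (M : rmod R)
  (I : coresolution M) : (forall i, injective_mod (I i)) ->
  (forall i, (i < k)%N -> pd_le (I i) (s + i)) -> AG k s M.
Proof.
elim: k s M I => //= k IH s M I II Ik.
have [N [q [e [qE eE]]]] := cotail_ex I.
exists (I 0%N), N, (cores_aug I), q; split=> //.
  by apply/pd_leP; have := Ik 0%N isT; rewrite addn0.
apply: (IH _ _ (cores_tail qE eE)) => [i|i ik]; first exact: (II i.+1).
by have := Ik i.+1 ik; rewrite addnS.
Qed.

Lemma k_Gorenstein_AG (R : nzRingType) (HR : modcat R) :
  (forall k, (0 < k)%N -> k_Gorenstein R k) -> forall k, AG k 0 (regular R).
Proof.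
move=> H [//|k]; have [I [[II _ _] Ik]] := H k.+1 isT.
exact: (@coresolution_AG _ HR k.+1 0%N _ I II) Ik.
Qed.

(** * The algebra and its opposite as rings over the field *)

Section AlgebraAsRing.

Variables (K : fieldType) (A : falgType K).

Let emb (k : K) : A := k%:A.

Fact alg_embD : {morph emb : x y / x + y}.
Proof. by move=> x y; apply: scalerDl. Qed.
Fact alg_embM : {morph emb : x y / x * y}.
Proof. by move=> x y; rewrite /emb -scalerAl mul1r scalerA. Qed.
Fact alg_emb1 : emb 1 = 1.
Proof. exact: scale1r. Qed.
Fact alg_embC k a : emb k * a = a * emb k.
Proof. by rewrite /emb -scalerAl -scalerAr mul1r mulr1. Qed.
Fact alg_emb_gen : exists N (g : 'I_N -> A), forall a, exists c : 'I_N -> K,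
  a = \sum_i emb (c i) * g i.
Proof.
exists (\dim {:A}), (fun i => (vbasis {:A})`_i) => a.
exists (fun i => coord (vbasis {:A}) i a).
rewrite {1}(coord_vbasis (memvf a)); apply: eq_bigr => i _.
by rewrite /emb -scalerAl mul1r.
Qed.

Definition alg_fdalg : fdalg K A :=
  Fdalg alg_embD alg_embM alg_emb1 alg_embC alg_emb_gen.

Let oemb (k : K) : oppring A := k%:A : A.

Fact op_embM : {morph oemb : x y / x * y}.
Proof. by move=> x y; rewrite mulrC; apply: alg_embM. Qed.
Fact op_embC k a : oemb k * a = a * oemb k.
Proof. by apply: esym; apply: alg_embC. Qed.
Fact op_emb_gen : exists N (g : 'I_N -> oppring A), forall a, exists c : 'I_N -> K,
  a = \sum_i oemb (c i) * g i.
Proof.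
have [N [g gE]] := alg_emb_gen; exists N, g => a; have [c cE] := gE a.
by exists c; rewrite [LHS]cE; apply: eq_bigr => i _; apply: alg_embC.
Qed.

Definition op_fdalg : fdalg K (oppring A) :=
  @Fdalg K (oppring A) oemb alg_embD op_embM alg_emb1 op_embC op_emb_gen.

Definition op_antiiso : antiiso alg_fdalg op_fdalg :=
  @Antiiso K A (oppring A) alg_fdalg op_fdalg (fun x => x) (fun _ _ => erefl)
    (fun _ _ => erefl) erefl (fun=> erefl) (fun x => x) (fun=> erefl) (fun=> erefl).

End AlgebraAsRing.

Section OneSide.

Variables (K : fieldType) (R S : nzRingType) (F : fdalg K R) (G : fdalg K S).
Variable p : antiiso F G.
Context {HR : modcat R} {HS : modcat S}.
Hypothesis R_AG : forall k, AG k 0 (regular R).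

Lemma AG_opposite k : AG k 0 (regular S).
Proof.
have [W [WI _ _]] := @dual_regular K R S F G p HR HS; apply=> l.
by apply: (coAG_ex R_AG); apply/id_bound0.
Qed.

Lemma id_opposite n : id_bound (regular R) n -> id_bound (regular S) n.
Proof.
move=> Rn; have [W [WI _ SW _]] := @dual_regular K R S F G p HR HS.
by apply/SW; apply: (pd_cogenerator R_AG).
Qed.

Lemma one_side_minimum n : id_bound (regular R) n -> tilt_has_minimum_pd_le R n.
Proof.
move=> Rn; have [W [WI WC _ _]] := @dual_regular K R S F G p HR HS.
by apply: (minimum_of_Gorenstein WI WC Rn); apply: (pd_cogenerator R_AG).
Qed.

Lemma one_side_finite n : id_bound (regular R) n ->
  contravariantly_finite (Pinfty R) /\ forall M, Pinfty R M <-> Pn R n M.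
Proof.
move=> Rn; have [W [WI WC _ _]] := @dual_regular K R S F G p HR HS.
have Wn : pd_bound W n by apply: (pd_cogenerator R_AG).
split=> [|M]; last exact: Pinfty_Pn.
exact: (contravariantly_finite_of_Gorenstein WI WC Rn).
Qed.

End OneSide.

Theorem corollary1p3 (K : closedFieldType) (A : falgType K)
  (A_basic : basic A) (A_connected : connected A)
  (A_Gorenstein : forall k : nat, (0 < k)%N -> k_Gorenstein A k)
  (n : nat) :
  [<-> Iwanaga_Gorenstein A /\
         (exists d : nat, [/\ id_eq (regular A) d,
                              id_eq (regular (oppring A)) d & (d <= n)%N]);
       id_le (regular A) n;
       id_le (regular (oppring A)) n;
       tilt_has_minimum_pd_le A n;
       tilt_has_minimum_pd_le (oppring A) n;
       contravariantly_finite (Pinfty A) /\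
         (forall M : rmod A, Pinfty A M <-> Pn A n M);
       contravariantly_finite (Pinfty (oppring A)) /\
         (forall M : rmod (oppring A),
            Pinfty (oppring A) M <-> Pn (oppring A) n M)].
Proof.
pose p := op_antiiso A; pose q := antiinv p.
pose HR := fd_modcat p; pose HS := fd_modcat q.
have R_AG := k_Gorenstein_AG HR A_Gorenstein.
have S_AG : forall k, AG k 0 (regular (oppring A)).
  by move=> k; apply: (@AG_opposite _ _ _ _ _ p HR HS).
(* Exchanging [p] with its inverse [q] turns one implication into the other, so every condition on
   one side can be crossed over through the injective dimension. *)
have RS m : id_le (regular A) m <-> id_le (regular (oppring A)) m.
  rewrite (@id_leP _ HR) (@id_leP _ HS).
  split; first exact: (@id_opposite _ _ _ _ _ p HR HS).
  exact: (@id_opposite _ _ _ _ _ q HS HR).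
tfae.
- by move=> [_ [d [[Rd _] _ dn]]]; apply/(@id_leP _ HR)/(id_mono dn)/(@id_leP _ HR).
- by move/RS.
- move/RS/(@id_leP _ HR); exact: (@one_side_minimum _ _ _ _ _ p HR HS).
- move/(@id_of_minimum _ HR R_AG)/(@id_leP _ HR)/RS/(@id_leP _ HS).
  exact: (@one_side_minimum _ _ _ _ _ q HS HR).
- move/(@id_of_minimum _ HS S_AG)/(@id_leP _ HS)/RS/(@id_leP _ HR).
  exact: (@one_side_finite _ _ _ _ _ p HR HS).
- move=> [_ /(@id_of_Pinfty _ HR R_AG)/(@id_leP _ HR)/RS/(@id_leP _ HS)].
  exact: (@one_side_finite _ _ _ _ _ q HS HR).
move=> [_ /(@id_of_Pinfty _ HS S_AG)/(@id_leP _ HS) Sn].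
(* [RS] holds for every bound, so the least bound for A is also the least one for the opposite
   algebra. *)
have ex : exists d, `[< id_le (regular A) d >] by exists n; apply/asboolP/RS.
case: (ex_minnP ex) => d /asboolP Rd dmin; split.
  by split; exists n => //; apply/RS.
exists d; split; last by apply/dmin/asboolP/RS.
  by split=> // m Rm; apply/dmin/asboolP.
by split=> [|m /RS Rm]; [apply/RS | apply/dmin/asboolP].
Qed.
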